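(* Let $\mathbb D,\mathbb E$ be Banach spaces with norms $\|\cdot\|_{\mathbb D},\|\cdot\|_{\mathbb E}$, let $\mathbb D_0\subseteq\mathbb D$, $\mathbb D_\phi\subseteq\mathbb D$, $\theta_0\in\mathbb D_\phi$, and let $\phi:\mathbb D_\phi\to\mathbb E$. Suppose: (1) $\phi$ is Hadamard directionally differentiable at $\theta_0$ tangentially to $\mathbb D_0$, and its derivative $\phi'_{\theta_0}:\mathbb D_0\to\mathbb E$ can be extended to a continuous map on all of $\mathbb D$ (also denoted $\phi'_{\theta_0}$). (2) There are maps $\hat\theta_n:\{X_i\}_{i=1}^n\to\mathbb D_\phi$ and scalars $r_n\uparrow\infty$ with $r_n\{\hat\theta_n-\theta_0\}\stackrel{L}{\rightarrow}\mathbb G_0$ in $\mathbb D$, where $\mathbb G_0$ is tight and its support is included in $\mathbb D_0$. (3) $\hat\theta_n^*:\{X_i,W_i\}_{i=1}^n\to\mathbb D_\phi$ with $\{W_i\}_{i=1}^n$ independent of $\{X_i\}_{i=1}^n$, and $$\sup_{f\in \mathrm{BL}_1(\mathbb D)}\big|E[f(r_n\{\hat\theta_n^*-\hat\theta_n\})|\{X_i\}_{i=1}^n]-E[f(\mathbb G_0)]\big|=o_p(1).$$ (4) The sequence $r_n\{\hat\theta_n^*-\hat\theta_n\}$ is asymptotically measurable (jointly in $\{X_i,W_i\}_{i=1}^n$), and for every continuous bounded $f:\mathbb D\to\mathbf R$, $f(r_n\{\hat\theta_n^*-\hat\theta_n\})$ is a measurable function of $\{W_i\}_{i=1}^n$ outer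 almost surely in $\{X_i\}_{i=1}^n$. (5) $\mathbb G_0$ is a Gaussian measure whose support is a vector subspace of $\mathbb D$. Then $\phi$ is (fully) Hadamard differentiable at $\theta_0$ tangentially to the support of $\mathbb G_0$ if and only if $$\sup_{f\in \mathrm{BL}_1(\mathbb E)}\big|E[f(r_n\{\phi(\hat\theta_n^* )-\phi(\hat\theta_n)\})|\{X_i\}_{i=1}^n]-E[f(\phi'_{\theta_0}(\mathbb G_0))]\big|=o_p(1).$$
   Context: Banach spaces are over the reals. A map $\phi:\mathbb D_\phi\subseteq\mathbb D\to\mathbb E$ is Hadamard differentiable at $\theta\in\mathbb D_\phi$ tangentially to $\mathbb D_0\subseteq\mathbb D$ if there is a continuous linear map $\phi'_\theta:\mathbb D_0\to\mathbb E$ with $\lim_{n}\|\{\phi(\theta+t_nh_n)-\phi(\theta)\}/t_n-\phi'_\theta(h)\|_{\mathbb E}=0$ for all sequences $\{h_n\}\subset\mathbb D$, $\{t_n\}\subset\mathbf R$ with $t_n\to0$, $h_n\to h\in\mathbb D_0$ and $\theta+t_nh_n\in\mathbb D_\phi$ for all $n$. It is Hadamard directionally differentiable at $\theta$ tangentially to $\mathbb D_0$ if there is a continuous (not necessarily linear) map $\phi'_\theta:\mathbb D_0\to\mathbb E$ such that the same limit holds for all $\{h_n\}\subset\mathbb D$, $\{t_n\}\subset\mathbf R_+$ with $t_n\downarrow0$, $h_n\to h\in\mathbb D_0$ and $\theta+t_nh_n\in\mathbb D_\phi$ for all $n$. $\{X_i\}_{i=1}^n$ is the data and $\{W_i\}_{i=1}^n$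 are random weights; $\hat\theta_n:\{X_i\}_{i=1}^n\to\mathbb D_\phi$ means $\hat\theta_n$ is a (not necessarily measurable) $\mathbb D_\phi$-valued function of the data, and similarly for $\hat\theta_n^*$. Convergence in distribution $\stackrel{L}{\to}$ is in the Hoffman-Jørgensen sense: $Z_n\stackrel{L}{\to}Z$ ($Z$ Borel) means $E^*[f(Z_n)]\to E[f(Z)]$ for all bounded continuous real $f$, where $E^*$ is outer expectation ($E_*$ inner expectation). Expectations and probabilities of possibly nonmeasurable objects are outer ones; $o_p(1)$ is convergence to zero in outer probability. $E[\,\cdot\,|\{X_i\}_{i=1}^n]$ denotes outer expectation with respect to the joint law of $\{W_i\}_{i=1}^n$ treating the data as constant. $Z_n$ is asymptotically measurable if $E^*[f(Z_n)]-E_*[f(Z_n)]\to0$ for all bounded continuous $f$. For a normed space $\mathbf A$, $\mathrm{BL}_1(\mathbf A)=\{f:\mathbf A\to\mathbf R:\ |f(a)|\le1,\ |f(a)-f(a')|\le\|a-a'\|_{\mathbf A}\ \forall a,a'\in\mathbf A\}$. $\mathbb G_0$ is a Borel random element of $\mathbb D$, identified with its law; a Gaussian measure need not be centered. *)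

(* Defs.v *)
From HB Require Import structures.
From mathcomp Require Export all_boot all_order all_algebra.
From mathcomp Require Export all_classical all_reals all_analysis.
From mathcomp Require Export measurable_realfun.

Set Implicit Arguments.
Unset Strict Implicit.
Unset Printing Implicit Defensive.

Export Order.TTheory GRing.Theory Num.Theory.
Export numFieldNormedType.Exports.

Local Open Scope classical_set_scope.
Local Open Scope ring_scope.

Section hadamard.
Context {R : realType} {D E : normedModType R}.

(* Maps with domain [Dphi] or [D0] are represented by total functions whose
   values outside the domain are never used. *)

Definition linear_on (D0 : set D) (dphi : D -> E) :=
  forall (a : R) (x y : D), D0 x -> D0 y -> D0 (a *: x + y) ->
    dphi (a *: x + y) = a *: dphi x + dphi y.

(* The difference quotient requires [t n != 0] (division by 0 is total). *)
Definition is_hadamard_derivative (phi : D -> E) (Dphi : set D)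
    (theta : D) (D0 : set D) (dphi : D -> E) :=
  [/\ {within D0, continuous dphi}, linear_on D0 dphi &
      forall (h : nat -> D) (t : nat -> R) (h0 : D),
        (forall n, t n != 0) -> t @ \oo --> 0 ->
        h @ \oo --> h0 -> D0 h0 ->
        (forall n, Dphi (theta + t n *: h n)) ->
        (fun n => `| (t n)^-1 *: (phi (theta + t n *: h n) - phi theta)
                     - dphi h0 |) @ \oo --> (0 : R)].

Definition hadamard_differentiable (phi : D -> E) (Dphi : set D)
    (theta : D) (D0 : set D) :=
  exists dphi, is_hadamard_derivative phi Dphi theta D0 dphi.

Definition is_hadamard_directional_derivative (phi : D -> E) (Dphi : set D)
    (theta : D) (D0 : set D) (dphi : D -> E) :=
  {within D0, continuous dphi} /\
  forall (h : nat -> D) (t : nat -> R) (h0 : D),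
    (forall n, 0 < t n) -> nonincreasing_seq t -> t @ \oo --> 0 ->
    h @ \oo --> h0 -> D0 h0 ->
    (forall n, Dphi (theta + t n *: h n)) ->
    (fun n => `| (t n)^-1 *: (phi (theta + t n *: h n) - phi theta)
                 - dphi h0 |) @ \oo --> (0 : R).

End hadamard.

Section outer.
Local Open Scope ereal_scope.
Context {d : measure_display} {T : measurableType d} {R : realType}.
Variable P : probability T R.

(* The middle condition says that the expectation of [U] exists: the library
   integral of a function for which both parts are infinite is a junk value. *)
Definition outer_expectation (g : T -> R) : \bar R :=
  ereal_inf [set \int[P]_x U x | U in
    [set U : T -> \bar R |
      [/\ measurable_fun [set: T] U,
          \int[P]_x U^\+ x < +oo \/ \int[P]_x U^\- x < +oo &
          forall x, (g x)%:E <= U x]]].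

Definition inner_expectation (g : T -> R) : \bar R :=
  - outer_expectation (fun x => - g x)%R.

Definition outer_probability (A : set T) : \bar R :=
  ereal_inf [set P B | B in [set B | measurable B /\ A `<=` B]].

End outer.

Definition bounded_continuous {R : realType} {A : normedModType R}
    (f : A -> R) :=
  continuous f /\ exists M : R, forall a, `|f a| <= M.

Definition BL1 {R : realType} (A : normedModType R) : set (A -> R) :=
  [set f | (forall a, `|f a| <= 1) /\
           (forall a b, `|f a - f b| <= `|a - b|)].
Arguments BL1 {R} A.

Notation borel A := (g_sigma_algebraType (@open A)).

Section borel_laws.
Context {R : realType} {D : normedModType R}.
Variable G : probability (borel D) R.

Definition tight :=
  forall e : R, 0 < e -> exists2 K : set D, compact K & ((1 - e)%:E <= G K)%E.

Definition law_support : set D :=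
  [set x | forall U : set D, open U -> U x -> (0 < G U)%E].

(* Laws concentrated at a point are Gaussian; [normal_prob m s] is the normal
   law with mean m and standard deviation s only for [s != 0]. *)
Definition gaussian :=
  forall l : {linear D -> R^o}, continuous l ->
    exists m s : R, forall B : set (measurableTypeR R), measurable B ->
      G (l @^-1` B) = if s == 0 then \d_m B else normal_prob m s B.

End borel_laws.

Definition vector_subspace {R : realType} {D : normedModType R} (S : set D) :=
  S 0 /\ forall (a : R) (x y : D), S x -> S y -> S (a *: x + y).

Section asymptotics.
Context {R : realType} {d : measure_display} (T : nat -> measurableType d).
Variable P : forall n, probability (T n) R.

Definition cvg_in_law {A : normedModType R} (Z : forall n, T n -> A)
    (G : probability (borel A) R) :=
  forall f : A -> R, bounded_continuous f ->
    outer_expectation (P n) (fun x => f (Z n x)) @[n --> \oo] -->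
      (\int[G]_z (f z)%:E)%E.

Definition asymptotically_measurable {A : normedModType R}
    (Z : forall n, T n -> A) :=
  forall f : A -> R, bounded_continuous f ->
    (outer_expectation (P n) (fun x => f (Z n x))
     - inner_expectation (P n) (fun x => f (Z n x)))%E @[n --> \oo] --> 0%E.

Definition cvg_to0_in_outer_probability (S : forall n, T n -> \bar R) :=
  forall e : R, 0 < e ->
    outer_probability (P n) [set x | e%:E < `|S n x|]%E @[n --> \oo] --> 0%E.

End asymptotics.

(* [L] is a joint law with marginals [P] and [Q] under which the two
   coordinates are independent. *)
Definition independent_joint_law {R : realType} {d d' : measure_display}
    {T : measurableType d} {T' : measurableType d'}
    (L : probability (T * T')%type R)
    (P : probability T R) (Q : probability T' R) :=
  forall (A : set T) (B : set T'), measurable A -> measurable B ->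
    L (A `*` B) = (P A * Q B)%E.

(* Main.v *)
(* Conditionally on the data, r_n(phi(theta_star) - phi(theta_hat)) behaves like
   phi'(h + z) - phi'(h), where h is the value of r_n(theta_hat - theta_0) and z
   has law G0; composing with a bounded Lipschitz f gives an almost Lipschitz
   function of z near any compact set, so that f is squeezed between Lipschitz
   functions controlled by the consistency of theta_star.  If phi' is linear on the
   support S of G0 the increment is phi'(z) and the bootstrap is consistent.
   Conversely, tightness of the data part lets h approach any point of S, so
   consistency forces, for every h in S,
     phi'(h + G0) - phi'(h)  and  phi'(G0)  to have the same law.     (H)
   Full differentiability on S is linearity of phi' on S; as phi' is positively
   homogeneous there, additivity remains to be derived from (H).  Let X, Y be
   independent with law G0 and let l be a functional of norm at most 1.  The
   variable l(phi'(X + Y) - phi'(Y)) has the law of l(phi'(X)), while by (H) and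
   Fubini its excess over l(phi'(X)) has mean zero given X; the equality case of
   Jensen's inequality for the strictly convex sqrt(1 + t^2) makes this excess
   vanish on S x S, and the functionals l separate points.

   This needs a first moment for G0, which is where normality enters.  If Z is
   the difference of two independent copies of G0, then sqrt 2 Z has the law of
   the sum of two independent copies of Z, which yields
     P(|Z| > sqrt 2 t + a + eta) <= (4/7) P(|Z| > t)
   for a fixed a, hence a geometric tail.  That equality of the functionals'
   characteristic functions is enough to compare the tails of the norms on a
   nonseparable space is obtained by approximating indicators of norm balls, on
   a compact set, by polynomials in cosines of finitely many norming functionals. *)

From HB Require Import structures.
Require Import Defs.
From mathcomp Require Import finmap ring lra.

Set Implicit Arguments.
Unset Strict Implicit.
Unset Printing Implicit Defensive.

Local Open Scope classical_set_scope.
Local Open Scope ring_scope.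

(** * Outer expectations and Borel sets *)

(** Neither space is assumed separable, so addition need not be measurable for the product of the
    Borel sigma-algebras. The Fubini arguments are therefore run on the square of a separable Borel
    set of full measure, which tightness provides. The estimators are not measurable either: bounds
    from below on outer expectations come from majorants of [- f], and good data points are found by
    subadditivity of outer probability. In the Jensen step put psi = l o phi' and u(t) = sqrt(1 +
    t^2). The tangent of u at psi(X) bounds u(psi(X + Y) - psi(Y)) - u(psi(X)) from below by
    u'(psi(X)) times the excess. The former has mean zero given Y, the latter given X, so their
    difference is nonnegative with mean zero; being continuous, it vanishes on S x S. A square in
    place of u would need a second moment, whereas u is Lipschitz. The factor 4/7 is 1/(2 * 7/8):
    two symmetric events give the 2, and a radius [a] with P(|Z| > a) <= 1/8 gives the 7/8. Radii
    grow by 3/2, which exceeds sqrt 2, and 3/2 * 4/7 = 6/7 < 1 makes the series for the first moment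
    converge. *)

Section borel.
Context {R : realType}.

Lemma open_borel (V : normedModType R) (U : set V) :
  open U -> measurable (U : set (borel V)).
Proof. by move=> oU; apply: sub_sigma_algebra. Qed.

Lemma closed_borel (V : normedModType R) (F : set V) :
  closed F -> measurable (F : set (borel V)).
Proof.
move=> cF; rewrite -(setCK F); apply: measurableC; apply: open_borel.
exact: closed_openC.
Qed.

Lemma compact_borel (V : normedModType R) (K : set V) :
  compact K -> measurable (K : set (borel V)).
Proof. by move=> cK; apply: closed_borel; apply: compact_closed. Qed.

Lemma continuous_borel (V : normedModType R) (f : V -> R) :
  continuous f -> measurable_fun [set: borel V] (f : borel V -> R).
Proof.
move=> /continuousP cf; apply: (measurability _ (RGenOpens.measurableE R)).
move=> _ [_ [a [b ->] <-]]; rewrite setTI; apply: open_borel.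
by apply: cf; exact: interval_open.
Qed.

Lemma continuous_borel_integrable (V : normedModType R) (P : probability (borel V) R)
   (f : V -> R) :
  bounded_continuous f -> P.-integrable [set: borel V] (fun x => (f x)%:E).
Proof.
move=> [cf [M fM]]; apply: measurable_bounded_integrable => //.
- by apply: (le_lt_trans (probability_le1 P measurableT)); rewrite ltry.
- exact: continuous_borel.
- exists M; split; first exact: num_real.
  by move=> x Mx y _; apply: le_trans (fM y) (ltW Mx).
Qed.

End borel.

Lemma measure_le d (T : measurableType d) (R : realType)
    (P : {measure set T -> \bar R}) (A B : set T) :
  measurable A -> measurable B -> A `<=` B -> (P A <= P B)%E.
Proof. by move=> mA mB; apply: le_measure; apply: mem_set. Qed.

Section outer_lemmas.
Local Open Scope ereal_scope.
Context {d : measure_display} {T : measurableType d} {R : realType}.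
Variable P : probability T R.
Implicit Types g : T -> R.

Lemma le_outer_expectation g1 g2 : (forall x, g1 x <= g2 x)%R ->
  outer_expectation P g1 <= outer_expectation P g2.
Proof.
move=> g12; apply: ereal_inf_le_tmp => _ [U [mU fU gU] <-].
exists U => //; split => // x; apply: le_trans (gU x).
by rewrite lee_fin.
Qed.

(** Dividing a majorant of [c * g] by [c] gives a majorant of [g]. The opposite inequality, in
    [outer_expectationZ], is this one for [c^-1] and the function [c * g]. *)
Let outer_expectationZ_ge (c : R) g : (0 < c)%R ->
  c%:E * outer_expectation P g <= outer_expectation P (fun x => c * g x)%R.
Proof.
move=> c0; apply: le_ereal_inf_tmp => _ [U [mU fU gU] <-].
rewrite -lee_pdivlMl//.
have ci : (0 < c^-1)%R by rewrite invr_gt0.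
have pE : (fun x => c^-1%:E * U x)^\+ = (fun x => c^-1%:E * U^\+ x).
  by apply/funext => x; rewrite ge0_funeposM// ltW.
have nE : (fun x => c^-1%:E * U x)^\- = (fun x => c^-1%:E * U^\- x).
  by apply/funext => x; rewrite ge0_funenegM// ltW.
have mp : measurable_fun [set: T] U^\+ by exact: measurable_funepos.
have mn : measurable_fun [set: T] U^\- by exact: measurable_funeneg.
have Zp : \int[P]_x (c^-1%:E * U^\+ x) = c^-1%:E * \int[P]_x U^\+ x.
  by rewrite ge0_integralZl// lee_fin ltW.
have Zn : \int[P]_x (c^-1%:E * U^\- x) = c^-1%:E * \int[P]_x U^\- x.
  by rewrite ge0_integralZl// lee_fin ltW.
(* [U] need not be integrable; since one of its parts has a finite integral, the difference of the
   two integrals is not of the form oo - oo and the factor distributes. *)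
have -> : c^-1%:E * \int[P]_x U x = \int[P]_x (c^-1%:E * U x).
  rewrite [in RHS]integralE pE nE Zp Zn integralE muleBr//.
  have [p0 n0] : 0 <= \int[P]_x U^\+ x /\ 0 <= \int[P]_x U^\- x.
    by split; exact: integral_ge0.
  case: fU => fU.
    by apply: fin_num_adde_defr; rewrite ge0_fin_numE.
  by apply: fin_num_adde_defl; rewrite fin_numN ge0_fin_numE.
apply: ereal_inf_lbound; exists (fun x => c^-1%:E * U x) => //; split.
- exact: measurable_funeM.
- rewrite pE nE Zp Zn; case: fU => fU; [left|right].
    by rewrite lte_mul_pinfty// ?lee_fin ?ltW.
  by rewrite lte_mul_pinfty// ?lee_fin ?ltW.
- by move=> x; rewrite lee_pdivlMl// -EFinM.
Qed.

Lemma outer_expectationZ (c : R) g : (0 < c)%R ->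
  outer_expectation P (fun x => c * g x)%R = c%:E * outer_expectation P g.
Proof.
move=> c0; apply/eqP; rewrite eq_le outer_expectationZ_ge// andbT.
rewrite -lee_pdivrMl//.
have ci : (0 < c^-1)%R by rewrite invr_gt0.
apply: (le_trans (outer_expectationZ_ge _ ci)).
by apply: le_outer_expectation => x; rewrite mulrA mulVf ?mul1r// gt_eqF.
Qed.

Lemma integral_cst_prob (c : R) : \int[P]_x (cst c%:E) x = c%:E.
Proof. by rewrite integral_cst//= probability_setT mule1. Qed.

Lemma outer_expectation_le_cst (c : R) g : (forall x, g x <= c)%R ->
  outer_expectation P g <= c%:E.
Proof.
move=> gc; apply: ereal_inf_lbound; exists (cst c%:E); last exact: integral_cst_prob.
split; first exact: measurable_cst.
  have [c0|c0] := leP 0%R c; [right|left].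
    rewrite integral0_eq ?ltry// => x _.
    by rewrite funenegE; apply/max_idPr; rewrite leeNl oppe0 lee_fin.
  rewrite integral0_eq ?ltry// => x _.
  by rewrite funeposE; apply/max_idPr; rewrite lee_fin ltW.
by move=> x; rewrite lee_fin.
Qed.

Lemma outer_expectation_ge_cst (c : R) g : (forall x, c <= g x)%R ->
  c%:E <= outer_expectation P g.
Proof.
move=> gc; apply: le_ereal_inf_tmp => _ [U [mU fU gU] <-].
have cU x : c%:E <= U x by apply: le_trans (gU x); rewrite lee_fin.
have iU : \int[P]_x U^\- x < +oo.
  apply: (@le_lt_trans _ _ (\int[P]_x (cst `|c|%:E) x)).
    apply: ge0_le_integral => //; first exact: measurable_funeneg.
    move=> x _; rewrite funenegE ge_max lee_fin normr_ge0 andbT.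
    apply: (@le_trans _ _ (- c%:E)); first by rewrite leeN2.
    by rewrite -EFinN lee_fin -normrN ler_norm.
  by rewrite integral_cst_prob ltry.
rewrite -(integral_cst_prob c) [leLHS]integralE [leRHS]integralE.
apply: leeB.
  apply: ge0_le_integral => //.
    exact: measurable_funepos.
    exact: measurable_funepos.
  by move=> x _; apply: (funepos_le (D := setT)) => [y _|]; [exact: cU|exact: mem_set].
apply: ge0_le_integral => //.
  exact: measurable_funeneg.
  exact: measurable_funeneg.
by move=> x _; apply: (funeneg_le (D := setT)) => [y _|]; [exact: cU|exact: mem_set].
Qed.

Lemma outer_expectation_fin_num (M : R) g : (forall x, `|g x| <= M)%R ->
  outer_expectation P g \is a fin_num.
Proof.
move=> gM; rewrite fin_numE; apply/andP; split.
  rewrite gt_eqF// (lt_le_trans (ltNyr (- M)%R))// outer_expectation_ge_cst// => x.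
  by have := gM x; rewrite ler_norml => /andP[].
rewrite lt_eqF// (le_lt_trans _ (ltry M))// outer_expectation_le_cst// => x.
by have := gM x; rewrite ler_norml => /andP[].
Qed.

Lemma le_outer_probability (A B : set T) : A `<=` B ->
  outer_probability P A <= outer_probability P B.
Proof.
move=> AB; apply: ereal_inf_le_tmp => _ [C [mC BC] <-].
by exists C => //; split => //; exact: subset_trans BC.
Qed.

Lemma outer_probability_ge0 (A : set T) : 0 <= outer_probability P A.
Proof. by apply: le_ereal_inf_tmp => _ [C [mC BC] <-]. Qed.

Lemma outer_probability_le1 (A : set T) : outer_probability P A <= 1.
Proof.
apply: ereal_inf_lbound; exists setT; last exact: probability_setT.
by split.
Qed.

Lemma outer_probabilityU (A B : set T) :
  outer_probability P (A `|` B) <= outer_probability P A + outer_probability P B.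
Proof.
have fin C : outer_probability P C \is a fin_num.
  rewrite ge0_fin_numE ?outer_probability_ge0//.
  by rewrite (le_lt_trans (outer_probability_le1 _))// ltry.
apply/lee_addgt0Pr => e e0.
have e2 : (0 < e / 2)%R by rewrite divr_gt0.
have [_ [A' [mA' AA'] <-] hA] := lb_ereal_inf_adherent e2 (fin A).
have [_ [B' [mB' BB'] <-] hB] := lb_ereal_inf_adherent e2 (fin B).
apply: (@le_trans _ _ (P (A' `|` B'))).
  apply: ereal_inf_lbound; exists (A' `|` B') => //; split.
    exact: measurableU.
  exact: setUSS.
apply: (le_trans (measureU2 _ _ _)) => //.
rewrite [e in e%:E](splitr e) EFinD addeACA.
by apply: leeD; apply/ltW.
Qed.

(** For each majorant [U] of [g] the set where [U] is at least 1 is a measurable cover of [A], to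
    which the usual Markov inequality applies. *)
Lemma outer_markov (A : set T) g : (forall x, 0 <= g x)%R ->
  (forall x, A x -> 1 <= g x)%R -> outer_probability P A <= outer_expectation P g.
Proof.
move=> g0 Ag; apply: le_ereal_inf_tmp => _ [U [mU fU gU] <-].
have U0 x : 0 <= U x by apply: le_trans (gU x); rewrite lee_fin.
have mB : measurable [set x | 1%:E <= U x].
  by rewrite -[X in measurable X]setTI; apply: emeasurable_fun_c_infty.
apply: (@le_trans _ _ (P [set x | 1%:E <= U x])).
  apply: ereal_inf_lbound; eexists; last reflexivity; split => //.
  by move=> x /Ag gx /=; apply: le_trans (gU x); rewrite lee_fin.
rewrite -[leLHS]mul1e -integral_cst// integral_mkcond.
apply: ge0_le_integral => //.
- by move=> x _; rewrite patchE; case: ifP.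
- apply/(measurable_restrictT _ _).1 => //.
- move=> x _; rewrite patchE; case: ifPn => //.
  by move/set_mem.
Qed.

(** The indicator of any measurable cover of [A] is a competitor in the infimum defining the outer
    expectation of [g]. *)
Lemma outer_expectation_le_prob (A : set T) g : (forall x, g x <= 1)%R ->
  (forall x, ~ A x -> g x <= 0)%R -> outer_expectation P g <= outer_probability P A.
Proof.
move=> g1 Ag; apply: le_ereal_inf_tmp => _ [C [mC AC] <-].
apply: ereal_inf_lbound; exists (fun x => (\1_C x)%:E); last first.
  by rewrite integral_indic// setIT.
split.
- by apply/measurable_EFinP; exact: measurable_indic.
- right; rewrite integral0_eq ?ltry// => x _.
  by rewrite funenegE; apply/max_idPr; rewrite leeNl oppe0 lee_fin indicE.
- move=> x; rewrite lee_fin indicE; case: (boolP (x \in C)) => [_|xC].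
    exact: g1.
  by apply: Ag => /AC; move: xC; rewrite notin_setE.
Qed.

End outer_lemmas.

(** * Lipschitz majorants and the support of a tight law *)

Section infconv.
Context {R : realType} {V : normedModType R}.
Implicit Types (K : set V) (g : V -> R) (x y k : V) (L c : R).

(** McShane's formula: for nonempty [K], [L >= 0] and [g] bounded below on [K], this is the largest
    [L]-Lipschitz function that stays below [g] on [K]. *)
Definition infconv K g L x : R := inf [set g k + L * `|x - k| | k in K].

Definition distance_to K x : R := infconv K (fun=> 0) 1 x.

Lemma infconv_ge K g L c x : K !=set0 ->
  (forall k, K k -> c <= g k + L * `|x - k|) -> c <= infconv K g L x.
Proof.
move=> [k0 Kk0] h; apply: lb_le_inf; first by exists (g k0 + L * `|x - k0|), k0.
by move=> _ [k Kk <-]; exact: h.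
Qed.

Lemma infconv_le K g L x k : 0 <= L -> (exists c, forall k, K k -> c <= g k) ->
  K k -> infconv K g L x <= g k + L * `|x - k|.
Proof.
move=> L0 [c gc] Kk; apply: ge_inf; last by exists k.
exists c => _ [k' Kk' <-]; rewrite -[c]addr0 lerD ?gc// mulr_ge0//.
Qed.

Lemma infconv_lip K g L x y : 0 <= L -> (exists c, forall k, K k -> c <= g k) ->
  K !=set0 -> `|infconv K g L x - infconv K g L y| <= L * `|x - y|.
Proof.
move=> L0 gc K0.
have h a b : infconv K g L a - L * `|a - b| <= infconv K g L b.
  apply: infconv_ge => // k Kk; rewrite lerBlDr.
  apply: (le_trans (infconv_le a L0 gc Kk)).
  by rewrite -addrA lerD2l -mulrDr ler_wpM2l// [leRHS]addrC ler_distD.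
by rewrite ler_norml; have := h x y; have := h y x; rewrite (distrC y x); lra.
Qed.

Lemma distance_to_ge K c x : K !=set0 ->
  (forall k, K k -> c <= `|x - k|) -> c <= distance_to K x.
Proof. by move=> K0 h; apply: infconv_ge => // k /h; rewrite add0r mul1r. Qed.

Lemma distance_to_le K x k : K k -> distance_to K x <= `|x - k|.
Proof.
move=> Kk; have := @infconv_le K (fun=> 0) 1 x k ler01.
by rewrite add0r mul1r; apply => //; exists 0.
Qed.

Lemma distance_to_ge0 K x : K !=set0 -> 0 <= distance_to K x.
Proof. by move=> K0; apply: distance_to_ge. Qed.

Lemma distance_to_eq0 K x : K x -> distance_to K x = 0.
Proof.
move=> Kx; apply/eqP; rewrite eq_le distance_to_ge0 ?andbT; last by exists x.
by have := distance_to_le x Kx; rewrite subrr normr0.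
Qed.

Lemma distance_to_lip K x y : K !=set0 ->
  `|distance_to K x - distance_to K y| <= `|x - y|.
Proof.
by move=> K0; rewrite -[leRHS]mul1r; apply: infconv_lip => //; exists 0.
Qed.

Lemma distance_to_lt K x c : K !=set0 -> distance_to K x < c ->
  exists2 k, K k & `|x - k| < c.
Proof.
move=> K0 xc; apply: contrapT => h.
move: xc; apply/negP; rewrite -leNgt; apply: distance_to_ge => // k Kk.
by rewrite leNgt; apply/negP => kc; apply: h; exists k.
Qed.

Lemma lipschitz_continuous (f : V -> R) L :
  (forall x y, `|f x - f y| <= L * `|x - y|) -> continuous f.
Proof.
move=> fL x; apply/cvgrPdist_lt => e e0; near=> y.
have L0 : 0 < `|L| + 1 by rewrite ltr_wpDl.
apply: (le_lt_trans (fL x y)).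
apply: (@le_lt_trans _ _ ((`|L| + 1) * `|x - y|)).
  by rewrite ler_wpM2r// (le_trans (ler_norm _))// lerDl.
rewrite -ltr_pdivlMl//.
near: y; apply/nbhs_ballP; exists ((`|L| + 1)^-1 * e).
  by rewrite /= mulr_gt0// invr_gt0.
by rewrite -ball_normE.
Unshelve. all: by end_near. Qed.

Lemma min_lip (c a b : R) : `|Num.min a c - Num.min b c| <= `|a - b|.
Proof.
wlog ab : a b / a <= b.
  by move=> h; have [/h//|/ltW/h] := leP a b; rewrite distrC (distrC b).
rewrite (distrC a) (ger0_norm (_ : 0 <= b - a)) ?subr_ge0//.
by rewrite distrC ger0_norm; case: (leP a c) => ac; case: (leP b c) => bc; lra.
Qed.

(* [U] is [min(F, 1) + 2 min(1, d(-, K) / delta) + 3 eps], where [F] is the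
   infimal convolution of [G] restricted to [K] with [L |-|]. *)
Lemma lipschitz_majorant K (G : V -> R) (eps L : R) :
  K !=set0 -> 0 < eps -> 1 <= L -> (forall x, `|G x| <= 1) ->
  (forall k k', K k -> K k' -> G k - G k' <= eps + L * `|k - k'|) ->
  exists U : V -> R,
  [/\ forall x y, `|U x - U y| <= (L + 2 * L / eps) * `|x - y|,
      forall x, `|U x| <= 3 + 3 * eps,
      forall x k, K k -> `|x - k| < eps / L -> G k + eps <= U x,
      forall x, (forall k, K k -> eps / L <= `|x - k|) -> 1 <= U x &
      forall x, (K x -> U x <= G x + 3 * eps) /\ U x <= G x + 3 * eps + 4].
Proof.
move=> K0 e0 L1 G1 GL.
have L0 : 0 < L by apply: lt_le_trans L1.
have Lge0 := ltW L0.
have G1' k : -1 <= G k by have := G1 k; rewrite ler_norml => /andP[].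
have G1'' k : G k <= 1 by have := G1 k; rewrite ler_norml => /andP[].
have Gb : exists c, forall k, K k -> c <= G k by exists (-1).
set F := infconv K G L.
have Fge x : -1 <= F x.
  by apply: infconv_ge => // k _; rewrite -[leLHS]addr0 lerD// mulr_ge0.
have FG k : K k -> F k <= G k.
  by move=> Kk; have := infconv_le k Lge0 Gb Kk; rewrite subrr normr0 mulr0 addr0.
have GF k : K k -> G k - eps <= F k.
  move=> Kk; apply: infconv_ge => // k' Kk'; have := GL _ _ Kk Kk'; lra.
pose rho x := Num.min (distance_to K x / (eps / L)) 1.
have eL0 : 0 < eps / L by rewrite divr_gt0.
have rho0 x : 0 <= rho x.
  by rewrite le_min ler01 andbT divr_ge0//; [exact: distance_to_ge0|exact: ltW].
have rho1 x : rho x <= 1 by rewrite ge_min lexx orbT.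
exists (fun x => Num.min (F x) 1 + 2 * rho x + 3 * eps); split.
- move=> x y.
  have h1 : `|Num.min (F x) 1 - Num.min (F y) 1| <= L * `|x - y|.
    by apply: le_trans (min_lip _ _ _) _; exact: infconv_lip.
  have h2 : `|rho x - rho y| <= L / eps * `|x - y|.
    apply: le_trans (min_lip _ _ _) _; rewrite -mulrBl normrM.
    rewrite mulrC (ger0_norm (_ : 0 <= (eps / L)^-1)) ?invr_ge0; try exact: ltW.
    by rewrite invf_div; apply: ler_wpM2l; [rewrite divr_ge0// ltW|exact: distance_to_lip].
  have -> : Num.min (F x) 1 + 2 * rho x + 3 * eps - (Num.min (F y) 1 + 2 * rho y + 3 * eps)
     = (Num.min (F x) 1 - Num.min (F y) 1) + 2 * (rho x - rho y) by ring.
  apply: (le_trans (ler_normD _ _)); rewrite [leRHS]mulrDl; apply: lerD => //.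
  by rewrite normrM ger0_norm// -!mulrA ler_pM2l// mulrA.
- move=> x; have := Fge x; have := rho0 x; have := rho1 x.
  rewrite ler_norml; case: (leP (F x) 1) => h; lra.
(* Here [F x >= F k - eps >= G k - 2 * eps]; the summand [3 * eps] repairs this loss and leaves the
   margin [eps]. *)
- move=> x k Kk xk.
  have : `|F x - F k| <= eps.
    apply: le_trans (infconv_lip _ _ Lge0 Gb K0) _.
    by rewrite mulrC -ler_pdivlMr// ltW.
  rewrite ler_norml => /andP[h _]; have := GF _ Kk; have := rho0 x; have := G1'' k.
  case: (leP (F x) 1); lra.
(* This far from [K] the cut-off [rho] equals 1, and [2 * rho] lifts the lower bound -1 of [F] to
   1. *)
- move=> x hx.
  have : rho x = 1.
    apply/eqP; rewrite eq_le rho1 le_min lexx andbT ler_pdivlMr// mul1r.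
    exact: distance_to_ge.
  move=> ->; have := Fge x; case: (leP (F x) 1); lra.
- move=> x; split.
    move=> Kx; have -> : rho x = 0.
      rewrite /rho distance_to_eq0// mul0r; apply/min_idPl; exact: ler01.
    by have := FG _ Kx; case: (leP (F x) 1) => h1 h2; lra.
  by have := G1' x; have := rho1 x; case: (leP (F x) 1) => h1 h2 h3; lra.
Qed.

End infconv.

Section support.
Context {R : realType} {V : normedModType R}.
Variable G : probability (borel V) R.
Implicit Types K : set V.

Lemma law_support_closed : closed (law_support G).
Proof.
rewrite -openC openE => x /= Sx.
have [U [oU Ux GU]] : exists U : set V, [/\ open U, U x & ~ (0 < G U)%E].
  apply: contrapT => h; apply: Sx => U oU Ux; apply: contrapT => GU.
  by apply: h; exists U.
apply: (@filterS _ _ _ U); last exact: open_nbhs_nbhs.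
by move=> y Uy Sy; apply: GU; exact: Sy.
Qed.

(** Every point outside the support has a null open neighbourhood, and finitely many of these cover
    [K]. Compactness stands in for the Lindelof property, which a nonseparable space does not
    have. *)
Lemma compact_disjoint_support_null K : compact K ->
  K `&` law_support G = set0 -> G K = 0%E.
Proof.
move=> cK KS; have := cK; rewrite compact_cover.
move=> /(_ _ [set U | open U /\ G U = 0%E] id).
case=> [U []//|x Kx|F FU KF].
  have : ~ law_support G x by move=> Sx; have : set0 x by rewrite -KS.
  move=> /existsNP[U /not_implyP[oU /not_implyP[Ux /negP]]].
  rewrite -leNgt => GU; exists U => //; split => //.
  by apply/eqP; rewrite eq_le GU measure_ge0.
have mF U : U \in F -> measurable (U : set (borel V)) /\ G U = 0%E.
  by move=> /FU /set_mem[/open_borel].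
have {}KF : K `<=` \big[setU/set0]_(U <- F) U.
  by rewrite -bigcup_fset.
have [mB GB] : measurable (\big[setU/set0]_(U <- F) U : set (borel V)) /\
    G (\big[setU/set0]_(U <- F) U) = 0%E.
  rewrite big_seq; elim/big_ind : _ => //.
    move=> A B [mA GA] [mB GB]; split; first exact: measurableU.
    by rewrite -GA; apply: measureU0.
apply/eqP; rewrite eq_le measure_ge0 andbT -GB measure_le//.
exact: compact_borel.
Qed.

Hypothesis tG : tight G.

(** A compact [K] of mass at least [1 - e] lies, apart from its points in the support, in the
    countable union of the compact sets [C n] of its points at distance at least 1/(n+1) from the
    support. These are null, so the support itself has mass at least [1 - e]. *)
Lemma law_support_full : law_support G !=set0 -> G (law_support G) = 1%E.
Proof.
move=> S0; have mS := closed_borel law_support_closed.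
apply/eqP; rewrite eq_le probability_le1//=.
apply/lee_subgt0Pr => e e0; have [K cK GK] := tG e0.
rewrite -EFinB; apply: (le_trans GK).
have mK := compact_borel cK.
pose C n := K `&` [set x | n.+1%:R^-1 <= distance_to (law_support G) x].
have cC n : compact (C n).
  apply: compact_closedI => //.
  apply: (@preimage_closed _ _ (distance_to (law_support G))
    [set y : R | n.+1%:R^-1 <= y]); last exact: closed_ge.
  move=> x _; apply: (@lipschitz_continuous _ _ _ 1) => a b.
  by rewrite mul1r distance_to_lip.
have GC n : G (C n) = 0%E.
  apply: compact_disjoint_support_null => //.
  apply/seteqP; split => // x [[_ /=] + Sx]; rewrite distance_to_eq0//.
  by rewrite leNgt invr_gt0 ltr0n.
have KC : K `<=` law_support G `|` \bigcup_n C n.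
  move=> x Kx; have [Sx|Sx] := pselect (law_support G x); [by left|right].
  have [e' e'0 he] : exists2 e, 0 < e & forall y, law_support G y -> e <= `|x - y|.
    have /nbhs_ballP[r r0 hr] : nbhs x (~` law_support G).
      by apply: open_nbhs_nbhs; split => //; rewrite openC; exact: law_support_closed.
    exists r => // y Sy; rewrite leNgt; apply/negP => xy.
    by apply: (hr y _ Sy); rewrite -ball_normE.
  have [n _ ne] := near_infty_natSinv_lt (PosNum e'0).
  exists n => //; split => //=.
  apply: (@le_trans _ _ e'); last exact: distance_to_ge.
  by apply/ltW; apply: ne => //=.
apply: (@le_trans _ _ (G (law_support G `|` \bigcup_n C n))).
  apply: measure_le => //; apply: measurableU => //.
  by apply: bigcupT_measurable => n; exact: compact_borel.
rewrite measureU0//; first by apply: bigcupT_measurable => n; exact: compact_borel.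
have mC n : measurable (C n : set (borel V)) by exact: compact_borel.
have mUC : measurable (\bigcup_n C n : set (borel V)) by exact: bigcupT_measurable.
apply: (measure_negligible mUC); apply: negligible_bigcup => n.
by exists (C n); split => //; exact: GC.
Qed.

Lemma tight_support (e : R) : law_support G !=set0 -> 0 < e ->
  exists K, [/\ compact K, K `<=` law_support G & ((1 - e)%:E <= G K)%E].
Proof.
move=> S0 e0; have [K cK GK] := tG e0.
have mS := closed_borel law_support_closed; have mK := compact_borel cK.
exists (K `&` law_support G); split => //.
  by apply: compact_closedI => //; exact: law_support_closed.
rewrite (le_trans GK)// [leLHS](measureDI G mK mS) addeC.
rewrite [X in (_ + X)%E](_ : _ = 0%E) ?adde0//.
apply/eqP; rewrite eq_le measure_ge0 andbT.
rewrite -[leRHS](_ : G (~` law_support G) = 0%E).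
  by apply: measure_le; [exact: measurableD|exact: measurableC|].
by rewrite probability_setC// law_support_full// subee.
Qed.

End support.

(** * Hadamard derivatives *)

Section uniform_on_compact.
Context {R : realType} {V E : normedModType R}.

(** Turns a radius that works near each point of [K] into one that works on all of [K], for
    properties inherited by smaller radii. It serves both uniform continuity and uniform
    differentiability along [K]. *)
Lemma near_compact_uniform (K : set V) (P : R -> V -> Prop) : compact K ->
  (forall d d' k, 0 < d <= d' -> P d' k -> P d k) ->
  (forall k, K k -> exists d, 0 < d /\ forall k', `|k - k'| < d -> P d k') ->
  exists2 d, 0 < d & forall k, K k -> P d k.
Proof.
move=> /compact_near_coveringP cK Pmono Ploc.
have := cK R (0^'+) P _.
case=> [k Kk|d /= d0 hd].
  have [d [d0 hd]] := Ploc k Kk.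
  exists (ball k d, [set e | 0 < e <= d]) => /=.
    split; first exact: nbhsx_ballx.
    by near=> e; apply/andP; split; near: e; [exact: nbhs_right_gt|exact: nbhs_right_le].
  move=> [k' e] /= [kk' ed]; apply: (Pmono _ _ _ ed); apply: hd.
  by move: kk'; rewrite -ball_normE.
exists (d / 2); first by rewrite divr_gt0.
have d2 : 0 < d / 2 by rewrite divr_gt0.
apply: hd => //; rewrite /ball_ /= sub0r normrN gtr0_norm//.
by rewrite ltr_pdivrMr// mulr_natr mulr2n ltrDl.
Unshelve. all: by end_near. Qed.

Lemma continuous_dist (f : V -> E) x (e : R) : continuous f -> 0 < e ->
  exists2 d, 0 < d & forall y, `|x - y| < d -> `|f x - f y| < e.
Proof.
move=> /(_ x) /cvgrPdist_lt /(_ e) h /h /nbhs_ballP[d d0 hd].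
by exists d => // y xy; apply: hd; rewrite -ball_normE.
Qed.

Lemma continuous_uniform_on_compact (f : V -> E) (K : set V) (e : R) :
  continuous f -> compact K -> 0 < e ->
  exists2 d, 0 < d & forall k y, K k -> `|k - y| < d -> `|f k - f y| < e.
Proof.
move=> cf cK e0.
have [|k Kk|d d0 hd] := @near_compact_uniform K
  (fun d k => forall y, `|k - y| < d -> `|f k - f y| < e) cK.
- move=> d d' k /andP[_ dd'] h y ky; apply: h; exact: lt_le_trans dd'.
- have e20 : 0 < e / 2 by rewrite divr_gt0.
  have [d d0 hd] := continuous_dist k cf e20.
  have d20 : 0 < d / 2 by rewrite divr_gt0.
  exists (d / 2); split => // k' kk' y k'y.
  have h1 : `|f k - f k'| < e / 2 by apply: hd; lra.
  have h2 : `|f k - f y| < e / 2.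
    apply: hd; have := ler_distD k' k y; lra.
  by have := ler_distD (f k) (f k') (f y); rewrite (distrC (f k') (f k)); lra.
- by exists d => // k y Kk; exact: hd.
Qed.

End uniform_on_compact.

Section hadamard_lemmas.
Context {R : realType} {D E : normedModType R}.
Variables (phi : D -> E) (Dphi : set D) (theta : D) (D0 : set D) (dphi : D -> E).
Hypothesis hphi : is_hadamard_directional_derivative phi Dphi theta D0 dphi.

Lemma directional_derivative_eps_delta h (e : R) : D0 h -> 0 < e ->
  exists2 d, 0 < d & forall t h', 0 < t < d -> `|h - h'| < d ->
    Dphi (theta + t *: h') ->
    `|t^-1 *: (phi (theta + t *: h') - phi theta) - dphi h| < e.
Proof.
move=> D0h e0; apply: contrapT => noH.
(* The premise [0 < d] is placed under the existential so that choice yields a function on all of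
   [R]. *)
have /choice[F FP] : forall d : R, exists p : R * D, 0 < d ->
    [/\ 0 < p.1 < d, `|h - p.2| < d, Dphi (theta + p.1 *: p.2) &
    e <= `|p.1^-1 *: (phi (theta + p.1 *: p.2) - phi theta) - dphi h|].
  move=> d; apply: contrapT => noP; apply: noH.
  have d0 : 0 < d by rewrite ltNge; apply/negP => d0; apply: noP; exists (0, 0);
    rewrite ltNge d0.
  exists d => // t h' td hh' Dt; rewrite ltNge; apply/negP => ht.
  by apply: noP; exists (t, h').
(* Each counterexample is drawn below the previous step size, which forces monotonicity, and below
   the reciprocal of its index, which forces convergence. The bound used at stage [n] is [b n]. *)
pose s := fix s n := if n is m.+1 then F (Num.min (m.+1%:R^-1) (s m).1) else F 1.
have s0 n : 0 < (s n).1.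
  elim: n => [|n IH] /=; first by have [//|/andP[]] := FP 1.
  by have [|/andP[]//] := FP (Num.min (n.+1%:R^-1) (s n).1);
    rewrite ?lt_min ?IH ?invr_gt0 ?ltr0n.
pose b n : R := if n is m.+1 then Num.min (m.+1%:R^-1) (s m).1 else 1.
have b0 n : 0 < b n by case: n => //= n; rewrite lt_min s0 invr_gt0 ltr0n.
have sE n : s n = F (b n) by case: n.
have sP n : [/\ 0 < (s n).1 < b n, `|h - (s n).2| < b n,
    Dphi (theta + (s n).1 *: (s n).2) &
    e <= `|(s n).1^-1 *: (phi (theta + (s n).1 *: (s n).2) - phi theta) - dphi h|].
  by rewrite sE; exact: FP.
have bn n : b n.+1 <= n.+1%:R^-1 by rewrite /= ge_min lexx.
have b_cvg (u : nat -> R) : (forall n, `|u n| < b n) -> u @ \oo --> 0.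
  move=> ub; apply/cvgr0Pnorm_lt => r r0.
  have [N _ HN] := near_infty_natSinv_lt (PosNum r0).
  exists N.+1 => // -[//|n] /= Nn; apply: lt_trans (ub _) _.
  by apply: le_lt_trans (bn n) _; exact: HN.
have s_nd : nonincreasing_seq (fun n => (s n).1).
  apply/nonincreasing_seqP => n; have [/andP[_ +] _ _ _] := sP n.+1.
  by rewrite /= lt_min => /andP[_ /ltW].
have t_cvg : (s n).1 @[n --> \oo] --> (0 : R).
  by apply: b_cvg => n; rewrite gtr0_norm//; have [/andP[]] := sP n.
have h_cvg : (s n).2 @[n --> \oo] --> h.
  apply/cvgrPdist_lt => r r0.
  have [N _ HN] := near_infty_natSinv_lt (PosNum r0).
  exists N.+1 => // -[//|n] /= Nn; have [_ + _ _] := sP n.+1.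
  move=> /lt_le_trans -/(_ _ (bn n)) /lt_trans; apply; exact: HN.
have sD n : Dphi (theta + (s n).1 *: (s n).2) by have [] := sP n.
have := hphi.2 _ _ h s0 s_nd t_cvg h_cvg D0h sD.
move=> /cvgr0Pnorm_lt /(_ _ e0) [N _ /(_ N (leqnn N))] /=.
  by rewrite normr_id ltNge; have [_ _ _ ->] := sP N.
Qed.

(** The estimate at [k] persists at nearby [k']: continuity of [dphi] moves the limit, and a halved
    radius leaves room to move the centre. Compactness then makes the radius uniform. *)
Lemma directional_derivative_compact (K : set D) (e : R) :
  continuous dphi -> compact K -> K `<=` D0 -> 0 < e ->
  exists2 d, 0 < d & forall k t h', K k -> 0 < t < d -> `|k - h'| < d ->
    Dphi (theta + t *: h') ->
    `|t^-1 *: (phi (theta + t *: h') - phi theta) - dphi k| < e.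
Proof.
move=> cd cK KD0 e0.
have [|k Kk|d d0 hd] := @near_compact_uniform _ _ K
  (fun d k => forall t h', 0 < t < d -> `|k - h'| < d ->
    Dphi (theta + t *: h') ->
    `|t^-1 *: (phi (theta + t *: h') - phi theta) - dphi k| < e) cK.
- move=> d d' k /andP[_ dd'] h t h' /andP[t0 td] kh; apply: h.
    by rewrite t0 (lt_le_trans td).
  exact: lt_le_trans dd'.
- have e20 : 0 < e / 2 by rewrite divr_gt0.
  have [d d0 hd] := continuous_dist k cd e20.
  have [d' d'0 hd'] := directional_derivative_eps_delta (KD0 _ Kk) e20.
  pose r := Num.min d (d' / 2).
  have rd : r <= d by rewrite ge_min lexx.
  have rd' : r <= d' / 2 by rewrite ge_min lexx orbT.
  exists r; split; first by rewrite lt_min d0 divr_gt0.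
  move=> k' kk' t h' /andP[t0 tr] k'h' Dt.
  have h1 : `|dphi k - dphi k'| < e / 2 by apply: hd; lra.
  have : `|t^-1 *: (phi (theta + t *: h') - phi theta) - dphi k| < e / 2.
    apply: hd' => //; first by apply/andP; split => //; lra.
    have := ler_distD k' k h'; lra.
  by have := ler_distD (dphi k) (t^-1 *: (phi (theta + t *: h') - phi theta)) (dphi k'); lra.
- by exists d => // k t h' Kk; exact: hd.
Qed.

(** Membership of [h] in the Bouligand tangent cone of [Dphi] at [theta]. Outside this cone no
    admissible sequence converges to [h], and the limit in the definition of the derivative puts no
    constraint on [dphi h]. *)
Definition contingent h :=
  forall d, 0 < d -> exists t h', [/\ 0 < t < d, `|h - h'| < d & Dphi (theta + t *: h')].

(** The pairs [(t, h')] and [(t / c, c *: h')] name the same point of [Dphi], and the second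
    difference quotient is [c] times the first. *)
Lemma directional_derivative_homogeneous h (c : R) :
  0 < c -> D0 h -> D0 (c *: h) -> contingent h -> dphi (c *: h) = c *: dphi h.
Proof.
move=> c0 hD chD hC; apply/eqP; rewrite -subr_eq0 -normr_eq0; apply/eqP.
apply/eqP; rewrite eq_le normr_ge0 andbT; apply/ler_addgt0Pr => e e0; rewrite add0r.
have e20 : 0 < e / 2 by rewrite divr_gt0.
have ec : 0 < e / 2 / c by rewrite divr_gt0.
have [d d0 hd] := directional_derivative_eps_delta hD ec.
have [d' d'0 hd'] := directional_derivative_eps_delta chD e20.
(* The bounds [d' * c] and [d' / c] ensure that [t / c] and [c *: h'] are within [d'] of 0 and of
   [c *: h]. *)
pose r := Num.min d (Num.min (d' * c) (d' / c)).
have r0 : 0 < r by rewrite !lt_min d0 mulr_gt0//= divr_gt0.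
have [t [h' [/andP[t0 tr] hh' Dt]]] := hC _ r0.
have := hd t h'; rewrite t0 /= => /(_ _ _ Dt).
have := hd' (t / c) (c *: h'); rewrite scalerA divfK ?gt_eqF// divr_gt0//=.
move: tr hh'; rewrite !lt_min => /andP[td /andP[tdc _]] /andP[hhd /andP[_ hhc]].
rewrite ltr_pdivrMr// tdc -scalerBr normrZ gtr0_norm// -ltr_pdivlMl// mulrC hhc td hhd.
move=> /(_ isT isT Dt) H1 /(_ isT isT).
set q := _ *: _ => H2.
have H3 : `|(t / c)^-1 *: (phi (theta + t *: h') - phi theta) - c *: dphi h| < e / 2.
  rewrite invf_div -scalerA -scalerBr normrZ gtr0_norm//.
  by rewrite mulrC -ltr_pdivlMr.
move: H1 H3; set q' := _ *: _ => H1 H3.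
have := ler_distD q' (dphi (c *: h)) (c *: dphi h); rewrite (distrC _ q'); lra.
Qed.

(** Contingency supplies one sequence along which the same quotients tend to both derivatives. *)
Lemma hadamard_derivative_unique (S : set D) (psi : D -> E) h :
  S h -> D0 h -> is_hadamard_derivative phi Dphi theta S psi ->
  contingent h -> psi h = dphi h.
Proof.
move=> Sh hD [_ _ hpsi] hC.
have /choice[F FP] : forall n : nat, exists p : R * D,
    [/\ 0 < p.1 < n.+1%:R^-1, `|h - p.2| < n.+1%:R^-1 & Dphi (theta + p.1 *: p.2)].
  by move=> n; have [|t [h' ?]] := hC n.+1%:R^-1; [rewrite invr_gt0 ltr0n|exists (t, h')].
have F0 n : 0 < (F n).1 by have [/andP[]] := FP n.
have Fc1 : (F n).1 @[n --> \oo] --> (0 : R).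
  apply/cvgr0Pnorm_lt => r r0.
  have [N _ HN] := near_infty_natSinv_lt (PosNum r0).
  exists N => // n /= Nn; rewrite gtr0_norm//.
  by have [/andP[_ h1] _ _] := FP n; apply: (lt_trans h1); exact: HN.
have Fc2 : (F n).2 @[n --> \oo] --> h.
  apply/cvgrPdist_lt => r r0.
  have [N _ HN] := near_infty_natSinv_lt (PosNum r0).
  exists N => // n /= Nn.
  by have [_ h1 _] := FP n; apply: (lt_trans h1); exact: HN.
have := hpsi _ _ h (fun n => lt0r_neq0 (F0 n)) Fc1 Fc2 Sh.
move=> /(_ (fun n => let: And3 _ _ p := FP n in p)) hl.
apply/eqP; rewrite -subr_eq0 -normr_eq0 eq_le normr_ge0 andbT.
apply/ler_addgt0Pr => e e0; rewrite add0r.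
have e20 : 0 < e / 2 by rewrite divr_gt0.
have [d d0 hd] := directional_derivative_eps_delta hD e20.
near \oo => n.
have h1 : `|(F n).1^-1 *: (phi (theta + (F n).1 *: (F n).2) - phi theta) - psi h| < e / 2.
  near: n; move: hl => /cvgr0Pnorm_lt /(_ _ e20); apply: filterS => n.
  by rewrite normr_id.
have h2 : `|(F n).1^-1 *: (phi (theta + (F n).1 *: (F n).2) - phi theta) - dphi h| < e / 2.
  apply: hd; last by have [] := FP n.
  - rewrite F0 /=; near: n; move: Fc1 => /cvgr0Pnorm_lt /(_ _ d0); apply: filterS => n.
    by rewrite gtr0_norm.
  - by near: n; move: Fc2 => /cvgrPdist_lt /(_ _ d0).
move: h1 h2; set q := _ *: _ => h1 h2.
have := ler_distD q (psi h) (dphi h); rewrite (distrC _ q); lra.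
Unshelve. all: by end_near. Qed.

(** The full derivative also allows negative and non-monotone [t]. The epsilon-delta form disposes
    of monotonicity, and a negative [t] in direction [h] is the positive [- t] in direction [- h],
    where linearity makes [dphi] odd. *)
Lemma linear_hadamard_differentiable (S : set D) :
  continuous dphi -> vector_subspace S -> S `<=` D0 -> linear_on S dphi ->
  hadamard_differentiable phi Dphi theta S.
Proof.
move=> cd [S0 Slin] SD0 lind; exists dphi; split => //.
  exact: continuous_subspaceT.
move=> h t h0 tn0 tc hc Sh0 Dt.
have d00 : dphi 0 = 0.
  have := lind 1 0 0 S0 S0; rewrite !scale1r addr0 => /(_ S0) /eqP.
  by rewrite -subr_eq0 opprD addrA subrr sub0r oppr_eq0 => /eqP.
have SN : S (- h0) by rewrite -scaleN1r -[_ *: _]addr0; exact: Slin.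
have dN : dphi (- h0) = - dphi h0.
  have := lind (-1) h0 0 Sh0 S0; rewrite !scaleN1r !addr0 d00 addr0.
  exact.
apply/cvgr0Pnorm_lt => e e0.
have [d d_gt0 hd] := directional_derivative_eps_delta (SD0 _ Sh0) e0.
have [d' d'_gt0 hd'] := directional_derivative_eps_delta (SD0 _ SN) e0.
near=> n; rewrite normr_id.
have h1 : `|t n| < d by near: n; move: tc => /cvgr0Pnorm_lt /(_ _ d_gt0).
have h2 : `|t n| < d' by near: n; move: tc => /cvgr0Pnorm_lt /(_ _ d'_gt0).
have h3 : `|h0 - h n| < d by near: n; move: hc => /cvgrPdist_lt /(_ _ d_gt0).
have h4 : `|h0 - h n| < d' by near: n; move: hc => /cvgrPdist_lt /(_ _ d'_gt0).
have [tp|tp|tp] := ltgtP (t n) 0; last by move: (tn0 n); rewrite tp eqxx.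
- have := hd' (- t n) (- h n); rewrite dN oppr_gt0 tp /= scalerN scaleNr !opprK.
  have flip (W : normedModType R) (a b : W) : `|- a + b| = `|a - b|.
    by rewrite addrC distrC.
  by rewrite invrN scaleNr !flip -(ltr0_norm tp); exact.
- by apply: hd => //; rewrite tp /= -(gtr0_norm tp).
Unshelve. all: by end_near. Qed.

End hadamard_lemmas.

(** * Bootstrap laws and Lipschitz sandwiches *)

Lemma compact_add {R : realType} {V : normedModType R} (K L : set V) :
  compact K -> compact L -> compact [set k + l | k in K & l in L].
Proof.
move=> cK cL.
have -> : [set k + l | k in K & l in L] = (fun p : V * V => p.1 + p.2) @` (K `*` L).
  apply/seteqP; split => x.
    by move=> [k Kk [l Ll <-]]; exists (k, l).
  by move=> [[k l] [/= Kk Ll] <-]; exists k => //; exists l.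
apply: continuous_compact; last exact: compact_setX.
apply: continuous_subspaceT => x; exact: add_continuous.
Qed.

Lemma BL1_bounded_continuous {R : realType} {V : normedModType R} (f : V -> R) :
  BL1 V f -> bounded_continuous f.
Proof.
move=> [f1 fl]; split; last by exists 1.
by apply: (@lipschitz_continuous _ _ _ 1) => x y; rewrite mul1r.
Qed.

Lemma RintegralN d (T : measurableType d) {R : realType}
    (mu : {measure set T -> \bar R}) (f : T -> R) :
  mu.-integrable [set: T] (EFin \o f) -> \int[mu]_x (- f x) = - \int[mu]_x f x.
Proof.
move=> fi; rewrite -mulN1r -RintegralZl//.
by apply: eq_Rintegral => x _; rewrite mulN1r.
Qed.

Section bootstrap_bound.
Context {R : realType} {D E : normedModType R}.
Variables (phi : D -> E) (Dphi : set D) (theta : D) (D0 : set D) (dphi : D -> E).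
Hypothesis hphi : is_hadamard_directional_derivative phi Dphi theta D0 dphi.
Hypothesis cdphi : continuous dphi.
Variable G : probability (borel D) R.
Hypothesis tG : tight G.
Hypothesis SD0 : law_support G `<=` D0.
Hypothesis subS : vector_subspace (law_support G).

Lemma continuous_increment k : continuous (fun z => dphi (k + z) - dphi k).
Proof.
move=> z; apply: continuousB; last exact: cst_continuous.
apply: continuous_comp; last exact: cdphi.
by apply: continuousD; [exact: cst_continuous|exact: id].
Qed.

Lemma bounded_continuous_comp (f : E -> R) (g : D -> E) :
  bounded_continuous f -> continuous g -> bounded_continuous (f \o g).
Proof.
move=> [cf [M fM]] cg; split; last by exists M => x; exact: fM.
by move=> x; apply: continuous_comp; [exact: cg|exact: cf].
Qed.

(** The constants [delta] and [M] precede [k], [f], [t] and [a], which makes the later bounds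
    uniform over [BL1] and over data near [K]. As [dphi] is merely continuous, [f] of its increment
    is Lipschitz on a compact set only up to an additive [eps], which is what [lipschitz_majorant]
    tolerates. *)
Lemma increment_lipschitz_majorant (K : set D) (eps : R) :
  compact K -> K `<=` law_support G -> 0 < eps <= 1 ->
  exists delta M : R, [/\ 0 < delta, 0 < M & forall k f t a,
    K k -> BL1 E f -> 0 < t < delta -> `|k - a| < delta ->
    Dphi (theta + t *: a) ->
    exists U : D -> R,
    [/\ forall x y, `|U x - U y| <= M * `|x - y|,
        forall x, `|U x| <= M,
        forall b, Dphi (theta + t *: (a + b)) ->
          f (t^-1 *: (phi (theta + t *: (a + b)) - phi (theta + t *: a))) <= U b &
        \int[G]_z U z <= \int[G]_z f (dphi (k + z) - dphi k) + 7 * eps]].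
Proof.
move=> cK KS /andP[e0 e1].
have S0 : law_support G !=set0 by exists 0; have [] := subS.
have [K1' [cK1' K1'S GK1']] := tight_support tG S0 e0.
(* Adding 0 puts [K] inside [K2], so that one uniform estimate covers both [theta + t *: a] and
   [theta + t *: (a + b)]. *)
pose K1 := K1' `|` [set 0 : D].
have cK1 : compact K1 by apply: compactU => //; exact: compact_set1.
have K1S : K1 `<=` law_support G.
  by move=> x [/K1'S//|->]; have [] := subS.
have K10 : K1 !=set0 by exists 0; right.
have mK1 := compact_borel cK1.
have GK1 : ((1 - eps)%:E <= G K1)%E.
  by apply: (le_trans GK1'); apply: measure_le => //; [exact: compact_borel|left].
pose K2 := [set k + l | k in K & l in K1].
have cK2 : compact K2 by exact: compact_add.
have K2S : K2 `<=` D0.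
  move=> _ [k Kk [l Kl <-]]; apply: SD0; rewrite -[k]scale1r; apply: subS.2.
    exact: KS.
  exact: K1S.
have K2K k : K k -> K2 k.
  by move=> Kk; exists k => //; exists 0; [right|rewrite addr0].
have e20 : 0 < eps / 2 by rewrite divr_gt0.
have [d1 d10 hd1] := directional_derivative_compact hphi cdphi cK2 K2S e20.
have [d2 d20 hd2] := continuous_uniform_on_compact cdphi cK2 e0.
(* The summand 1 gives [1 <= L]; [2 / d2] makes [L] times the distance exceed the oscillation 2 of
   [F] beyond distance [d2]; [2 * eps / d1] gives [eps / L <= d1 / 2], so that this error and
   [delta = d1 / 2] add up to at most [d1]. *)
pose L := 1 + 2 / d2 + 2 * eps / d1.
have a1 : 0 < 2 / d2 by rewrite divr_gt0.
have a2 : 0 < 2 * eps / d1 by rewrite divr_gt0// mulr_gt0.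
have L1 : 1 <= L by rewrite /L; lra.
have L0 : 0 < L by lra.
have eL : eps / L <= d1 / 2.
  rewrite ler_pdivrMr// mulrC -ler_pdivrMr ?divr_gt0//.
  rewrite invf_div mulrA (mulrC eps) /L; lra.
have a3 : 0 < 2 * L / eps by rewrite divr_gt0// mulr_gt0.
exists (d1 / 2), (6 + L + 2 * L / eps); split.
- by rewrite divr_gt0.
- lra.
move=> k f t a Kk fBL /andP[t0 td] ka Da.
have [f1 fl] := fBL.
pose F := fun z => f (dphi (k + z) - dphi k).
have F1 z : `|F z| <= 1 by exact: f1.
have FL z z' : K1 z -> K1 z' -> F z - F z' <= eps + L * `|z - z'|.
  move=> Kz Kz'; have [zz'|zz'] := ltP `|z - z'| d2.
    have : `|dphi (k + z) - dphi (k + z')| < eps.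
      apply: hd2; first by exists k => //; exists z.
      by rewrite opprD addrACA subrr add0r.
    have := fl (dphi (k + z) - dphi k) (dphi (k + z') - dphi k).
    rewrite opprB addrA subrK => h1 h2.
    have : F z - F z' <= `|F z - F z'| by exact: ler_norm.
    have : 0 <= L * `|z - z'| by rewrite mulr_ge0// ltW.
    rewrite /F; lra.
  have : F z - F z' <= 2.
    have := F1 z; have := F1 z'; rewrite !ler_norml => /andP[? ?] /andP[? ?]; lra.
  have : 2 <= L * `|z - z'|.
    have h : 2 / d2 * d2 <= L * `|z - z'|.
      by apply: ler_pM => //; [exact: ltW|exact: ltW|rewrite /L; lra].
    by rewrite divfK ?gt_eqF// in h.
  lra.
have [U [UL UM Unear Ufar Uint]] := lipschitz_majorant K10 e0 L1 F1 FL.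
exists U; split.
- move=> x y; apply: (le_trans (UL x y)); apply: ler_wpM2r => //; lra.
- by move=> x; apply: (le_trans (UM x)); lra.
- move=> b Dab.
  have [[k1 K1k1 bk1]|far] := pselect (exists2 k1, K1 k1 & `|b - k1| < eps / L).
    apply: le_trans (Unear _ _ K1k1 bk1).
    set T := t^-1 *: _.
    have ->: T = t^-1 *: (phi (theta + t *: (a + b)) - phi theta) -
                 t^-1 *: (phi (theta + t *: a) - phi theta).
      by rewrite -scalerBr opprB addrA subrK.
    have td1 : 0 < t < d1 by rewrite t0 /=; lra.
    have h1 : `|t^-1 *: (phi (theta + t *: (a + b)) - phi theta) - dphi (k + k1)| < eps / 2.
      apply: hd1 => //; first by exists k => //; exists k1.
      rewrite opprD addrACA; apply: (le_lt_trans (ler_normD _ _)).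
      rewrite (distrC k1); lra.
    have h2 : `|t^-1 *: (phi (theta + t *: a) - phi theta) - dphi k| < eps / 2.
      by apply: hd1 => //; [exact: K2K|lra].
    move: h1 h2; set q1 := _ *: _; set q2 := _ *: _ => h1 h2.
    have : `|f (q1 - q2) - F k1| <= `|q1 - dphi (k + k1)| + `|q2 - dphi k|.
      apply: (le_trans (fl _ _)).
      rewrite [X in `|X| <= _](_ : _ = (q1 - dphi (k + k1)) - (q2 - dphi k)).
        exact: ler_normB.
      by rewrite !opprB [LHS]addrACA [RHS]addrACA (addrC (- q2)).
    rewrite ler_norml => /andP[_]; rewrite /F; lra.
  apply: (@le_trans _ _ 1).
    by apply: (le_trans _ (f1 _)); exact: ler_norm.
  apply: Ufar => k1 K1k1; rewrite leNgt; apply/negP => h.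
  by apply: far; exists k1.
- have bcU : bounded_continuous U.
    by split; [exact: lipschitz_continuous UL|exists (3 + 3 * eps)].
  have bcF : bounded_continuous F.
    apply: (bounded_continuous_comp (BL1_bounded_continuous fBL)).
    exact: continuous_increment.
  have iU := continuous_borel_integrable G bcU.
  have iF := continuous_borel_integrable G bcF.
  have ic (c : R) : G.-integrable [set: borel D] (EFin \o cst c).
    exact: finite_measure_integrable_cst.
  have mK1C : measurable (~` K1 : set (borel D)) by exact: measurableC.
  have iI : G.-integrable [set: borel D] (EFin \o (fun x => 4 * \1_(~` K1) x)).
    have iI0 : G.-integrable [set: borel D] (EFin \o \1_(~` K1)).
      exact: integrable_indic.
    exact: (integrableZl measurableT 4 iI0).
  have iFc : G.-integrable [set: borel D] (EFin \o (fun x => F x + 3 * eps)).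
    exact: (integrableD measurableT iF (ic (3 * eps))).
  (* On [K1] the majorant exceeds [F] by at most [3 * eps]; elsewhere it may exceed it by 4 more, on
     a set of mass at most [eps]. Hence the 7. *)
  apply: (@le_trans _ _ (\int[G]_x ((F x + 3 * eps) + 4 * \1_(~` K1) x))).
    apply: le_Rintegral => //; first exact: (integrableD measurableT iFc iI).
    move=> x _; have [hK hnK] := Uint x.
    rewrite indicE; case: (boolP (x \in ~` K1)) => [_|] /=; first lra.
    move/negP; rewrite in_setE /= => /contrapT/hK; lra.
  have -> : \int[G]_x (F x + 3 * eps + 4 * \1_(~` K1) x) =
      \int[G]_x F x + 3 * eps + 4 * fine (G (~` K1)).
    rewrite (RintegralD measurableT iFc iI) (RintegralD measurableT iF (ic (3 * eps))).
    rewrite [X in _ + X + _ = _](congr1 fine (integral_cst_prob G (3 * eps))).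
    rewrite RintegralZl//; last exact: integrable_indic.
    by rewrite /Rintegral integral_indic// setIT.
  have : fine (G (~` K1)) <= eps.
    rewrite -lee_fin fineK ?fin_num_measure// probability_setC//.
    by rewrite leeBlDr ?fin_num_measure// addeC -leeBlDr// -EFinB.
  rewrite /F; lra.
Qed.

(** Only positive homogeneity of the outer expectation is needed: [U / M] belongs to [BL1]. *)
Lemma outer_expectation_lipschitz d (W : measurableType d)
    (P : probability W R) (B : W -> D) (b M : R) (U : D -> R) :
  (forall g, BL1 D g ->
    `|outer_expectation P (g \o B) - \int[G]_z (g z)%:E|%E <= b%:E)%E ->
  0 < M -> (forall x y, `|U x - U y| <= M * `|x - y|) -> (forall x, `|U x| <= M) ->
  (`|outer_expectation P (U \o B) - \int[G]_z (U z)%:E| <= (M * b)%:E)%E.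
Proof.
move=> hb M0 UL UM.
pose g := fun z => M^-1 * U z.
have gBL : BL1 D g.
  have Mi : `|M^-1| = M^-1 by rewrite ger0_norm// invr_ge0 ltW.
  split => [x|x y]; rewrite /g -?mulrBr normrM Mi mulrC ler_pdivrMr//.
    by rewrite mul1r.
  by rewrite mulrC.
have bcU : bounded_continuous U.
  by split; [exact: lipschitz_continuous UL|exists M].
have UE : U \o B = (fun w => M * (g \o B) w).
  by apply/funext => w; rewrite /g /= mulrA divff ?mul1r// gt_eqF.
have -> : (\int[G]_z (U z)%:E = M%:E * \int[G]_z (g z)%:E)%E.
  rewrite -integralZl//; last exact: continuous_borel_integrable (BL1_bounded_continuous gBL).
  by apply: eq_integral => z _; rewrite -EFinM /g mulrA divff ?mul1r// gt_eqF.
rewrite UE outer_expectationZ// -muleBr//; last first.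
  rewrite fin_num_adde_defr//.
  by apply: (@outer_expectation_fin_num _ _ _ _ 1) => w; exact: gBL.1.
rewrite abseM EFinM gee0_abs; last by rewrite lee_fin ltW.
by rewrite lee_pmul2l//; exact: hb.
Qed.

Lemma lee_abs_sub (a c : \bar R) (e : R) : a \is a fin_num -> c \is a fin_num ->
  (`|a - c| <= e%:E)%E = (a <= c + e%:E)%E && (c <= a + e%:E)%E.
Proof.
move=> /fineK <- /fineK <-; rewrite -EFinB -!EFinD !lee_fin.
by rewrite ler_distlC lerBlDr.
Qed.

Lemma bootstrap_bound (K : set D) (eps : R) :
  compact K -> K `<=` law_support G -> 0 < eps <= 1 ->
  exists delta M : R, [/\ 0 < delta, 0 < M &
    forall d (W : measurableType d) (P : probability W R) k t a (B : W -> D) b,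
    K k -> 0 < t < delta -> `|k - a| < delta ->
    Dphi (theta + t *: a) -> (forall w, Dphi (theta + t *: (a + B w))) ->
    (forall g, BL1 D g ->
      `|outer_expectation P (g \o B) - \int[G]_z (g z)%:E|%E <= b%:E)%E ->
    forall f, BL1 E f ->
    (`|outer_expectation P (fun w =>
        f (t^-1 *: (phi (theta + t *: (a + B w)) - phi (theta + t *: a))))%R
      - \int[G]_z (f (dphi (k + z) - dphi k)%R)%:E| <= (M * b + 7 * eps)%:E)%E].
Proof.
move=> cK KS heps.
have [delta [M [d0 M0 H]]] := increment_lipschitz_majorant cK KS heps.
exists delta, M; split => // d W P k t a B b Kk td ka Da DaB hb f fBL.
have nfBL : BL1 E (fun y => - f y).
  by split => [x|x y]; rewrite ?normrN -?opprD ?normrN; [exact: fBL.1|exact: fBL.2].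
have ifin (g : D -> R) : bounded_continuous g -> (\int[G]_z (g z)%:E)%E \is a fin_num.
  by move=> bg; apply: integrable_fin_num => //; exact: continuous_borel_integrable.
have bcF : bounded_continuous (fun z => f (dphi (k + z) - dphi k)).
  apply: (bounded_continuous_comp (BL1_bounded_continuous fBL)).
  exact: continuous_increment.
have bcL (U : D -> R) : (forall x y, `|U x - U y| <= M * `|x - y|) ->
    (forall x, `|U x| <= M) -> bounded_continuous U.
  by move=> h1 h2; split; [exact: lipschitz_continuous h1|exists M].
have ofin (g : W -> R) (m : R) : (forall w, `|g w| <= m) ->
  outer_expectation P g \is a fin_num by exact: outer_expectation_fin_num.
have RE (g : D -> R) : bounded_continuous g ->
    (\int[G]_z (g z)%:E)%E = (\int[G]_z (g z))%:E.
  by move=> bg; rewrite fineK// ifin.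
have Tfin : outer_expectation P (fun w =>
    f (t^-1 *: (phi (theta + t *: (a + B w)) - phi (theta + t *: a)))) \is a fin_num.
  by apply: (@ofin _ 1) => w; exact: fBL.1.
rewrite lee_abs_sub//; last exact: ifin.
apply/andP; split.
  have [U [UL UM UT UI]] := H k f t a Kk fBL td ka Da.
  have bcU := bcL _ UL UM.
  have := outer_expectation_lipschitz hb M0 UL UM.
  rewrite lee_abs_sub; [|exact: (ofin _ M (fun w => UM (B w)))|exact: ifin].
  move=> /andP[h _].
  apply: (@le_trans _ _ (outer_expectation P (U \o B))).
    by apply: le_outer_expectation => w; exact: UT.
  apply: (le_trans h); rewrite !RE// -!EFinD lee_fin; lra.
(* Outer expectation is not odd. The lower bound therefore uses the minorant [- U] of [f], where [U]
   majorizes [- f], and applies the hypothesis on [BL1] to [- U] itself. *)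
have [U [UL UM UT UI]] := H k _ t a Kk nfBL td ka Da.
have UL' x y : `|- U x - - U y| <= M * `|x - y| by rewrite -opprD normrN.
have UM' x : `|- U x| <= M by rewrite normrN.
have bcU := bcL _ UL' UM'.
have := outer_expectation_lipschitz hb M0 UL' UM'.
rewrite lee_abs_sub; [|exact: (ofin _ M (fun w => UM' (B w)))|exact: ifin].
move=> /andP[_ h].
have h2 : (outer_expectation P (fun w => - U (B w))%R <= outer_expectation P (fun w =>
    f (t^-1 *: (phi (theta + t *: (a + B w)) - phi (theta + t *: a)))%R))%E.
  by apply: le_outer_expectation => w; rewrite lerNl; exact: UT.
have {}h : (\int[G]_z (- U z)%R%:E <= outer_expectation P (fun w =>
    f (t^-1 *: (phi (theta + t *: (a + B w)) - phi (theta + t *: a)))%R) + (M * b)%:E)%E.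
  by apply: (le_trans h); rewrite leeD2r.
move: h UI; rewrite !RE//.
have -> : \int[G]_z (- U z) = - \int[G]_z U z.
  by rewrite RintegralN//; exact: continuous_borel_integrable (bcL _ UL UM).
have -> : \int[G]_z (- f (dphi (k + z) - dphi k)) = - \int[G]_z f (dphi (k + z) - dphi k).
  by rewrite RintegralN//; exact: continuous_borel_integrable bcF.
move: Tfin => /fineK <-; rewrite -!EFinD !lee_fin; lra.
Qed.

End bootstrap_bound.

(** * Consequences in outer probability *)

Section ereal_limits.
Context {R : realType}.
Implicit Type u : nat -> \bar R.

Lemma ereal_cvg0 u : (forall n, (0 <= u n)%E) ->
  (forall e : R, 0 < e -> \forall n \near \oo, (u n <= e%:E)%E) -> u @ \oo --> 0%E.
Proof.
move=> u0 ue; apply/fine_cvgP; split.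
  apply: filterS (ue 1 ltr01) => n un; rewrite ge0_fin_numE//.
  by rewrite (le_lt_trans un)// ltry.
apply/cvgr0Pnorm_le => e e0; apply: filterS (ue e e0) => n un /=.
have unf : u n \is a fin_num by rewrite ge0_fin_numE// (le_lt_trans un)// ltry.
by rewrite ger0_norm ?fine_ge0// -lee_fin fineK.
Qed.

Lemma ereal_cvg_le u (l c : R) : u @ \oo --> l%:E -> l < c ->
  \forall n \near \oo, (u n <= c%:E)%E.
Proof.
move=> /fine_cvgP[uf uc] lc.
have cl0 : 0 < c - l by rewrite subr_gt0.
near=> n.
have un : u n \is a fin_num by near: n.
have : `|l - fine (u n)| <= c - l.
  by near: n; move: uc => /cvgrPdist_le /(_ _ cl0).
by rewrite -[u n]fineK// lee_fin ler_norml => /andP[]; lra.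
Unshelve. all: by end_near. Qed.

Lemma ereal_cvg_ge u (l c : R) : u @ \oo --> l%:E -> c < l ->
  \forall n \near \oo, (c%:E <= u n)%E.
Proof.
move=> /fine_cvgP[uf uc] lc.
have cl0 : 0 < l - c by rewrite subr_gt0.
near=> n.
have un : u n \is a fin_num by near: n.
have : `|l - fine (u n)| <= l - c.
  by near: n; move: uc => /cvgrPdist_le /(_ _ cl0).
by rewrite -[u n]fineK// lee_fin ler_norml => /andP[]; lra.
Unshelve. all: by end_near. Qed.

End ereal_limits.

Section consequences.
Context {R : realType} {D E : normedModType R}.
Variables (phi : D -> E) (Dphi : set D) (theta : D) (D0 : set D) (dphi : D -> E).
Hypothesis hphi : is_hadamard_directional_derivative phi Dphi theta D0 dphi.
Hypothesis cdphi : continuous dphi.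
Variable G : probability (borel D) R.
Hypothesis tG : tight G.
Hypothesis SD0 : law_support G `<=` D0.
Hypothesis subS : vector_subspace (law_support G).
Context (dX dW : measure_display) (X : nat -> measurableType dX)
  (W : nat -> measurableType dW).
Variables (PX : forall n, probability (X n) R) (PW : forall n, probability (W n) R).
Variables (theta_hat : forall n, X n -> D) (theta_star : forall n, X n -> W n -> D).
Hypothesis htheta_hat : forall n x, Dphi (@theta_hat n x).
Hypothesis htheta_star : forall n x w, Dphi (@theta_star n x w).
Variable r : nat -> R.
Hypothesis r_oo : r @ \oo --> +oo.
Hypothesis hcvg : cvg_in_law PX (fun n x => r n *: (@theta_hat n x - theta)) G.
Hypothesis hboot : cvg_to0_in_outer_probability PX
    (fun n x => ereal_sup
      [set `| outer_expectation (PW n)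
                (fun w => f (r n *: (@theta_star n x w - @theta_hat n x)))
              - \int[G]_z (f z)%:E |%E | f in BL1 D]).

Let beta n (x : X n) := ereal_sup [set `| outer_expectation (PW n)
    (fun w => f (r n *: (@theta_star n x w - @theta_hat n x)))
    - \int[G]_z (f z)%:E |%E | f in BL1 D].

Let gamma n (x : X n) := ereal_sup [set `| outer_expectation (PW n)
    (fun w => f (r n *: (phi (@theta_star n x w) - phi (@theta_hat n x))))
    - \int[G]_z (f (dphi z))%:E |%E | f in BL1 E].

Let S0 : law_support G !=set0.
Proof. by exists 0; have [] := subS. Qed.

(** One direction of the portmanteau theorem: the indicator of the ball dominates a continuous tent
    function with positive [G]-integral [I], and the outer expectations of the tent tend to [I],
    hence are eventually at least [I / 2]. *)
Lemma support_approached h (d : R) : law_support G h -> 0 < d ->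
  exists2 c : R, 0 < c & \forall n \near \oo, (c%:E <= outer_probability (PX n)
    [set x | (`|h - r n *: (@theta_hat n x - theta)| < d)%R])%E.
Proof.
move=> Sh d0.
pose f z := Num.max (1 - `|h - z| / d) 0.
have f0 z : 0 <= f z by rewrite /f le_max lexx orbT.
have f1 z : f z <= 1.
  by rewrite /f ge_max ler01 andbT lerBlDr lerDl divr_ge0// ltW.
have cf : continuous f.
  move=> z; apply: (@continuous_max _ _ (fun z => 1 - `|h - z| / d) (fun=> 0)).
    apply: continuousB; first exact: cst_continuous.
    apply: continuousM; last exact: cst_continuous.
    apply: continuous_comp; last exact: norm_continuous.
    by apply: continuousB; [exact: cst_continuous|exact: id].
  exact: cst_continuous.
have bcf : bounded_continuous f.
  by split => //; exists 1 => z; rewrite ger0_norm.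
have d20 : 0 < d / 2 by rewrite divr_gt0.
(* On this half-size ball, which has positive mass because [h] is in the support, the tent is at
   least 1/2. *)
pose U := [set z | `|h - z| < d / 2].
have oU : open U.
  rewrite (_ : U = ball h (d / 2)); last by rewrite -ball_normE.
  exact: ball_open.
have GU : (0 < G U)%E by apply: Sh => //; rewrite /U /= subrr normr0.
have mU := open_borel oU.
have fint := integrable_fin_num measurableT (continuous_borel_integrable G bcf).
set I := (\int[G]_z (f z)%:E)%E in fint.
have I0 : (0 < I)%E.
  apply: (@lt_le_trans _ _ (\int[G]_z ((2^-1)%:E * (\1_U z)%:E))%E).
    rewrite ge0_integralZl//; last first.
    - by apply/measurable_EFinP; exact: measurable_indic.
    by rewrite integral_indic// setIT mule_gt0.
  apply: ge0_le_integral => //.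
  - by apply/measurable_EFinP/measurable_funM => //; exact: measurable_indic.
  - by apply/measurable_EFinP; exact: continuous_borel.
  - move=> z _; rewrite lee_fin indicE; case: (boolP (z \in U)) => [|_]; last first.
      by rewrite mulr0.
    move=> /set_mem /=; rewrite /U /= => hz; rewrite mulr1 le_max; apply/orP; left.
    rewrite lerBrDr -lerBrDl ler_pdivrMr//; lra.
exists (fine I / 2).
  by rewrite divr_gt0// fine_gt0// I0 -ge0_fin_numE// ltW.
have /ereal_cvg_ge : outer_expectation (PX n) (fun x => f (r n *: (@theta_hat n x - theta)))
    @[n --> \oo] --> (fine I)%:E by rewrite fineK//; exact: hcvg.
have I2 : fine I / 2 < fine I.
  have : 0 < fine I by rewrite fine_gt0// I0 -ge0_fin_numE// ltW.
  lra.
move=> /(_ _ I2); apply: filterS => n /le_trans; apply.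
apply: outer_expectation_le_prob => // x /= hx.
rewrite /f ge_max lexx andbT lerBlDr add0r ler_pdivlMr// mul1r leNgt.
exact/negP.
Qed.

Let r_large (d : R) : 0 < d -> \forall n \near \oo, 0 < (r n)^-1 < d.
Proof.
move=> d0; have := r_oo => /cvgryPgt /(_ d^-1); apply: filterS => n rn.
have r0 : 0 < r n by apply: lt_trans rn; rewrite invr_gt0.
by rewrite invr_gt0 r0 /= invf_plt.
Qed.

(** With [t = (r n)^-1], [a] the scaled estimation error and [b] the scaled bootstrap error, the two
    estimators are [theta + t *: a] and [theta + t *: (a + b)], as [bootstrap_bound] expects. *)
Let theta_hatE n x : 0 < (r n)^-1 ->
  theta + (r n)^-1 *: (r n *: (@theta_hat n x - theta)) = @theta_hat n x.
Proof.
by rewrite invr_gt0 => r0; rewrite scalerA mulVf ?gt_eqF// scale1r addrC subrK.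
Qed.

Let theta_starE n x w : 0 < (r n)^-1 ->
  theta + (r n)^-1 *: (r n *: (@theta_hat n x - theta) +
     r n *: (@theta_star n x w - @theta_hat n x)) = @theta_star n x w.
Proof.
rewrite invr_gt0 => r0; rewrite -scalerDr scalerA mulVf ?gt_eqF// scale1r.
have -> : @theta_hat n x - theta + (@theta_star n x w - @theta_hat n x) =
  @theta_star n x w - theta by rewrite addrC addrA subrK.
by rewrite addrC subrK.
Qed.

(** A set of positive outer probability is nonempty, so for large [n] some data set gives a point of
    [Dphi] at step [(r n)^-1] in a direction close to [h]. *)
Lemma support_contingent h : law_support G h -> contingent Dphi theta h.
Proof.
move=> Sh d d0; have [c c0 hc] := support_approached Sh d0.
have hn : \forall n \near \oo, exists t h', [/\ 0 < t < d, `|h - h'| < d &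
    Dphi (theta + t *: h')].
  near=> n.
  have rn : 0 < (r n)^-1 < d by near: n; exact: r_large.
  have : (c%:E <= outer_probability (PX n)
    [set x | (`|h - r n *: (@theta_hat n x - theta)| < d)%R])%E by near: n.
  have [[x hx] _|hN] := pselect ([set x | `|h - r n *: (@theta_hat n x - theta)| < d] !=set0).
    exists (r n)^-1, (r n *: (@theta_hat n x - theta)); split => //.
    by rewrite theta_hatE//; case/andP: rn.
  move/set0P/negP/negPn/eqP: hN => ->.
  rewrite leNgt => /negP[]; apply: (@le_lt_trans _ _ 0%E); last by rewrite lte_fin.
  by apply: ereal_inf_lbound; exists set0; [split|exact: measure0].
by have [n] := filter_ex hn.
Unshelve. all: by end_near. Qed.

Lemma bootstrap_estimate (K : set D) (eps : R) :
  compact K -> K `<=` law_support G -> 0 < eps <= 1 ->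
  exists delta M : R, [/\ 0 < delta, 0 < M & forall n x k b,
    0 < (r n)^-1 < delta -> K k -> `|k - r n *: (@theta_hat n x - theta)| < delta ->
    (`|ereal_sup [set `| outer_expectation (PW n)
                (fun w => f (r n *: (@theta_star n x w - @theta_hat n x)))
              - \int[G]_z (f z)%:E |%E | f in BL1 D]| <= b%:E)%E ->
    forall f, BL1 E f ->
    (`|outer_expectation (PW n) (fun w =>
        f (r n *: (phi (@theta_star n x w) - phi (@theta_hat n x))))%R
      - \int[G]_z (f (dphi (k + z) - dphi k)%R)%:E| <= (M * b + 7 * eps)%:E)%E].
Proof.
move=> cK KS heps.
have [delta [M [d0 M0 H]]] := bootstrap_bound hphi cdphi tG SD0 subS cK KS heps.
exists delta, M; split => // n x k b rn Kk kx hb f fBL.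
have ri0 : 0 < (r n)^-1 by case/andP: rn.
have := H _ _ (PW n) k (r n)^-1 (r n *: (@theta_hat n x - theta))
  (fun w => r n *: (@theta_star n x w - @theta_hat n x)) b Kk rn kx.
rewrite theta_hatE// => /(_ (@htheta_hat n x)).
have hs w : Dphi (theta + (r n)^-1 *: (r n *: (@theta_hat n x - theta) +
     r n *: (@theta_star n x w - @theta_hat n x))) by rewrite theta_starE.
move=> /(_ hs) /(_ _ f fBL); rewrite invrK.
have -> : (fun w => f (r n *: (phi (theta + (r n)^-1 *: (r n *: (@theta_hat n x - theta) +
     r n *: (@theta_star n x w - @theta_hat n x))) - phi (@theta_hat n x)))) =
   (fun w => f (r n *: (phi (@theta_star n x w) - phi (@theta_hat n x)))).
  by apply/funext => w; rewrite theta_starE.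
apply => g gBL; apply: le_trans hb; apply: le_trans (lee_abs _).
by apply: ereal_sup_ubound; exists g.
Qed.

(** Property (H). The data are near [h] with outer probability at least [c], while each consistency
    statement fails with outer probability at most [c / 3]; by subadditivity some data point
    satisfies all three conditions. It compares two deterministic integrals, so one point is
    enough. *)
Lemma increment_law_of_bootstrap :
  cvg_to0_in_outer_probability PX
    (fun n x => ereal_sup
      [set `| outer_expectation (PW n)
                (fun w => f (r n *: (phi (@theta_star n x w)
                                     - phi (@theta_hat n x))))
              - \int[G]_z (f (dphi z))%:E |%E | f in BL1 E]) ->
  forall h f, law_support G h -> BL1 E f ->
    (\int[G]_z (f (dphi (h + z) - dphi h)%R)%:E = \int[G]_z (f (dphi z))%:E)%E.
Proof.
move=> hcons h f Sh fBL.
have bf := BL1_bounded_continuous fBL.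
have bc1 : bounded_continuous (fun z => f (dphi (h + z) - dphi h)).
  by apply: (bounded_continuous_comp bf); exact: continuous_increment.
have bc2 : bounded_continuous (fun z => f (dphi z)) by exact: bounded_continuous_comp.
have fin1 := integrable_fin_num measurableT (continuous_borel_integrable G bc1).
have fin2 := integrable_fin_num measurableT (continuous_borel_integrable G bc2).
rewrite -[LHS]fineK// -[RHS]fineK//; congr EFin.
apply/eqP; rewrite -subr_eq0 -normr_eq0 eq_le normr_ge0 andbT.
apply/ler_addgt0Pr => e e0; rewrite add0r.
(* The estimate at [h] costs [M * (eps / M) + 7 * eps], and the assumed consistency costs one more
   [eps]. *)
pose eps := Num.min 1 (e / 9).
have eps0 : 0 < eps by rewrite lt_min ltr01 divr_gt0.
have eps1 : eps <= 1 by rewrite ge_min lexx.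
have epse : eps <= e / 9 by rewrite ge_min lexx orbT.
have heps : 0 < eps <= 1 by rewrite eps0.
have hS : [set h] `<=` law_support G by move=> _ ->.
have [delta [M [d0 M0 H]]] := bootstrap_estimate (@compact_set1 _ h) hS heps.
have [c c0 hc] := support_approached Sh d0.
have eM : 0 < eps / M by rewrite divr_gt0.
have c30 : 0 < c / 3 by rewrite divr_gt0.
have := hcons _ eps0; have := hboot eM.
move=> /ereal_cvg_le /(_ c30) hb /ereal_cvg_le /(_ c30) hc'.
suff /filter_ex[n] : \forall n \near \oo, `|fine (\int[G]_z (f (dphi (h + z) - dphi h)%R)%:E)%E -
   fine (\int[G]_z (f (dphi z))%:E)%E| <= e by [].
near=> n.
have rn : 0 < (r n)^-1 < delta by near: n; exact: r_large.
have h1 : (c%:E <= outer_probability (PX n)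
    [set x | (`|h - r n *: (@theta_hat n x - theta)| < delta)%R])%E by near: n.
have h2 : (outer_probability (PX n) [set x | (eps / M)%:E < `|@beta n x|] <= (c / 3)%:E)%E.
  by near: n.
have h3 : (outer_probability (PX n) [set x | eps%:E < `|@gamma n x|] <= (c / 3)%:E)%E.
  by near: n.
set B1 := [set x | _] in h2; set B2 := [set x | _] in h3.
have [x [hx nB1 nB2]] : exists x, [/\ `|h - r n *: (@theta_hat n x - theta)| < delta,
    ~ B1 x & ~ B2 x].
  apply: contrapT => hno.
  have : (c%:E <= (c / 3)%:E + (c / 3)%:E)%E.
    apply: (le_trans h1).
    apply: (@le_trans _ _ (outer_probability (PX n) (B1 `|` B2))); last first.
      by apply: (le_trans (outer_probabilityU _ _ _)); exact: leeD.
    apply: le_outer_probability => x hx.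
    have [|nB1] := pselect (B1 x); first by left.
    have [|nB2] := pselect (B2 x); first by right.
    by exfalso; apply: hno; exists x.
  rewrite -EFinD lee_fin; lra.
have /= := H n x h (eps / M) rn erefl hx; move: nB1 => /= /negP; rewrite -leNgt => nB1.
move=> /(_ nB1 f fBL); rewrite mulrC divfK ?gt_eqF//.
have : (`|outer_expectation (PW n) (fun w =>
        f (r n *: (phi (@theta_star n x w) - phi (@theta_hat n x))))%R
      - \int[G]_z (f (dphi z))%:E| <= eps%:E)%E.
  move: nB2 => /= /negP; rewrite -leNgt; apply: le_trans; apply: le_trans (lee_abs _).
  by apply: ereal_sup_ubound; exists f.
have Tfin : outer_expectation (PW n) (fun w =>
        f (r n *: (phi (@theta_star n x w) - phi (@theta_hat n x))))%R \is a fin_num.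
  by apply: (@outer_expectation_fin_num _ _ _ _ 1) => w; exact: fBL.1.
rewrite -[X in (`|X - _| <= _)%E -> _]fineK//.
rewrite -[X in _ -> (`|X - _| <= _)%E -> _]fineK//.
rewrite -[X in (`|_ - X| <= _)%E -> _]fineK//.
rewrite -[X in _ -> (`|_ - X| <= _)%E -> _]fineK//.
rewrite -!EFinB /= !lee_fin.
set a := fine _; set b := fine _; set g := fine _ => i1 i2.
have := ler_distD a g b; rewrite (distrC g a); lra.
Unshelve. all: by end_near. Qed.

(** With high outer probability the scaled estimation error is close to some [k] in a compact part
    [K] of the support. The estimate at [k] applies, and by linearity its limit law does not depend
    on [k]. *)
Lemma bootstrap_of_linear : linear_on (law_support G) dphi ->
  cvg_to0_in_outer_probability PX
    (fun n x => ereal_sup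
      [set `| outer_expectation (PW n)
                (fun w => f (r n *: (phi (@theta_star n x w)
                                     - phi (@theta_hat n x))))
              - \int[G]_z (f (dphi z))%:E |%E | f in BL1 E]).
Proof.
move=> lind e e0; apply: ereal_cvg0 => [n|eta eta0]; first exact: outer_probability_ge0.
(* The estimate costs [8 * eps]; the exceptional sets [B1] and [B2] have outer probability at most
   [eps] and [2 * eps]. *)
pose eps := Num.min 1 (Num.min (e / 8) (eta / 3)).
have eps0 : 0 < eps by rewrite !lt_min ltr01 !divr_gt0.
have eps1 : eps <= 1 by rewrite !ge_min lexx.
have epse : eps <= e / 8 by rewrite !ge_min lexx orbT.
have epseta : eps <= eta / 3 by rewrite !ge_min lexx !orbT.
have heps : 0 < eps <= 1 by rewrite eps0.
have [K' [cK' K'S GK']] := tight_support tG S0 eps0.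
pose K := K' `|` [set 0 : D].
have cK : compact K by apply: compactU => //; exact: compact_set1.
have KS : K `<=` law_support G by move=> x [/K'S//|->]; have [] := subS.
have K0 : K !=set0 by exists 0; right.
have mK := compact_borel cK.
have GK : ((1 - eps)%:E <= G K)%E.
  by apply: (le_trans GK'); apply: measure_le => //; [exact: compact_borel|left].
have [delta [M [d0 M0 H]]] := bootstrap_estimate cK KS heps.
have eM : 0 < eps / M by rewrite divr_gt0.
(* A continuous function that is 0 on [K] and 1 at distance at least [delta] from it. Its
   [G]-integral is at most [eps], so convergence in law and Markov's inequality bound the outer
   probability of being far from [K]. *)
pose rho z := Num.min (distance_to K z / delta) 1.
have rho0 z : 0 <= rho z.
  by rewrite le_min ler01 andbT divr_ge0//; [exact: distance_to_ge0|exact: ltW].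
have rho1 z : rho z <= 1 by rewrite ge_min lexx orbT.
have bcrho : bounded_continuous rho.
  split; last by exists 1 => z; rewrite ger0_norm.
  apply: (@lipschitz_continuous _ _ _ delta^-1) => a b.
  apply: (le_trans (min_lip _ _ _)); rewrite -mulrBl normrM mulrC.
  rewrite (ger0_norm (_ : 0 <= delta^-1)); last by rewrite invr_ge0 ltW.
  by rewrite ler_pM2l ?invr_gt0//; exact: distance_to_lip.
have rhofin := integrable_fin_num measurableT (continuous_borel_integrable G bcrho).
have rhoeps : (\int[G]_z (rho z)%:E <= eps%:E)%E.
  apply: (@le_trans _ _ (G (~` K))).
    have -> : G (~` K) = (\int[G]_z (\1_(~` K) z)%:E)%E.
      by rewrite integral_indic// ?setIT//; exact: measurableC.
    apply: ge0_le_integral => //.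
    - by move=> z _; rewrite lee_fin.
    - by apply/measurable_EFinP; exact: continuous_borel bcrho.1.
    - by apply/measurable_EFinP; apply: measurable_indic; exact: measurableC.
    - move=> z _; rewrite lee_fin indicE; case: (boolP (z \in ~` K)) => [_|] //=.
      move/negP; rewrite in_setE /= => /contrapT Kz.
      by rewrite /rho distance_to_eq0// mul0r ge_min lexx.
  rewrite probability_setC// leeBlDr ?fin_num_measure// addeC -leeBlDr//.
have := hboot eM => /ereal_cvg_le /(_ eps0) hb.
have : outer_expectation (PX n) (fun x => rho (r n *: (@theta_hat n x - theta)))
    @[n --> \oo] --> (fine (\int[G]_z (rho z)%:E)%E)%:E by rewrite fineK//; exact: hcvg.
have hlt : fine (\int[G]_z (rho z)%:E)%E < 2 * eps.
  apply: (@le_lt_trans _ _ eps); last by lra.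
  by rewrite -lee_fin fineK.
move=> /ereal_cvg_le /(_ hlt) hr.
near=> n.
have rn : 0 < (r n)^-1 < delta by near: n; exact: r_large.
have h1 : (outer_expectation (PX n) (fun x => rho (r n *: (@theta_hat n x - theta)))
    <= (2 * eps)%:E)%E by near: n.
have h2 : (outer_probability (PX n) [set x | (eps / M)%:E < `|@beta n x|] <= eps%:E)%E.
  by near: n.
set B1 := [set x | _] in h2.
pose B2 := [set x | delta <= distance_to K (r n *: (@theta_hat n x - theta))].
have h3 : (outer_probability (PX n) B2 <= (2 * eps)%:E)%E.
  apply: (le_trans _ h1); apply: outer_markov => [x|x] //=.
  by rewrite /B2 /= => hx; rewrite /rho le_min lexx andbT ler_pdivlMr// mul1r.
apply: (@le_trans _ _ (eps%:E + (2 * eps)%:E)%E); last by rewrite -EFinD lee_fin; lra.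
apply: (@le_trans _ _ (outer_probability (PX n) (B1 `|` B2))); last first.
  by apply: (le_trans (outer_probabilityU _ _ _)); exact: leeD.
apply: le_outer_probability => x /= hx.
have [|nB1] := pselect (B1 x); first by left.
right; rewrite /B2 /= leNgt; apply/negP => /(distance_to_lt K0)[k Kk].
rewrite distrC => kx.
move: nB1 => /= /negP; rewrite -leNgt => nB1.
have {}H := H n x k (eps / M) rn Kk kx nB1.
suff : (`|ereal_sup [set `|outer_expectation (PW n) (fun w =>
    f (r n *: (phi (@theta_star n x w) - phi (@theta_hat n x)))) -
        \int[G]_z (f (dphi z))%:E|%E | f in BL1 E]| <= e%:E)%E.
  by rewrite leNgt hx.
rewrite gee0_abs; last first.
  apply: (le_trans (abse_ge0 _)); apply: ereal_sup_ubound.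
  exists (fun=> 0); last reflexivity.
  by split => [a|a b]; rewrite ?subrr normr0.
apply: ge_ereal_sup => _ [f fBL <-].
have := H f fBL; rewrite mulrC divfK ?gt_eqF//.
have -> : (\int[G]_z (f (dphi (k + z) - dphi k)%R)%:E = \int[G]_z (f (dphi z))%:E)%E.
  have bf := BL1_bounded_continuous fBL.
  have bc1 : bounded_continuous (fun z => f (dphi (k + z) - dphi k)).
    by apply: (bounded_continuous_comp bf); exact: continuous_increment.
  have bc2 : bounded_continuous (fun z => f (dphi z)) by exact: bounded_continuous_comp.
  (* Additivity of [dphi] is known only on the support, which has full measure. *)
  apply: ae_eq_integral => //.
  - by apply/measurable_EFinP; exact: continuous_borel bc1.1.
  - by apply/measurable_EFinP; exact: continuous_borel bc2.1.
  have mS := closed_borel (@law_support_closed _ _ G).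
  have GSC : G (~` law_support G) = 0%E.
    by rewrite probability_setC// law_support_full// subee.
  exists (~` law_support G); split.
  - exact: measurableC.
  - exact: GSC.
  move=> z /= hz Sz; apply: hz => _; congr (f _)%:E.
  have := lind 1 k z (KS _ Kk) Sz; rewrite !scale1r => ->.
    by rewrite addrC addrA addNr add0r.
  by rewrite -[k]scale1r; apply: subS.2 => //; exact: KS.
by move/le_trans; apply; rewrite lee_fin; lra.
Unshelve. all: by end_near. Qed.

End consequences.

(** * Norming functionals *)

Section hahn_banach.
Context {R : realType} {V : normedModType R}.

(** Graphs of functionals on subspaces dominated by the norm, encoded as relations. The last clause
    puts [(x, |x|)] in every nonempty graph but admits the empty one, as Zorn's lemma needs for the
    empty chain. *)
Let dominated_graph (x : V) (f : set (V * R)) :=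
  [/\ forall c p q, f p -> f q -> f (c *: p.1 + q.1, c * p.2 + q.2),
      forall p, f p -> p.2 <= `|p.1| &
      forall p, f p -> f (x, `|x|)].

Let maximal_dominated_graph x : exists f : set (V * R),
  [/\ dominated_graph x f, f (x, `|x|) & forall v, exists a, f (v, a)].
Proof.
have [|A [[Alin Adom Ax] Amax]] := @Zorn_bigcup _ (dominated_graph x).
  move=> F FP Ftot; split.
  - move=> c p q [f Ff fp] [g Fg gq].
    have [fg|gf] := Ftot _ _ Ff Fg.
      by exists g => //; have [h _ _] := FP _ Fg; apply: h => //; exact: fg.
    by exists f => //; have [h _ _] := FP _ Ff; apply: h => //; exact: gf.
  - by move=> p [f Ff fp]; have [_ h _] := FP _ Ff; exact: h.
  - by move=> p [f Ff fp]; exists f => //; have [_ _ h] := FP _ Ff; exact: h fp.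
have A0 : A (x, `|x|).
  apply: contrapT => nAx.
  have A0 : A = set0 by apply/seteqP; split => // p /Ax.
  apply: (Amax [set (c *: x, c * `|x|) | c in [set: R]]).
    rewrite A0; split=> // /(_ (x, `|x|)); apply; exists 1 => //.
    by rewrite scale1r mul1r.
  split.
  - move=> c _ _ [a _ <-] [b _ <-] /=; exists (c * a + b) => //.
    by rewrite scalerDl scalerA mulrDl mulrA.
  - by move=> _ [a _ <-] /=; rewrite normrZ ler_wpM2r// ler_norm.
  - by move=> _ _; exists 1 => //; rewrite scale1r mul1r.
have A00 : A (0, 0).
  have := Alin (-1) _ _ A0 A0; rewrite /= scaleN1r mulN1r !addNr; exact.
have Ascale c p : A p -> A (c *: p.1, c * p.2).
  by move=> Ap; have := Alin c _ _ Ap A00; rewrite /= !addr0.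
exists A; split => // v0; apply: contrapT => nv0.
pose B0 := [set p.2 - `|p.1 - v0| | p in A].
(* Any value at [v0] between the two sides for all [p] and [q] extends the functional with the norm
   bound; [c] is the supremum of the left sides. *)
have key p q : A p -> A q -> p.2 - `|p.1 - v0| <= `|q.1 + v0| - q.2.
  move=> Ap Aq; have := Alin 1 _ _ Ap Aq; rewrite scale1r mul1r => /Adom /= h.
  have : `|p.1 + q.1| <= `|p.1 - v0| + `|q.1 + v0|.
    by apply: le_trans (ler_normD _ _); rewrite addrACA addNr addr0.
  lra.
have B0sup : has_sup B0.
  split; first by exists (0 - `|0 - v0|), (0, 0).
  by exists (`|0 + v0| - 0) => _ [p Ap <-]; exact: (key p (0, 0)).
pose c := sup B0.
have cge p : A p -> p.2 - `|p.1 - v0| <= c.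
  by move=> Ap; apply: ub_le_sup; [exact: B0sup.2|exists p].
have cle q : A q -> c <= `|q.1 + v0| - q.2.
  by move=> Aq; apply: ge_sup; [exact: B0sup.1|move=> _ [p Ap <-]; exact: key].
pose B := [set (p.1 + t *: v0, p.2 + t * c) | p in A & t in [set: R]].
have AB : A `<=` B.
  move=> p Ap; exists p => //; exists 0 => //.
  by rewrite scale0r mul0r !addr0 -surjective_pairing.
apply: (Amax B).
  split => // BA; apply: nv0; exists c; apply: BA; exists (0, 0) => //.
  by exists 1 => //=; rewrite scale1r mul1r !add0r.
split.
- move=> e _ _ [p Ap [s _ <-]] [q Aq [t _ <-]] /=.
  exists (e *: p.1 + q.1, e * p.2 + q.2); first exact: Alin.
  exists (e * s + t) => //=; congr pair; last by ring.
  by rewrite scalerDr scalerDl scalerA addrACA.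
- move=> _ [p Ap [t _ <-]] /=; have [t0|t0|->] := ltgtP t 0.
  + have s0 : 0 < - t by rewrite oppr_gt0.
    have := cge _ (Ascale (- t)^-1 _ Ap); rewrite /= lerBlDr.
    rewrite -(ler_pM2l s0) mulrA divff ?mul1r ?gt_eqF// mulrDr.
    rewrite -{2}(gtr0_norm s0) -normrZ scalerBr scalerA divff ?scale1r ?gt_eqF//.
    rewrite scaleNr opprK; lra.
  + have := cle _ (Ascale t^-1 _ Ap); rewrite /= lerBrDr.
    rewrite -(ler_pM2l t0) mulrDr mulrA divff ?mul1r ?gt_eqF//.
    rewrite -{2}(gtr0_norm t0) -normrZ scalerDr scalerA divff ?scale1r ?gt_eqF//.
    lra.
  + by rewrite scale0r mul0r !addr0; exact: Adom.
- by move=> _ _; exact: AB.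
Qed.

(** Hahn-Banach. The graph is single-valued because domination at the vector 0 leaves no positive
    difference of two values; applied to [- y], domination also gives the bound from below. *)
Lemma norming_functional (x : V) : exists l : {linear V -> R^o},
  [/\ continuous l, forall y, `|l y| <= `|y| & l x = `|x|].
Proof.
have [f [[flin fdom _] fx /choice[l fl]]] := maximal_dominated_graph x.
have f0 v a b : f (v, a) -> f (v, b) -> a <= b.
  move=> fa fb; have := flin (-1) _ _ fb fa; rewrite /= scaleN1r mulN1r addNr.
  by move=> /fdom /=; rewrite normr0; lra.
have fu v a b : f (v, a) -> f (v, b) -> a = b.
  by move=> fa fb; apply/eqP; rewrite eq_le !(f0 v).
have llin : linear (l : V -> R^o).
  move=> a u v; apply: (fu (a *: u + v)) => //.
  exact: (flin a (u, l u) (v, l v)).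
pose L : {linear V -> R^o} := HB.pack (l : V -> R^o) (GRing.isLinear.Build _ _ _ _ _ llin).
have lle y : `|l y| <= `|y|.
  rewrite ler_norml; apply/andP; split; last exact: (fdom _ (fl y)).
  have := flin (-1) _ _ (fl y) (flin (-1) _ _ (fl y) (fl y)).
  rewrite /= scaleN1r mulN1r addNr addr0 addNr addr0 => /fdom /=.
  by rewrite normrN; lra.
exists L; split => //; last exact: (fu x).
move=> y; apply/cvgrPdist_lt => e e0; apply/nbhs_ballP; exists e => //= z.
have -> : l y - l z = L (y - z) by rewrite linearB.
by rewrite -ball_normE; exact: le_lt_trans.
Qed.

End hahn_banach.

(** * Rotation of Gaussian laws *)

Lemma Rintegral_law d d' (T : measurableType d) (T' : measurableType d') (R : realType)
    (P : {measure set T -> \bar R}) (nu : {measure set T' -> \bar R}) (X : T -> T')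
    (f : T' -> R) :
  measurable_fun [set: T] X ->
  (forall B, measurable B -> P (X @^-1` B) = nu B) ->
  measurable_fun [set: T'] f -> P.-integrable [set: T] (EFin \o (f \o X)) ->
  \int[P]_z f (X z) = \int[nu]_x f x.
Proof.
move=> mX hX mf intf; congr fine.
have mEf : measurable_fun [set: T'] (EFin \o f) by exact/measurable_EFinP.
have h := integral_pushforward (D := setT) mX mEf intf measurableT.
apply: (etrans (esym h)).
pose mX' := isMeasurableFun.Build _ _ _ _ _ mX.
pose X' : {mfun T >-> T'} := HB.pack X mX'.
apply: (@eq_measure_integral _ _ _ _ nu (pushforward P X')) => B mB _; exact: hX.
Qed.

Section normal.
Context {R : realType}.
Notation mu := (@lebesgue_measure R).

Lemma ge0_integral_affine (f : R -> R) (a b : R) : 0 < a -> continuous f ->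
  (forall x, 0 <= f x) ->
  (\int[mu]_x (f x)%:E = \int[mu]_x (f (a * x + b) * a)%:E)%E.
Proof.
move=> a0 cf f0; pose F (x : R) : R := a * x + b.
have dF (x : R) : is_derive x (1 : R) F a.
  by apply: is_derive_eq; rewrite addr0; exact: mulr1.
have F'E : F^`()%classic = cst a.
  by apply/funext => x; rewrite derive1E; apply: derive_val.
rewrite (@increasing_ge0_integration_by_substitutionT _ F f)//.
- by apply: eq_integral => x _; rewrite F'E.
- by move=> x y xy; rewrite /F ltrD2r ltr_pM2l.
- by rewrite F'E => x; exact: cvg_cst.
- by rewrite F'E; exact: is_cvg_cst.
- by rewrite F'E; exact: is_cvg_cst.
- rewrite /F; apply: (@cvg_comp _ _ _ (fun x => a * x) (fun x => x + b)); last exact: cvg_addrr_Ny.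
  by apply: gt0_cvgMrNy.
- rewrite /F; apply: (@cvg_comp _ _ _ (fun x => a * x) (fun x => x + b)); last exact: cvg_addrr.
  by apply: gt0_cvgMry.
Qed.

Lemma normal_pdf_scale (a s x : R) : 0 < a -> s != 0 ->
  normal_pdf 0 (a * s) (a * x) * a = normal_pdf 0 s x.
Proof.
move=> a0 s0; have as0 : a * s != 0 by rewrite mulf_neq0// gt_eqF.
rewrite !normal_pdfE// /normal_fun !subr0 mulrAC; congr (_ * expR _).
  rewrite /normal_peak.
  have -> : (a * s) ^+ 2 * pi *+ 2 = a ^+ 2 * (s ^+ 2 * pi *+ 2) by ring.
  rewrite sqrtrM ?sqr_ge0//.
  by rewrite sqrtr_sqr gtr0_norm// invfM mulrC mulrA divff ?mul1r// gt_eqF.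
rewrite !exprMn -mulrnAr -mulrN invfM mulrACA divff ?mul1r//.
by rewrite sqrf_eq0 gt_eqF.
Qed.

(** Completing the square: for independent X and Y of the same normal law, X - Y is centred with
    deviation [sqrt 2 * s], and given X - Y = z the variable Y is normal with mean [m - z / 2] and
    deviation [s / sqrt 2]. *)
Lemma normal_pdf_autocorrelation (m s y z : R) : s != 0 ->
  normal_pdf m s (z + y) * normal_pdf m s y =
  normal_pdf 0 (Num.sqrt 2 * s) z * normal_pdf (m - z / 2) (s / Num.sqrt 2) y.
Proof.
move=> s0.
have q0 : Num.sqrt 2 != 0 :> R by rewrite sqrtr_eq0 -ltNge.
have q2 : Num.sqrt 2 ^+ 2 = 2 :> R by rewrite sqr_sqrtr.
rewrite !normal_pdfE ?mulf_neq0 ?invr_neq0//.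
rewrite mulrACA [RHS]mulrACA /normal_fun -!expRD; congr (_ * expR _).
  have pos (t : R) : 0 <= t ^+ 2 * pi *+ 2.
    by rewrite mulrn_wge0// mulr_ge0 ?sqr_ge0 ?pi_ge0.
  rewrite /normal_peak -!invfM; congr (_^-1).
  rewrite -sqrtrM// -sqrtrM//; congr (Num.sqrt _).
  by rewrite !exprMn exprVn q2; field.
by rewrite !exprMn exprVn q2; field.
Qed.

Lemma integral_normal_autocorrelation (m s : R) (f : R -> R) : s != 0 ->
  continuous f -> (forall x, 0 <= f x) ->
  (\int[mu]_y \int[mu]_x (f (x - y) * normal_pdf m s x * normal_pdf m s y)%R%:E =
   \int[mu]_z (f z * normal_pdf 0 (Num.sqrt 2 * s) z)%R%:E)%E.
Proof.
move=> s0 cf f0.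
have mf : measurable_fun [set: R] f by exact: continuous_measurable_fun.
have q0 : Num.sqrt 2 != 0 :> R by rewrite sqrtr_eq0 -ltNge.
pose h (yz : R * R) := (f yz.2 * normal_pdf m s (yz.2 + yz.1) * normal_pdf m s yz.1)%:E.
have h0 yz : (0 <= h yz)%E by rewrite lee_fin !mulr_ge0// normal_pdf_ge0.
have mh : measurable_fun [set: R * R] h.
  apply/measurable_EFinP; apply: measurable_funM.
    apply: measurable_funM; first exact: measurableT_comp.
    apply: measurableT_comp; first exact: measurable_normal_pdf.
    exact: measurable_funD.
  by apply: measurableT_comp => //; exact: measurable_normal_pdf.
transitivity (\int[mu]_y \int[mu]_z h (y, z))%E.
  apply: eq_integral => y _.
  have cg : continuous (fun x => f (x - y) * normal_pdf m s x * normal_pdf m s y).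
    move=> x; apply: cvgM; last exact: cvg_cst.
    apply: cvgM; last exact: continuous_normal_pdf.
    apply: continuous_comp; last exact: cf.
    by apply: cvgB; [exact: cvg_id|exact: cvg_cst].
  rewrite (@ge0_integral_affine _ 1 y ltr01 cg); last first.
    by move=> x; rewrite !mulr_ge0// normal_pdf_ge0.
  by apply: eq_integral => x _; rewrite mul1r mulr1 addrK.
rewrite fubini_tonelli//; apply: eq_integral => z _.
under eq_integral => y _.
  rewrite /h /= -mulrA normal_pdf_autocorrelation// mulrA EFinM.
  over.
rewrite ge0_integralZl//.
- by rewrite integral_normal_pdf mule1.
- by apply/measurable_EFinP; exact: measurable_normal_pdf.
- by move=> y _; rewrite lee_fin normal_pdf_ge0.
- by rewrite lee_fin mulr_ge0// normal_pdf_ge0.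
Qed.

Lemma integral_normal_scale (a s : R) (f : R -> R) : 0 < a -> s != 0 ->
  continuous f -> (forall x, 0 <= f x) ->
  (\int[mu]_x (f (a * x) * normal_pdf 0 s x)%R%:E =
   \int[mu]_x (f x * normal_pdf 0 (a * s) x)%R%:E)%E.
Proof.
move=> a0 s0 cf f0.
have as0 : a * s != 0 by rewrite mulf_neq0// gt_eqF.
rewrite [RHS](@ge0_integral_affine _ a 0)//.
- by apply: eq_integral => x _; rewrite addr0 -mulrA normal_pdf_scale.
- by move=> x; apply: cvgM; [exact: cf|exact: continuous_normal_pdf].
- by move=> x; rewrite mulr_ge0// normal_pdf_ge0.
Qed.

Let N m s (f : R -> R) := \int[mu]_x (f x * normal_pdf m s x).

Let N_integrable m s (f : R -> R) (M : R) : continuous f -> (forall x, `|f x| <= M) ->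
  mu.-integrable [set: R] (fun x => (f x * normal_pdf m s x)%:E).
Proof.
move=> cf fM; have mf : measurable_fun [set: R] f by exact: continuous_measurable_fun.
apply: (le_integrable measurableT _ _
  (integrableZl measurableT M (integrable_normal_pdf m s))).
- by apply/measurable_EFinP; apply: measurable_funM => //; exact: measurable_normal_pdf.
- move=> x _; rewrite lee_fin !normrM ler_wpM2r//.
  by rewrite (le_trans (fM x))// ler_norm.
Qed.

Let N_EFin m s (f : R -> R) (M : R) : continuous f -> (forall x, `|f x| <= M) ->
  (\int[mu]_x (f x * normal_pdf m s x)%:E = (N m s f)%:E)%E.
Proof.
by move=> cf fM; rewrite fineK//; apply: integrable_fin_num => //; exact: N_integrable fM.
Qed.

(** The change of variables and Tonelli steps are stated for nonnegative functions. Cosine and sine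
    enter them after adding a constant, as [1 + c1 * cos + c2 * sin] with [|c1| + |c2| <= 1]. *)
Let trig (c0 c1 c2 a x : R) := c0 + c1 * cos (a * x) + c2 * sin (a * x).

Let trig_continuous c0 c1 c2 a : continuous (trig c0 c1 c2 a).
Proof.
move=> x; apply: cvgD.
  apply: cvgD; first exact: cvg_cst.
  apply: cvgM; first exact: cvg_cst.
  apply: continuous_comp; last exact: continuous_cos.
  by apply: cvgM; [exact: cvg_cst|exact: cvg_id].
apply: cvgM; first exact: cvg_cst.
apply: continuous_comp; last exact: continuous_sin.
by apply: cvgM; [exact: cvg_cst|exact: cvg_id].
Qed.

Let trig_bounded c0 c1 c2 a x : `|trig c0 c1 c2 a x| <= `|c0| + `|c1| + `|c2|.
Proof.
apply: (le_trans (ler_normD _ _)); apply: lerD.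
  apply: (le_trans (ler_normD _ _)); rewrite lerD2l normrM ler_piMr//.
  exact: cos_max.
by rewrite normrM ler_piMr//; exact: sin_max.
Qed.

Let trig_integrable m s c0 c1 c2 a :
  mu.-integrable [set: R] (fun x => (trig c0 c1 c2 a x * normal_pdf m s x)%:E).
Proof. by apply: N_integrable; [exact: trig_continuous|exact: trig_bounded]. Qed.

Let trig_EFin m s c0 c1 c2 a :
  (\int[mu]_x (trig c0 c1 c2 a x * normal_pdf m s x)%:E = (N m s (trig c0 c1 c2 a))%:E)%E.
Proof. by apply: N_EFin; [exact: trig_continuous|exact: trig_bounded]. Qed.

Let C m s a := N m s (fun x => cos (a * x)).
Let S m s a := N m s (fun x => sin (a * x)).

Let N_trig m s a (c0 c1 c2 : R) :
  N m s (trig c0 c1 c2 a) =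
  c0 + c1 * C m s a + c2 * S m s a.
Proof.
have ip : mu.-integrable [set: R] (EFin \o (fun x => c0 * normal_pdf m s x)).
  exact: (integrableZl measurableT c0 (integrable_normal_pdf m s)).
have ic : mu.-integrable [set: R] (EFin \o (fun x => cos (a * x) * normal_pdf m s x)).
  have := trig_integrable m s 0 1 0 a.
  by under eq_fun do rewrite /trig add0r mul1r mul0r addr0.
have is' : mu.-integrable [set: R] (EFin \o (fun x => sin (a * x) * normal_pdf m s x)).
  have := trig_integrable m s 0 0 1 a.
  by under eq_fun do rewrite /trig add0r mul1r mul0r add0r.
have ic1 : mu.-integrable [set: R] (EFin \o (fun x => c1 * (cos (a * x) * normal_pdf m s x))).
  exact: (integrableZl measurableT c1 ic).
have is1 : mu.-integrable [set: R] (EFin \o (fun x => c2 * (sin (a * x) * normal_pdf m s x))).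
  exact: (integrableZl measurableT c2 is').
rewrite /N (_ : (fun x => _) = (fun x => c0 * normal_pdf m s x +
   c1 * (cos (a * x) * normal_pdf m s x) + c2 * (sin (a * x) * normal_pdf m s x))); last first.
  by apply/funext => x; rewrite /trig; ring.
rewrite (RintegralD measurableT _ is1); last exact: (integrableD measurableT ip ic1).
rewrite (RintegralD measurableT ip ic1) !RintegralZl//; last exact: integrable_normal_pdf.
by rewrite [X in c0 * X](_ : _ = 1) ?mulr1// /Rintegral integral_normal_pdf.
Qed.

(** [C + i S] is the characteristic function of the normal law; its squared modulus is that of the
    difference of two independent copies. The coefficient pairs (1, 0) and (0, 1) extract the real
    and imaginary parts. *)
Lemma normal_trig_autocorrelation m s a : s != 0 ->
  N 0 (Num.sqrt 2 * s) (fun x => cos (a * x)) = C m s a ^+ 2 + S m s a ^+ 2 /\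
  N 0 (Num.sqrt 2 * s) (fun x => sin (a * x)) = 0.
Proof.
have t1 (x y z : R) : 1 + 1 * x = 1 + 1 * y + 0 * z -> y = x by lra.
have t2 (x y z : R) : 1 + 0 * x = 1 + 0 * y + 1 * z -> z = 0 by lra.
move=> s0.
have key (c1 c2 : R) : `|c1| + `|c2| <= 1 ->
    1 + c1 * (C m s a ^+ 2 + S m s a ^+ 2) =
    1 + c1 * C 0 (Num.sqrt 2 * s) a + c2 * S 0 (Num.sqrt 2 * s) a.
  move=> c12; rewrite -N_trig.
  pose f := trig 1 c1 c2 a.
  have f0 x : 0 <= f x.
    have h1 : `|c1 * cos (a * x)| <= `|c1| by rewrite normrM ler_piMr// cos_max.
    have h2 : `|c2 * sin (a * x)| <= `|c2| by rewrite normrM ler_piMr// sin_max.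
    move: h1 h2; rewrite !ler_norml /f /trig => /andP[? _] /andP[? _]; lra.
  have cf : continuous f by exact: trig_continuous.
  have := integral_normal_autocorrelation m s0 cf f0.
  rewrite trig_EFin.
  have E1 y x : f (x - y) = trig 1 (c1 * cos (a * y) - c2 * sin (a * y))
     (c1 * sin (a * y) + c2 * cos (a * y)) a x.
    by rewrite /f /trig mulrBr cosB sinB; ring.
  under eq_integral => y _.
    under eq_integral do rewrite EFinM.
    rewrite ge0_integralZr//; last 3 first.
    - apply/measurable_EFinP; apply: measurable_funM; last exact: measurable_normal_pdf.
      apply: (measurableT_comp (continuous_measurable_fun cf)).
      exact: measurable_funB.
    - by move=> x _; rewrite lee_fin mulr_ge0// normal_pdf_ge0.
    - by rewrite lee_fin normal_pdf_ge0.
    under eq_integral do rewrite E1.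
    rewrite trig_EFin N_trig -EFinM.
    rewrite (_ : _ + _ = trig 1 (c1 * C m s a + c2 * S m s a)
      (c1 * S m s a - c2 * C m s a) a y); last by rewrite /trig; ring.
    over.
  rewrite trig_EFin.
  rewrite N_trig => -[<-]; ring.
have k1 := key 1 0; have k2 := key 0 1.
rewrite !normr0 !normr1 addr0 in k1; rewrite !normr0 !normr1 add0r in k2.
have {}k1 := k1 (lexx _); have {}k2 := k2 (lexx _).
by split; [exact: t1 k1|exact: t2 k2].
Qed.

(** Both sides are the characteristic function at 1 of the centred normal law with deviation
    [2 * s]: once as sqrt 2 times a variable of deviation [sqrt 2 * s], once as the difference of
    two independent such variables. *)
Lemma normal_trig_sqrt2 m s : s != 0 ->
  C m s (Num.sqrt 2) ^+ 2 + S m s (Num.sqrt 2) ^+ 2 = (C m s 1 ^+ 2 + S m s 1 ^+ 2) ^+ 2.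
Proof.
move=> s0; set q : R := Num.sqrt 2.
have q_gt0 : 0 < q by rewrite sqrtr_gt0.
have qs0 : q * s != 0 by rewrite mulf_neq0// gt_eqF.
have [h1 _] := normal_trig_autocorrelation m q s0.
have [h2 h3] := normal_trig_autocorrelation m 1 s0.
have [h4 _] := normal_trig_autocorrelation 0 1 qs0.
rewrite -h1 -h2; move: h4; rewrite /C /S h3 expr0n addr0 => <-.
have f0 x : 0 <= trig 1 1 0 1 x.
  by rewrite /trig mul0r addr0 mul1r; have := cos_geN1 (1 * x); lra.
have := integral_normal_scale q_gt0 qs0 (@trig_continuous 1 1 0 1) f0.
rewrite trig_EFin N_trig.
have -> : (fun x : R => (trig 1 1 0 1 (q * x) * normal_pdf 0 (q * s) x)%:E) =
          (fun x => (trig 1 1 0 q x * normal_pdf 0 (q * s) x)%:E).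
  by apply/funext => x; rewrite /trig !mul0r !mul1r.
rewrite trig_EFin N_trig.
have t (x y z w : R) : (1 + 1 * x + 0 * y)%:E = (1 + 1 * z + 0 * w)%:E -> x = z.
  by move=> []; lra.
exact: t.
Qed.

Lemma integral_normal_prob m s (f : R -> R) : s != 0 ->
  measurable_fun [set: R] f -> (exists M, forall x, `|f x| <= M) ->
  \int[normal_prob m s]_x f x = \int[mu]_x (f x * normal_pdf m s x).
Proof.
move=> s0 mf [M fM].
have intf : (normal_prob m s).-integrable [set: R] (EFin \o f).
  apply: measurable_bounded_integrable => //.
    by apply: (le_lt_trans (probability_le1 (normal_prob m s) measurableT)); rewrite ltry.
  exists M; split; first exact: num_real.
  by move=> x Mx y _; apply: le_trans (fM y) (ltW Mx).
congr fine; rewrite -(Radon_Nikodym_change_of_variables (normal_prob_dominates m s))//=.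
apply: ae_eq_integral => //.
- apply: emeasurable_funM; first exact/measurable_EFinP.
  apply: (measurable_int mu); apply: Radon_Nikodym_integrable.
  exact: normal_prob_dominates.
- apply/measurable_EFinP; apply: measurable_funM => //; exact: measurable_normal_pdf.
- under [X in ae_eq _ _ _ X]eq_fun do rewrite EFinM.
  apply: ae_eqe_mul2l.
  rewrite Radon_NikodymE//=; first exact: normal_prob_dominates.
  move=> abmu.
  case: cid => /= h [h1 h2 h3].
  apply: integral_ae_eq => //=.
  + by apply/measurable_EFinP; exact: measurable_normal_pdf.
  + by move=> B _ mB; rewrite -h3.
Qed.

Lemma gaussian_trig_sqrt2 (V : normedModType R) (G : probability (borel V) R)
    (l : {linear V -> R^o}) : gaussian G -> continuous l ->
  (\int[G]_z cos (Num.sqrt 2 * l z)) ^+ 2 + (\int[G]_z sin (Num.sqrt 2 * l z)) ^+ 2 =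
  ((\int[G]_z cos (l z)) ^+ 2 + (\int[G]_z sin (l z)) ^+ 2) ^+ 2.
Proof.
move=> gG cl; have [m [s hl]] := gG l cl.
have ml : measurable_fun [set: borel V] (l : borel V -> measurableTypeR R).
  exact: (@continuous_borel _ _ (l : V -> R)).
have push (f : R -> R) : continuous f -> (forall x, `|f x| <= 1) ->
    \int[G]_z f (l z) = if s == 0 then f m else N m s f.
  move=> cf f1; have mf : measurable_fun [set: R] f by exact: continuous_measurable_fun.
  have intf : G.-integrable [set: borel V] (EFin \o (f \o l)).
    apply: measurable_bounded_integrable => //.
    - by apply: (le_lt_trans (probability_le1 G measurableT)); rewrite ltry.
    - exact: (measurableT_comp mf).
    exists 1; split; first exact: num_real.
    by move=> x Mx y _; apply: le_trans (f1 _) (ltW Mx).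
  case: ifPn hl => [s0|s0] hl.
    have hl' : forall B : set R, measurable B -> G (l @^-1` B) = dirac m B by exact: hl.
    rewrite (@Rintegral_law _ _ (borel V) R R G
      (dirac m : {measure set R -> \bar R}) l f ml hl' mf intf).
    rewrite /Rintegral integral_dirac ?diracT ?mul1e//.
    exact/measurable_EFinP.
  rewrite (@Rintegral_law _ _ (borel V) (measurableTypeR R) R G
    (normal_prob m s : probability (measurableTypeR R) R) l f ml hl mf intf).
  by apply: integral_normal_prob => //; exists 1.
have contM (f : R -> R) a : continuous f -> continuous (fun x : R => f (a * x)).
  move=> cf x; apply: continuous_comp; last exact: cf.
  by apply: cvgM; [exact: cvg_cst|exact: cvg_id].
rewrite (push (fun x => cos (Num.sqrt 2 * x))); last 2 first.
  by apply: contM; exact: continuous_cos.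
  by move=> x; exact: cos_max.
rewrite (push (fun x => sin (Num.sqrt 2 * x))); last 2 first.
  by apply: contM; exact: continuous_sin.
  by move=> x; exact: sin_max.
rewrite (push cos); last 2 first.
  exact: continuous_cos.
  by move=> x; exact: cos_max.
rewrite (push sin); last 2 first.
  exact: continuous_sin.
  by move=> x; exact: sin_max.
(* For a point mass the characteristic function has modulus 1. *)
case: ifPn => s0; first by rewrite !cos2Dsin2 expr1n.
have := normal_trig_sqrt2 m s0; rewrite /C /S.
have one (f : R -> R) : (fun x => f (1 * x)) = f by apply/funext => x; rewrite mul1r.
by rewrite !one.
Qed.

End normal.

(** * Pairs of independent copies of a tight law *)

Section separable.
Context {R : realType} {V : normedModType R}.
Implicit Types (K A : set V) (G : probability (borel V) R).

Lemma compact_net K (e : R) : compact K -> 0 < e ->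
  exists s : seq V, forall x, K x -> exists2 y, y \in s & `|y - x| < e.
Proof.
move=> + e0; rewrite compact_cover => cK.
have [|x Kx|F _ KF] := cK _ K (fun y => ball y e).
- by move=> y _; exact: ball_open.
- by exists x => //; exact: ballxx.
exists (enum_fset F) => x /KF[y /= yF]; rewrite -ball_normE => xy.
by exists y.
Qed.

Definition separable_set A := exists u : nat -> V,
  forall x (e : R), A x -> 0 < e -> exists n, `|u n - x| < e.

(** A countable union of compact sets whose masses tend to 1; the finite nets of all these sets at
    all scales 1/(m+1) are listed in one sequence through the coding of triples. *)
Lemma tight_separable G : tight G ->
  exists A, [/\ measurable (A : set (borel V)), G A = 1%E & separable_set A].
Proof.
move=> tG.
have i0 n : 0 < n.+1%:R^-1 :> R by rewrite invr_gt0 ltr0n.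
have /choice[K hK] : forall n : nat, exists K, compact K /\ ((1 - n.+1%:R^-1)%:E <= G K)%E.
  by move=> n; have [K cK GK] := tG _ (i0 n); exists K.
have /choice[s hs] : forall nm : nat * nat, exists s : seq V, forall x, K nm.1 x ->
    exists2 y, y \in s & `|y - x| < nm.2.+1%:R^-1.
  by move=> [n m]; exact: compact_net (hK n).1 (i0 m).
have mK n : measurable (K n : set (borel V)) by exact: compact_borel (hK n).1.
have mA : measurable (\bigcup_n K n : set (borel V)) by exact: bigcupT_measurable.
exists (\bigcup_n K n); split => //.
  apply/eqP; rewrite eq_le probability_le1//=; apply/lee_subgt0Pr => e e0.
  have [n _ ne] := near_infty_natSinv_lt (PosNum e0).
  apply: (@le_trans _ _ (G (K n))).
    rewrite -EFinB; apply: le_trans (hK n).2; rewrite lee_fin lerD2l lerN2 ltW//.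
    exact: (ne n (leqnn n)).
  by apply: measure_le => //; exact: bigcup_sup.
exists (fun k => if (choice.unpickle k : option (nat * nat * nat)) is Some (n, m, i)
  then nth 0 (s (n, m)) i else 0).
move=> x e [n _ Kx] e0.
have [m _ me] := near_infty_natSinv_lt (PosNum e0).
have [y ys yx] := hs (n, m) x Kx.
exists (choice.pickle (n, m, index y (s (n, m)))); rewrite choice.pickleK nth_index//.
by apply: (lt_trans yx); exact: (me m (leqnn m)).
Qed.

(** Inside the square of [A] an open set is a countable union of products of balls centred at the
    points [u i]; without separability it need not belong to the product sigma-algebra. *)
Lemma open_setX_measurable A (U : set (V * V)) : measurable (A : set (borel V)) ->
  separable_set A -> open U ->
  measurable ((A `*` A) `&` U : set (borel V * borel V)).
Proof.
move=> mA [u hu] oU.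
pose r n : R := n.+1%:R^-1.
pose B i n : set V := ball (u i) (r n).
pose good i j n := B i n `*` B j n `<=` U.
have r0 n : 0 < r n by rewrite invr_gt0 ltr0n.
have -> : (A `*` A) `&` U = \bigcup_i \bigcup_j \bigcup_(n in good i j)
    ((A `&` B i n) `*` (A `&` B j n)).
  apply/seteqP; split => [[x y] [[/= Ax Ay] Uxy]|[x y] [i _ [j _ [n gn]]]]; last first.
    by move=> [/= [Ax Bx] [Ay By]]; split => //; exact: gn.
  have : nbhs (x, y) U by apply: open_nbhs_nbhs.
  move=> /nbhs_ballP[e /= e0 he].
  have e20 : 0 < e / 2 by rewrite divr_gt0.
  have [n _ ne] := near_infty_natSinv_lt (PosNum e20).
  have {}ne : r n < e / 2 by exact: (ne n (leqnn n)).
  have [i hi] := hu x _ Ax (r0 n).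
  have [j hj] := hu y _ Ay (r0 n).
  exists i => //; exists j => //; exists n; last first.
    by rewrite /B -!ball_normE.
  move=> [a b] [/=]; rewrite /B -!ball_normE /= => ha hb; apply: he.
  split; rewrite /= -ball_normE /=.
    have := ler_distD (u i) x a; rewrite (distrC x (u i)); lra.
  have := ler_distD (u j) y b; rewrite (distrC y (u j)); lra.
apply: bigcupT_measurable => i; apply: bigcupT_measurable => j.
apply: bigcup_measurable => n _; apply: measurableX;
  apply: measurableI => //; apply: open_borel; exact: ball_open.
Qed.

Lemma continuous_setX_measurable A (f : V * V -> R) : measurable (A : set (borel V)) ->
  separable_set A -> continuous f ->
  measurable_fun (A `*` A : set (borel V * borel V)) (f : borel V * borel V -> R).
Proof.
move=> mA sA /continuousP cf; apply: (measurability _ (RGenOpens.measurableE R)).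
move=> _ [_ [a [b ->] <-]]; apply: open_setX_measurable => //.
by apply: cf; exact: interval_open.
Qed.

End separable.

Section law_of_pair.
Context {R : realType} {V : normedModType R}.
Variable G : probability (borel V) R.
Hypothesis tG : tight G.

(* Addition of a non-separable [V] is not measurable for the product of the
   Borel sigma-algebras, hence the restriction to a separable set of full
   measure. *)
Lemma law_of_continuous_pair (F : V * V -> V) : continuous F ->
  exists (rho : probability (borel V) R) (A : set V) (m : borel V * borel V -> borel V),
  [/\ tight rho, measurable (A : set (borel V)) /\ G A = 1%E, measurable_fun setT m,
      forall x y, A x -> A y -> m (x, y) = F (x, y) &
      forall B, measurable B -> rho B = (G \x G)%E (m @^-1` B)].
Proof.
move=> cF; have [A [mA GA sA]] := tight_separable tG.
pose m := (F : borel V * borel V -> borel V) \_ (A `*` A) : borel V * borel V -> borel V.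
have mAA : measurable (A `*` A : set (borel V * borel V)) by exact: measurableX.
have mm : measurable_fun [set: borel V * borel V] m.
  apply/(measurable_restrictT _ mAA).
  apply: (@measurability _ _ _ (borel V) _ _ (@open V) erefl).
  move=> _ [U oU <-]; apply: open_setX_measurable => //.
  by move/continuousP : cF; exact.
have mE x y : A x -> A y -> m (x, y) = F (x, y).
  by move=> Ax Ay; rewrite /m patchE mem_set.
pose mm' := isMeasurableFun.Build _ _ _ _ _ mm.
pose m' : {mfun (borel V * borel V)%type >-> borel V} := HB.pack m mm'.
exists (distribution (G \x G)%E m' : probability (borel V) R), A, m; split => //.
move=> e e0; have e20 : 0 < e / 2 by rewrite divr_gt0.
have [K cK GK] := tG e20; have mK := compact_borel cK.
(* Its mass is at least [(1 - e / 2) ^+ 2 >= 1 - e]. The factors become negative for [e > 2], where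
   the claim is trivial. *)
exists (F @` (K `*` K)).
  apply: continuous_compact; last exact: compact_setX.
  exact: continuous_subspaceT.
have GKA : ((1 - e / 2)%:E <= G (K `&` A))%E.
  apply: (le_trans GK); rewrite (measureDI G mK mA).
  rewrite [X in (X + _)%E](_ : _ = 0%E) ?add0e//.
  apply/eqP; rewrite eq_le measure_ge0 andbT.
  rewrite -[leRHS](_ : G (~` A) = 0%E).
    by apply: measure_le; [exact: measurableD|exact: measurableC|].
  by rewrite probability_setC// GA subee.
apply: (@le_trans _ _ ((G \x G)%E ((K `&` A) `*` (K `&` A)))).
  rewrite product_measure1E; try exact: measurableI.
  have [e1|e1] := leP e 2; last first.
    apply: (@le_trans _ _ 0%E); last by rewrite mule_ge0.
    rewrite lee_fin; lra.
  apply: (@le_trans _ _ ((1 - e / 2)%:E * (1 - e / 2)%:E)%E).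
    rewrite -EFinM lee_fin; have := sqr_ge0 (e / 2); rewrite expr2; lra.
  by apply: lee_pmul => //; rewrite lee_fin; lra.
apply: measure_le.
- by apply: measurableX; exact: measurableI.
- rewrite -[X in measurable X]setTI; apply: (mm measurableT).
  apply: compact_borel; apply: continuous_compact; last exact: compact_setX.
  exact: continuous_subspaceT.
- move=> [x y] [/= [Kx Ax] [Ky Ay]]; rewrite mE//.
  by exists (x, y).
Qed.

Lemma measurable_pair_ae (A : set V) (f g : borel V * borel V -> R) :
  measurable (A : set (borel V)) -> G A = 1%E ->
  measurable_fun setT f -> measurable_fun setT g ->
  (forall x y, A x -> A y -> f (x, y) = g (x, y)) ->
  \int[(G \x G)%E]_p f p = \int[(G \x G)%E]_p g p.
Proof.
move=> mA GA mf mg fg; congr fine.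
have mAA : measurable (A `*` A : set (borel V * borel V)) by exact: measurableX.
apply: ae_eq_integral => //; [exact/measurable_EFinP|exact/measurable_EFinP|].
exists (~` (A `*` A)); split.
- exact: measurableC.
- have : (G \x G)%E (A `*` A) = 1%E.
    apply: (etrans (product_measure1E G G mA mA)).
    by apply: (etrans (congr2 mule GA GA)); rewrite mule1.
  move=> h; apply: (etrans (probability_setC _ mAA)).
  by rewrite [X in (1 - X)%E]h subee.
- move=> [x y] /= h [Ax Ay]; apply: h => _; congr EFin; exact: fg.
Qed.

End law_of_pair.

(** * Comparison of tails *)

Section plateau.
Context {R : realType}.
Implicit Types a b u eta : R.

(** The square of cos(u / 2). It lies in [0, 1], decreases in |u| near 0, and is affine in cos u, so
    that polynomials in it are polynomials in cos u. *)
Definition haversine u : R := (1 + cos u) / 2.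

Definition plateau n N u : R := 1 - (1 - haversine u ^+ n) ^+ N.

Lemma haversine_itv u : 0 <= haversine u <= 1.
Proof. by have := cos_le1 u; have := cos_geN1 u; rewrite /haversine; lra. Qed.

Lemma haversine_lt u u' : `|u| < `|u'| <= 1 -> haversine u' < haversine u.
Proof.
move=> /andP[uu' u'1]; rewrite /haversine -(cos_norm u) -(cos_norm u').
have := pi_ge2 R => pi2.
have hu : `|u| \in `[0, pi] by rewrite in_itv /= normr_ge0; lra.
have hu' : `|u'| \in `[0, pi] by rewrite in_itv /= normr_ge0; lra.
have : cos `|u'| < cos `|u| by rewrite ltr_cos.
lra.
Qed.

Lemma haversine_le u u' : `|u| <= `|u'| <= 1 -> haversine u' <= haversine u.
Proof.
move=> /andP[]; rewrite le_eqVlt => /orP[/eqP uu' _|uu' u'1].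
  by rewrite /haversine -(cos_norm u) uu' cos_norm.
by apply/ltW/haversine_lt; rewrite uu'.
Qed.

Lemma bernoulli_le (x : R) N : 0 <= x <= 1 -> 1 - N%:R * x <= (1 - x) ^+ N.
Proof.
move=> /andP[x0 x1]; elim: N => [|N IH]; first by rewrite mul0r subr0 expr0.
rewrite exprS; apply: (@le_trans _ _ ((1 - x) * (1 - N%:R * x))).
  rewrite -natr1; have : 0 <= N%:R * (x * x) by rewrite mulr_ge0// mulr_ge0.
  by rewrite mulrDl mul1r mulrBl mul1r mulrBr mulr1; lra.
by apply: ler_wpM2l => //; lra.
Qed.

Lemma exprn_le_inv (x : R) N : 0 <= x <= 1 -> (1 - x) ^+ N * (1 + N%:R * x) <= 1.
Proof.
move=> /andP[x0 x1]; elim: N => [|N IH]; first by rewrite mul0r addr0 mulr1 expr0.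
rewrite exprSr -mulrA; apply: le_trans IH; apply: ler_wpM2l.
  by rewrite exprn_ge0//; lra.
rewrite -natr1; have : 0 <= N%:R * (x * x) by rewrite mulr_ge0// mulr_ge0.
have := mulr_ge0 x0 x0; rewrite mulrDl; nra.
Qed.

Lemma plateau_itv n N u : 0 <= plateau n N u <= 1.
Proof.
have /andP[h0 h1] := haversine_itv u.
have hn0 : 0 <= haversine u ^+ n by rewrite exprn_ge0.
have hn1 : haversine u ^+ n <= 1 by rewrite exprn_ile1.
have h2 : 0 <= (1 - haversine u ^+ n) ^+ N by rewrite exprn_ge0// subr_ge0.
have h3 : (1 - haversine u ^+ n) ^+ N <= 1.
  by rewrite exprn_ile1 ?subr_ge0//; lra.
by rewrite /plateau; lra.
Qed.

(* The [(1 - v ^ n) ^ N] device from the elementary proof of the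
   Stone-Weierstrass theorem. *)
Lemma plateau_exists a b eta : 0 <= a < b -> b <= 1 -> 0 < eta <= 1 ->
  exists n N, forall u, (`|u| <= a -> 1 - eta <= plateau n N u) /\
    (b <= `|u| <= 1 -> plateau n N u <= eta).
Proof.
move=> /andP[a0 ab] b1 /andP[eta0 eta1].
have b0 : 0 < b by apply: le_lt_trans ab.
set al := haversine a; set be := haversine b.
have albe : be < al by apply: haversine_lt; rewrite ger0_norm// gtr0_norm// ab.
have be0 : 0 < be.
  have := haversine_lt (u := b) (u' := 1) => h.
  have cos1 := @cos1_gt0 R; have : 0 < haversine 1 by rewrite /haversine; lra.
  move: b1; rewrite le_eqVlt => /orP[/eqP b1|b1]; first by rewrite /be b1.
  by move=> /lt_trans; apply; apply: h; rewrite gtr0_norm// normr1 b1 lexx.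
have al0 : 0 < al by apply: lt_trans albe.
have al1 : al <= 1 by have /andP[] := haversine_itv a.
have q1 : `|be / al| < 1.
  by rewrite (gtr0_norm (divr_gt0 be0 al0)) ltr_pdivrMr// mul1r.
have e2 : 0 < eta ^+ 2 / 2 by rewrite divr_gt0// exprn_gt0.
have [n _ /(_ n (leqnn n)) /= hn] : \forall n \near \oo, `|(be / al) ^+ n| < eta ^+ 2 / 2.
  by have /cvgr0Pnorm_lt := cvg_expr q1; apply.
have aln : 0 < al ^+ n by rewrite exprn_gt0.
have ben : 0 < be ^+ n by rewrite exprn_gt0.
have aln1 : al ^+ n <= 1 by rewrite exprn_ile1// ltW.
have {}hn : be ^+ n < eta ^+ 2 / 2 * al ^+ n.
  by rewrite -ltr_pdivrMr// -expr_div_n; apply: le_lt_trans hn; exact: ler_norm.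
(* [N] lies between [y] and [2 * y]: then [N * al ^+ n >= 1 / eta] makes [(1 - al ^+ n) ^+ N] at
   most [eta], while [N * be ^+ n <= eta] by the choice of [n]. *)
pose y := (eta * al ^+ n)^-1.
have y1 : 1 <= y.
  by rewrite invf_ge1 ?mulr_gt0// mulr_ile1// ltW.
have y0 : 0 < y by apply: lt_le_trans y1.
pose N := (Num.truncn y).+1.
have /andP[yN1 yN2] : y <= N%:R <= 2 * y.
  have /andP[h1 h2] := Num.Theory.truncn_itv (ltW y0).
  rewrite ltW//= /N -natr1; lra.
exists n, N => u; split => [ua|/andP[bu u1]].
  have hu : al <= haversine u.
    by apply: haversine_le; rewrite (ger0_norm a0) ua /= (ltW (lt_le_trans ab b1)).
  have /andP[_ hu1] := haversine_itv u.
  have hun : al ^+ n <= haversine u ^+ n by rewrite lerXn2r ?nnegrE// ltW// (lt_le_trans al0).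
  have hun1 : haversine u ^+ n <= 1 by rewrite exprn_ile1// (le_trans (ltW al0)).
  have : (1 - haversine u ^+ n) ^+ N <= (1 - al ^+ n) ^+ N.
    by rewrite lerXn2r ?nnegrE ?subr_ge0// lerD2l lerN2.
  have hh : (1 - al ^+ n) ^+ N * (1 + N%:R * al ^+ n) <= 1.
    by apply: exprn_le_inv; rewrite aln1 ltW.
  have : (1 - al ^+ n) ^+ N <= eta.
    have p0 : 0 <= (1 - al ^+ n) ^+ N by rewrite exprn_ge0// subr_ge0.
    have : 1 <= eta * (N%:R * al ^+ n).
      have ea : 0 < eta * al ^+ n by rewrite mulr_gt0.
      have e1 : y * (eta * al ^+ n) = 1 by rewrite mulVf// gt_eqF.
      by rewrite mulrCA -[leLHS]e1; exact: (ler_wpM2r (ltW ea) yN1).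
    move=> h1; have h2 : (1 - al ^+ n) ^+ N * (N%:R * al ^+ n) <= 1 by lra.
    have := ler_wpM2l p0 h1; rewrite mulr1 mulrCA => h3.
    by apply: (le_trans h3); rewrite -[leRHS]mulr1 ler_pM2l.
  rewrite /plateau; lra.
have hu : haversine u <= be by apply: haversine_le; rewrite gtr0_norm// bu.
have /andP[hu0 hu1] := haversine_itv u.
have hun : haversine u ^+ n <= be ^+ n by rewrite lerXn2r ?nnegrE// ltW.
have hun0 : 0 <= haversine u ^+ n by rewrite exprn_ge0.
have hun1 : haversine u ^+ n <= 1 by rewrite exprn_ile1.
have : 1 - N%:R * haversine u ^+ n <= (1 - haversine u ^+ n) ^+ N.
  by apply: bernoulli_le; rewrite hun0.
have : N%:R * haversine u ^+ n <= eta.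
  apply: (@le_trans _ _ (2 * y * (eta ^+ 2 / 2 * al ^+ n))).
    apply: ler_pM => //; apply: (le_trans hun); exact: ltW.
  have ea : eta * al ^+ n != 0 by rewrite gt_eqF// mulr_gt0.
  have e1 : (eta * al ^+ n) * y = 1 by rewrite mulfV.
  rewrite [leLHS](_ : _ = eta * ((eta * al ^+ n) * y)); first by rewrite e1 mulr1.
  by move: (y) => z; field.
rewrite /plateau; lra.
Qed.

End plateau.

Lemma prodr_ge_subr (R : realDomainType) (I : Type) (s : seq I) (F : I -> R) (e : R) :
  (forall i, 0 <= F i <= 1) -> (forall i, 1 - e <= F i) -> 0 <= e ->
  1 - (size s)%:R * e <= \prod_(i <- s) F i.
Proof.
move=> F01 Fe e0; elim: s => [|i s IH]; first by rewrite big_nil mul0r subr0.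
rewrite big_cons /= -natr1 mulrDl mul1r.
set P := \prod_(j <- s) F j in IH *.
have P0 : 0 <= P by apply: prodr_ge0 => j _; have /andP[] := F01 j.
have P1 : P <= 1 by apply: prodr_ile1 => j _; exact: F01.
have h1 : (1 - e) * P <= F i * P by apply: ler_wpM2r.
have h2 : e * P <= e by rewrite ler_piMr.
by move: h1; rewrite mulrBl mul1r; lra.
Qed.

Section Rintegral_indicator.
Context d (T : measurableType d) {R : realType} (P : probability T R).

Lemma Rintegral_indicator (A : set T) : measurable A -> \int[P]_x \1_A x = fine (P A).
Proof. by move=> mA; rewrite /Rintegral integral_indic// setIT. Qed.

Lemma integrable_indicator (A : set T) : measurable A ->
  P.-integrable [set: T] (EFin \o \1_A).
Proof. by move=> mA; exact: integrable_indic. Qed.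

Lemma integrable_cst (c : R) : P.-integrable [set: T] (EFin \o cst c).
Proof. exact: finite_measure_integrable_cst. Qed.

Lemma Rintegral_cst_prob (c : R) : \int[P]_x c = c.
Proof. exact: (congr1 fine (integral_cst_prob P c)). Qed.

End Rintegral_indicator.

Section comparison.
Context {R : realType} {V : normedModType R}.

Definition continuous_functional (l : V -> R) :=
  continuous l /\ forall a x y, l (a *: x + y) = a * l x + l y.

Lemma continuous_functionalD l l' : continuous_functional l ->
  continuous_functional l' -> continuous_functional (fun x => l x + l' x).
Proof.
move=> [cl ll] [cl' ll']; split; last by move=> a x y; rewrite ll ll'; ring.
by move=> x; apply: cvgD; [exact: cl|exact: cl'].
Qed.

Lemma continuous_functionalZ a l : continuous_functional l ->
  continuous_functional (fun x => a * l x).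
Proof.
move=> [cl ll]; split; last by move=> b x y; rewrite ll; ring.
by move=> x; apply: cvgM; [exact: cvg_cst|exact: cl].
Qed.

Lemma continuous_functionalB l l' : continuous_functional l ->
  continuous_functional l' -> continuous_functional (fun x => l x - l' x).
Proof.
move=> [cl ll] [cl' ll']; split; last by move=> a x y; rewrite ll ll'; ring.
by move=> x; apply: cvgB; [exact: cl|exact: cl'].
Qed.

Variables l1 l2 : probability (borel V) R.
Hypothesis same_cos : forall l, continuous_functional l ->
  \int[l1]_x cos (l x) = \int[l2]_x cos (l x).

(* [f] does not distinguish [l1] from [l2], even after multiplication by a
   cosine; this class is an algebra generated by cosines. *)
Let good (f : V -> R) := bounded_continuous f /\
  forall l, continuous_functional l ->
    \int[l1]_x (f x * cos (l x)) = \int[l2]_x (f x * cos (l x)).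

Let bounded_continuousM (f g : V -> R) : bounded_continuous f -> bounded_continuous g ->
  bounded_continuous (fun x => f x * g x).
Proof.
move=> [cf [Mf fM]] [cg [Mg gM]]; split.
  by move=> x; apply: cvgM; [exact: cf|exact: cg].
by exists (Mf * Mg) => x; rewrite normrM ler_pM.
Qed.

Let bounded_continuousD (f g : V -> R) : bounded_continuous f -> bounded_continuous g ->
  bounded_continuous (fun x => f x + g x).
Proof.
move=> [cf [Mf fM]] [cg [Mg gM]]; split.
  by move=> x; apply: cvgD; [exact: cf|exact: cg].
by exists (Mf + Mg) => x; rewrite (le_trans (ler_normD _ _))// lerD.
Qed.

Let bounded_continuous_cst c : bounded_continuous (fun _ : V => c).
Proof. by split; [exact: cst_continuous|exists `|c|]. Qed.

Let bounded_continuous_cos l : continuous_functional l ->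
  bounded_continuous (fun x => cos (l x)).
Proof.
move=> [cl _]; split; last by exists 1 => x; exact: cos_max.
by move=> x; apply: continuous_comp; [exact: cl|exact: continuous_cos].
Qed.

Let good1 : good (fun=> 1).
Proof.
split; first exact: bounded_continuous_cst.
move=> l fl; under eq_Rintegral do rewrite mul1r.
by under [RHS]eq_Rintegral do rewrite mul1r; exact: same_cos.
Qed.

Let goodD a b f g : good f -> good g -> good (fun x => a * f x + b * g x).
Proof.
move=> [bf gf] [bg gg]; split.
  by apply: bounded_continuousD; apply: bounded_continuousM => //;
    exact: bounded_continuous_cst.
move=> l fl; have bc := bounded_continuous_cos fl.
have E (P : probability (borel V) R) : \int[P]_x ((a * f x + b * g x) * cos (l x)) =
    a * \int[P]_x (f x * cos (l x)) + b * \int[P]_x (g x * cos (l x)).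
  have i1 := continuous_borel_integrable P (bounded_continuousM bf bc).
  have i2 := continuous_borel_integrable P (bounded_continuousM bg bc).
  have ai1 := continuous_borel_integrable P (bounded_continuousM
    (bounded_continuous_cst a) (bounded_continuousM bf bc)).
  have bi2 := continuous_borel_integrable P (bounded_continuousM
    (bounded_continuous_cst b) (bounded_continuousM bg bc)).
  rewrite -(RintegralZl a measurableT i1) -(RintegralZl b measurableT i2).
  rewrite -(RintegralD measurableT ai1 bi2).
  by apply: eq_Rintegral => x _; ring.
by rewrite !E gf// gg.
Qed.

(** The product of two cosines is half the sum of the cosines of [l + l'] and [l - l'], which are
    again functionals. This is why [good] carries a cosine factor along. *)
Let good_cos f l : good f -> continuous_functional l ->
  good (fun x => f x * cos (l x)).
Proof.
move=> [bf gf] fl; split; first by apply: bounded_continuousM => //; exact: bounded_continuous_cos.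
move=> l' fl'.
have fD := continuous_functionalD fl fl'; have fB := continuous_functionalB fl fl'.
have E (P : probability (borel V) R) : \int[P]_x (f x * cos (l x) * cos (l' x)) =
    2^-1 * (\int[P]_x (f x * cos (l x + l' x)) + \int[P]_x (f x * cos (l x - l' x))).
  have i1 := continuous_borel_integrable P (bounded_continuousM bf (bounded_continuous_cos fD)).
  have i2 := continuous_borel_integrable P (bounded_continuousM bf (bounded_continuous_cos fB)).
  rewrite -(RintegralD measurableT i1 i2) -RintegralZl//;
    last exact: (integrableD measurableT i1 i2).
  by apply: eq_Rintegral => x _; rewrite cosD cosB; field.
by rewrite !E (gf _ fD) (gf _ fB).
Qed.

Let good_ext f g : f =1 g -> good f -> good g.
Proof. by move=> /funext ->. Qed.

Let good_haversine f l n : good f -> continuous_functional l ->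
  good (fun x => f x * haversine (l x) ^+ n).
Proof.
move=> gf fl; elim: n => [|n IH]; first by apply: good_ext gf => x; rewrite mulr1.
apply: good_ext (goodD 2^-1 2^-1 IH (good_cos IH fl)) => x.
by rewrite exprS /haversine; field.
Qed.

Let good_plateau f l n N : good f -> continuous_functional l ->
  good (fun x => f x * plateau n N (l x)).
Proof.
move=> gf fl.
have gpow : good (fun x => f x * (1 - haversine (l x) ^+ n) ^+ N).
  elim: N => [|N IH]; first by apply: good_ext gf => x; rewrite mulr1.
  apply: good_ext (goodD 1 (-1) IH (good_haversine n IH fl)) => x.
  by rewrite exprS; ring.
by apply: good_ext (goodD 1 (-1) gf gpow) => x; rewrite /plateau; ring.
Qed.

Let good_prod (s : seq V) (l : V -> V -> R) n N :
  (forall y, continuous_functional (l y)) ->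
  good (fun x => \prod_(y <- s) plateau n N (l y x)).
Proof.
move=> fl; elim: s => [|y s IH].
  by apply: good_ext good1 => x; rewrite big_nil.
by apply: good_ext (good_plateau n N IH (fl y)) => x; rewrite big_cons mulrC.
Qed.

Hypothesis tl2 : tight l2.

Let measurable_norm_gt t : measurable ([set x | t < `|x|] : set (borel V)).
Proof.
apply: open_borel; rewrite (_ : [set _ | _] = (fun x : V => `|x|) @^-1` [set y : R | t < y]) //.
by apply: open_comp => [x _|]; [exact: norm_continuous|exact: open_gt].
Qed.

(** On [K] the norm is, up to the mesh of a finite net, the maximum of the norming functionals of
    the net points. The product [p] of their plateaus is nearly 1 on the ball of radius [t] and
    nearly 0 on [K] beyond [t'], and both laws give it the same integral. *)
Lemma norm_tail_le t t' : 0 <= t < t' ->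
  (l2 [set x | t' < `|x|]%R <= l1 [set x | t < `|x|]%R)%E.
Proof.
move=> /andP[t0 tt']; apply/lee_addgt0Pr => e e0.
pose ep := Num.min 1 (e / 3).
have ep0 : 0 < ep by rewrite lt_min ltr01 divr_gt0.
have ep1 : ep <= 1 by rewrite ge_min lexx.
have ep3 : ep <= e / 3 by rewrite ge_min lexx orbT.
have [K cK lK] := tl2 ep0; have mK := compact_borel cK.
(* If [|x| > t'] and the net point [y] is within [d] of [x], then
   [l y x >= |y| - d > t' - 2 * d = t + d]. *)
pose d := (t' - t) / 3; have d0 : 0 < d by rewrite divr_gt0// subr_gt0.
have dE : t' = t + 3 * d by rewrite /d; field.
have [s hs] := compact_net cK d0.
have /choice[l hl] : forall y : V, exists l : {linear V -> R^o},
    [/\ continuous l, forall x, `|l x| <= `|x| & l y = `|y|] by move=> y; exact: norming_functional.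
(* Division by [B] brings all values of the functionals on [K] into [-1, 1], the range in which a
   plateau is controlled. *)
pose B := t' + d + \sum_(y <- s) `|y|.
have sum0 : 0 <= \sum_(y <- s) `|y| by rewrite sumr_ge0.
have B0 : 0 < B by rewrite /B; lra.
have KB x : K x -> `|x| <= B.
  move=> /hs[y ys yx]; have : `|y| <= \sum_(y <- s) `|y|.
    by rewrite (big_rem y)//= lerDl sumr_ge0.
  have := ler_normB y (y - x); rewrite opprB addrC subrK => h1 h2.
  by apply: (le_trans h1); rewrite /B; lra.
pose k y x := B^-1 * l y x.
have fk y : continuous_functional (k y).
  apply: continuous_functionalZ; split; first by have [] := hl y.
  by move=> a x z; rewrite linearP.
pose c := (size s).+1%:R : R.
have c0 : 0 < c by rewrite ltr0n.
(* The product loses at most [eta] per net point where it should be 1 and is at most [eta] where it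
   should be 0; together this is [ep]. *)
pose eta := ep / c.
have eta0 : 0 < eta by rewrite divr_gt0.
have eta1 : eta <= ep.
  by rewrite ler_pdivrMr// ler_peMr//; [exact: ltW|rewrite ler1n].
have [n [N hnN]] : exists n N, forall u, (`|u| <= t / B -> 1 - eta <= plateau n N u) /\
    ((t + d) / B <= `|u| <= 1 -> plateau n N u <= eta).
  apply: plateau_exists.
  - by rewrite divr_ge0 ?(ltW B0)//= ltr_pM2r ?invr_gt0//; lra.
  - by rewrite ler_pdivrMr// mul1r /B; lra.
  - by rewrite eta0 (le_trans eta1).
pose p x := \prod_(y <- s) plateau n N (k y x).
have p01 x : 0 <= p x <= 1.
  rewrite prodr_ge0/=; last by move=> y _; have /andP[] := plateau_itv n N (k y x).
  by apply: prodr_ile1 => y _; exact: plateau_itv.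
have plow x : `|x| <= t -> 1 - (size s)%:R * eta <= p x.
  move=> xt; apply: prodr_ge_subr => [y|y|]; last exact: ltW.
    exact: plateau_itv.
  apply: (hnN _).1; rewrite normrM gtr0_norm ?invr_gt0// mulrC ler_pM2r ?invr_gt0//.
  by have [_ /(_ x) h _] := hl y; exact: le_trans xt.
have pup x : K x -> t' < `|x| -> p x <= eta.
  move=> Kx tx; have [y ys yx] := hs x Kx.
  have [_ lle lyy] := hl y.
  rewrite /p (big_rem y)//=.
  have h1 : plateau n N (k y x) <= eta.
    apply: (hnN _).2; rewrite /k normrM (gtr0_norm (_ : 0 < B^-1)) ?invr_gt0//.
    apply/andP; split.
      rewrite [leRHS]mulrC ler_pM2r ?invr_gt0//.
      have -> : l y x = l y y - l y (y - x) by rewrite linearB opprB addrC subrK.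
      rewrite lyy; apply: le_trans (ler_norm _).
      have := lle (y - x); rewrite ler_norml => /andP[_ h].
      have := ler_normB y (y - x); rewrite opprB addrC subrK; lra.
    by rewrite ler_pdivrMl// mulr1; apply: (le_trans (lle x)); exact: KB.
  have /andP[h2 _] := plateau_itv n N (k y x).
  apply: (le_trans _ h1); rewrite ler_piMr//.
  by apply: prodr_ile1 => z _; exact: plateau_itv.
have gp : good p by apply: good_prod.
have bp := gp.1.
have f0 : continuous_functional (fun _ : V => 0).
  by split; [exact: cst_continuous|move=> *; rewrite mulr0 addr0].
have pE : \int[l1]_x p x = \int[l2]_x p x.
  have h (P : probability (borel V) R) : \int[P]_x (p x * cos 0) = \int[P]_x p x.
    by apply: eq_Rintegral => x _; rewrite cos0 mulr1.
  by have := gp.2 _ f0; rewrite !h.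
have i1 := continuous_borel_integrable l1 bp.
have i2 := continuous_borel_integrable l2 bp.
have mT : measurable ([set x | t < `|x|] : set (borel V)) by exact: measurable_norm_gt.
have mT' : measurable ([set x | t' < `|x|] : set (borel V)) by exact: measurable_norm_gt.
have mKC : measurable (~` K : set (borel V)) by exact: measurableC.
have up2 : fine (l2 [set x | t' < `|x|]) <= fine (l2 (~` K)) + (1 - \int[l2]_x p x) + eta.
  have iK := integrable_indicator l2 mKC.
  have iC := integrable_cst l2 (1 + eta).
  have iKC := integrableD measurableT iK iC.
  rewrite -(Rintegral_indicator l2 mT').
  apply: (@le_trans _ _ (\int[l2]_x (\1_(~` K) x + (1 + eta) - p x))).
    apply: le_Rintegral => //.
    - exact: integrable_indicator.
    - exact: (integrableB measurableT iKC i2).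
    move=> x _; have /andP[px0 px1] := p01 x.
    rewrite !indicE; case: (boolP (x \in [set x | t' < `|x|])) => [/set_mem /= tx|_] /=.
      case: (boolP (x \in ~` K)) => [_|/negP] /=; first lra.
      by rewrite in_setE /= => /contrapT Kx; have := pup x Kx tx; lra.
    have : 0 <= (x \in ~` K)%:R :> R by rewrite ler0n.
    lra.
  rewrite (RintegralB measurableT iKC i2) (RintegralD measurableT iK iC).
  by rewrite Rintegral_cst_prob Rintegral_indicator//; lra.
have low1 : 1 - \int[l1]_x p x <= fine (l1 [set x | t < `|x|]) + (size s)%:R * eta.
  have iT := integrable_indicator l1 mT.
  have iC := integrable_cst l1 ((size s)%:R * eta).
  have iC1 := integrable_cst l1 1.
  rewrite -(Rintegral_indicator l1 mT) -{1}(Rintegral_cst_prob l1 1).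
  rewrite -(Rintegral_cst_prob l1 (_ * eta)).
  rewrite -(RintegralB measurableT iC1 i1) -(RintegralD measurableT iT iC).
  apply: le_Rintegral => //.
  - exact: (integrableB measurableT iC1 i1).
  - exact: (integrableD measurableT iT iC).
  move=> x _; have /andP[px0 px1] := p01 x.
  have se0 : 0 <= (size s)%:R * eta by rewrite mulr_ge0// ltW.
  rewrite indicE; case: (boolP (x \in [set x | t < `|x|])) => [_|/negP] /=; first lra.
  by rewrite in_setE /= => /negP; rewrite -leNgt => /plow; lra.
have lKC : fine (l2 (~` K)) <= ep.
  rewrite -lee_fin fineK ?fin_num_measure// probability_setC//.
  by rewrite leeBlDr ?fin_num_measure// addeC -leeBlDr.
have seta : (size s)%:R * eta + eta = ep.
  by rewrite -[X in _ + X]mul1r -mulrDl natr1 /eta mulrC divfK// gt_eqF.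
rewrite -[leLHS]fineK ?fin_num_measure// -[X in (X + _)%E]fineK ?fin_num_measure//.
rewrite -EFinD lee_fin; rewrite pE in low1; lra.
Qed.

End comparison.

(** * First moment of a Gaussian law *)

Section product_integrals.
Context d (T : measurableType d) (R : realType).
Variable P : probability T R.

Lemma bounded_measurable_integrable d' (T' : measurableType d') (Q : probability T' R)
    (f : T' -> R) (M : R) : measurable_fun [set: T'] f -> (forall x, `|f x| <= M) ->
  Q.-integrable [set: T'] (EFin \o f).
Proof.
move=> mf fM; apply: measurable_bounded_integrable => //.
  by apply: (le_lt_trans (probability_le1 Q measurableT)); rewrite ltry.
exists M; split; first exact: num_real.
by move=> x Mx y _; apply: le_trans (fM y) (ltW Mx).
Qed.

Lemma measurable_prod_fun (f g : T -> R) : measurable_fun [set: T] f ->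
  measurable_fun [set: T] g -> measurable_fun [set: T * T] (fun p => f p.1 * g p.2).
Proof. by move=> mf mg; apply: measurable_funM; exact: measurableT_comp. Qed.

Lemma Rintegral_prod_mul (f g : T -> R) (M N : R) : measurable_fun [set: T] f ->
  measurable_fun [set: T] g -> (forall x, `|f x| <= M) -> (forall x, `|g x| <= N) ->
  \int[(P \x P)%E]_p (f p.1 * g p.2) = (\int[P]_x f x) * (\int[P]_x g x).
Proof.
move=> mf mg fM gN.
have int : (P \x P)%E.-integrable [set: T * T] (EFin \o (fun p => f p.1 * g p.2)).
  apply: (@bounded_measurable_integrable _ _ _ _ (M * N)); first exact: measurable_prod_fun.
  by move=> p; rewrite normrM ler_pM.
have intf := bounded_measurable_integrable P mf fM.
have intg := bounded_measurable_integrable P mg gN.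
rewrite /Rintegral -(integral12_prod_meas1 int).
have E : (\int[P]_x fubini_F P (EFin \o (fun p => (f p.1 * g p.2)%R)) x =
    \int[P]_x ((f x)%:E * (\int[P]_y g y)%:E))%E.
  apply: eq_integral => x _; rewrite /fubini_F /=.
  under eq_integral do rewrite EFinM.
  by rewrite integralZl// /Rintegral fineK//; exact: integrable_fin_num.
by rewrite E integralZr// fineM//; exact: integrable_fin_num.
Qed.

Lemma probability_setI_full (A B : set T) : measurable A -> measurable B ->
  P A = 1%E -> P (A `&` B) = P B.
Proof.
move=> mA mB PA; rewrite [RHS](measureDI P mB mA) setIC.
rewrite [X in (X + _)%E](_ : _ = 0%E) ?add0e//.
apply/eqP; rewrite eq_le measure_ge0 andbT.
rewrite -[leRHS](_ : P (~` A) = 0%E).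
  by apply: measure_le; [exact: measurableD|exact: measurableC|].
by rewrite probability_setC// PA subee.
Qed.

End product_integrals.

Section linear_pair_law.
Context {R : realType} {V : normedModType R}.

(* [rho] is the law of [a X + b Y] for [X], [Y] independent with law [G]. *)
Definition linear_pair_law (G rho : probability (borel V) R) (a b : R) :=
  exists (A : set V) (m : borel V * borel V -> borel V),
  [/\ measurable (A : set (borel V)) /\ G A = 1%E, measurable_fun setT m,
      forall x y, A x -> A y -> m (x, y) = a *: (x : V) + b *: (y : V) &
      forall B, measurable B -> rho B = (G \x G)%E (m @^-1` B)].

Lemma linear_pair_law_exists (G : probability (borel V) R) a b : tight G ->
  exists2 rho : probability (borel V) R, tight rho & linear_pair_law G rho a b.
Proof.
move=> tG.
have cF : continuous (fun p : V * V => a *: p.1 + b *: p.2).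
  move=> p; apply: cvgD.
    by apply: cvgZr; exact: cvg_fst.
  by apply: cvgZr; exact: cvg_snd.
have [rho [A [m [h1 h2 h3 h4 h5]]]] := law_of_continuous_pair tG cF.
by exists rho => //; exists A, m.
Qed.

(** Real and imaginary parts of the factorization of the characteristic function of a X + b Y for
    independent X and Y. *)
Lemma linear_pair_law_cos (G rho : probability (borel V) R) a b l :
  linear_pair_law G rho a b -> continuous_functional l ->
  \int[rho]_x cos (l x) = (\int[G]_x cos (a * l x)) * (\int[G]_x cos (b * l x)) -
    (\int[G]_x sin (a * l x)) * (\int[G]_x sin (b * l x)) /\
  \int[rho]_x sin (l x) = (\int[G]_x sin (a * l x)) * (\int[G]_x cos (b * l x)) +
    (\int[G]_x cos (a * l x)) * (\int[G]_x sin (b * l x)).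
Proof.
move=> [A [m [[mA GA] mm mE rhoE]]] fl.
have ml c : measurable_fun [set: borel V] ((fun x => c * l x) : borel V -> R).
  by apply: continuous_borel; have [] := continuous_functionalZ c fl.
have mlc c : measurable_fun [set: borel V] ((fun x => cos (c * l x)) : borel V -> R).
  exact: (measurableT_comp (continuous_measurable_fun (@continuous_cos R)) (ml c)).
have mls c : measurable_fun [set: borel V] ((fun x => sin (c * l x)) : borel V -> R).
  exact: (measurableT_comp (continuous_measurable_fun (@continuous_sin R)) (ml c)).
have cos1 c (x : borel V) : `|cos (c * l x)| <= 1 by exact: cos_max.
have sin1 c (x : borel V) : `|sin (c * l x)| <= 1 by exact: sin_max.
have int (f g : borel V -> R) : measurable_fun setT f -> measurable_fun setT g ->
    (forall x, `|f x| <= 1) -> (forall x, `|g x| <= 1) ->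
    (G \x G)%E.-integrable [set: borel V * borel V] (EFin \o (fun p => f p.1 * g p.2)).
  move=> mf mg f1 g1; apply: (@bounded_measurable_integrable _ _ _ _ _ (1 * 1)).
    exact: measurable_prod_fun.
  by move=> p; rewrite normrM ler_pM.
have transfer (f : R -> R) (g : borel V * borel V -> R) : continuous f ->
    (forall x, `|f x| <= 1) -> measurable_fun setT g ->
    (forall x y, f (a * l x + b * l y) = g (x, y)) ->
    \int[rho]_x f (l x) = \int[(G \x G)%E]_p g p.
  move=> cf f1 mg fg.
  have mfl : measurable_fun [set: borel V] ((fun x => f (l x)) : borel V -> R).
    apply: (measurableT_comp (continuous_measurable_fun cf)).
    by apply: continuous_borel; have [] := fl.
  rewrite -(@Rintegral_law _ _ _ _ _ (G \x G)%E rho m (fun x => f (l x)) mm _ mfl); last 2 first.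
  - by move=> B mB; exact: (esym (rhoE B mB)).
  - apply: (@bounded_measurable_integrable _ _ _ _ _ 1); last by move=> p; exact: f1.
    exact: (measurableT_comp mfl mm).
  apply: (measurable_pair_ae mA GA) => //.
    exact: (measurableT_comp mfl mm).
  move=> x y Ax Ay; rewrite mE// -fg; congr f.
  have l0 : l 0 = 0.
    have := fl.2 1 0 0; rewrite scaler0 addr0 mul1r; lra.
  by have := fl.2 b y 0; rewrite addr0 l0 addr0 => lb; rewrite fl.2 lb.
split.
  rewrite (transfer cos (fun p => cos (a * l p.1) * cos (b * l p.2) -
    sin (a * l p.1) * sin (b * l p.2))).
  - rewrite (RintegralB measurableT (int _ _ (mlc a) (mlc b) (cos1 a) (cos1 b))
      (int _ _ (mls a) (mls b) (sin1 a) (sin1 b))).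
    congr (_ - _).
      exact: (Rintegral_prod_mul G (mlc a) (mlc b) (cos1 a) (cos1 b)).
    exact: (Rintegral_prod_mul G (mls a) (mls b) (sin1 a) (sin1 b)).
  - exact: continuous_cos.
  - exact: cos_max.
  - apply: measurable_funB.
      exact: (measurable_prod_fun (mlc a) (mlc b)).
    exact: (measurable_prod_fun (mls a) (mls b)).
  - by move=> x y; rewrite cosD.
rewrite (transfer sin (fun p => sin (a * l p.1) * cos (b * l p.2) +
    cos (a * l p.1) * sin (b * l p.2))).
- rewrite (RintegralD measurableT (int _ _ (mls a) (mlc b) (sin1 a) (cos1 b))
    (int _ _ (mlc a) (mls b) (cos1 a) (sin1 b))).
  congr (_ + _).
    exact: (Rintegral_prod_mul G (mls a) (mlc b) (sin1 a) (cos1 b)).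
  exact: (Rintegral_prod_mul G (mlc a) (mls b) (cos1 a) (sin1 b)).
- exact: continuous_sin.
- exact: sin_max.
- apply: measurable_funD.
    exact: (measurable_prod_fun (mls a) (mlc b)).
  exact: (measurable_prod_fun (mlc a) (mls b)).
- by move=> x y; rewrite sinD.
Qed.

Lemma gaussian_functional_sqrt2 (G : probability (borel V) R) l :
  gaussian G -> continuous_functional l ->
  (\int[G]_z cos (Num.sqrt 2 * l z)) ^+ 2 + (\int[G]_z sin (Num.sqrt 2 * l z)) ^+ 2 =
  ((\int[G]_z cos (l z)) ^+ 2 + (\int[G]_z sin (l z)) ^+ 2) ^+ 2.
Proof.
move=> gG [cl ll].
have llin : linear (l : V -> R^o) by move=> a x y; exact: ll.
pose L : {linear V -> R^o} := HB.pack (l : V -> R^o) (GRing.isLinear.Build _ _ _ _ _ llin).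
exact: (@gaussian_trig_sqrt2 R V G L gG cl).
Qed.

End linear_pair_law.

Section tails.
Context {R : realType} {V : normedModType R}.
Implicit Types (G rho : probability (borel V) R).

Definition norm_tail G (t : R) : R := fine (G [set x | t < `|x|]).

Lemma measurable_norm_tail t : measurable ([set x | t < `|x|] : set (borel V)).
Proof.
apply: open_borel; rewrite (_ : [set _ | _] = (fun x : V => `|x|) @^-1` [set y : R | t < y]) //.
by apply: open_comp => [x _|]; [exact: norm_continuous|exact: open_gt].
Qed.

Lemma norm_tailE G t : G [set x | t < `|x|] = (norm_tail G t)%:E.
Proof. by rewrite fineK// fin_num_measure//; exact: measurable_norm_tail. Qed.

Lemma norm_tail_ge0 G t : 0 <= norm_tail G t.
Proof. by rewrite fine_ge0. Qed.

Lemma norm_tail_small G (e : R) : tight G -> 0 < e ->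
  exists2 a, 0 < a & norm_tail G a <= e.
Proof.
move=> tG e0; have [K cK GK] := tG e e0; have mK := compact_borel cK.
have [s hs] := compact_net cK ltr01.
exists (1 + \sum_(y <- s) `|y|).
  have : 0 <= \sum_(y <- s) `|y| by rewrite sumr_ge0.
  lra.
rewrite -lee_fin -norm_tailE.
apply: (@le_trans _ _ (G (~` K))).
  apply: measure_le; [exact: measurable_norm_tail|exact: measurableC|].
  move=> x /= xs Kx; have [y ys yx] := hs x Kx.
  have : `|y| <= \sum_(y <- s) `|y| by rewrite (big_rem y)//= lerDl sumr_ge0.
  have := ler_normB y (y - x); rewrite opprB addrC subrK; lra.
by rewrite probability_setC// leeBlDr ?fin_num_measure// addeC -leeBlDr.
Qed.

Lemma measurable_norm_le a : measurable ([set x | `|x| <= a] : set (borel V)).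
Proof.
rewrite (_ : [set _ | _] = ~` [set x | a < `|x|]); last first.
  by apply/seteqP; split => x /=; rewrite leNgt => /negP.
exact: measurableC (measurable_norm_tail a).
Qed.

Lemma norm_le_measure G a : G [set x | `|x| <= a] = (1 - norm_tail G a)%:E.
Proof.
rewrite (_ : [set _ | _] = ~` [set x | a < `|x|]); last first.
  by apply/seteqP; split => x /=; rewrite leNgt => /negP.
by rewrite probability_setC ?norm_tailE//; exact: measurable_norm_tail.
Qed.

Lemma linear_pair_rectangle G rho a b (B1 B2 B : set V) :
  linear_pair_law G rho a b -> measurable (B1 : set (borel V)) ->
  measurable (B2 : set (borel V)) -> measurable (B : set (borel V)) ->
  (forall x y, B1 x -> B2 y -> B (a *: x + b *: y)) ->
  (G B1 * G B2 <= rho B)%E.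
Proof.
move=> [A [m [[mA GA] mm mE rhoE]]] mB1 mB2 mB hB.
rewrite rhoE// -(probability_setI_full mA mB1 GA) -(probability_setI_full mA mB2 GA).
have mAB1 : measurable (A `&` B1 : set (borel V)) by exact: measurableI.
have mAB2 : measurable (A `&` B2 : set (borel V)) by exact: measurableI.
rewrite -product_measure1E//; apply: measure_le.
- exact: measurableX.
- by rewrite -[X in measurable X]setTI; exact: mm.
- by move=> [x y] [/= [Ax Bx] [Ay By]]; rewrite mE//; exact: hB.
Qed.

(** The two disjoint rectangles are the source of the factor 2 that makes the tail recursion
    contract. *)
Lemma linear_pair_rectangle2 G rho a b (B1 B2 B : set V) :
  linear_pair_law G rho a b -> measurable (B1 : set (borel V)) ->
  measurable (B2 : set (borel V)) -> measurable (B : set (borel V)) ->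
  (forall x y, B1 x -> B2 y -> B (a *: x + b *: y)) ->
  (forall x y, B2 x -> B1 y -> B (a *: x + b *: y)) -> B1 `&` B2 = set0 ->
  (G B1 * G B2 + G B2 * G B1 <= rho B)%E.
Proof.
move=> [A [m [[mA GA] mm mE rhoE]]] mB1 mB2 mB hB hB' B12.
rewrite rhoE// -(probability_setI_full mA mB1 GA) -(probability_setI_full mA mB2 GA).
have mAB1 : measurable (A `&` B1 : set (borel V)) by exact: measurableI.
have mAB2 : measurable (A `&` B2 : set (borel V)) by exact: measurableI.
rewrite -!product_measure1E//.
have mX1 : measurable ((A `&` B1) `*` (A `&` B2) : set (borel V * borel V)) by exact: measurableX.
have mX2 : measurable ((A `&` B2) `*` (A `&` B1) : set (borel V * borel V)) by exact: measurableX.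
rewrite -measureU//; last first.
  apply/seteqP; split => // -[x y] [[/= [_ x1] [_ y1]] [/= [_ x2] [_ y2]]].
  by have : (B1 `&` B2) x by []; rewrite B12.
apply: measure_le.
- exact: measurableU.
- by rewrite -[X in measurable X]setTI; exact: mm.
- by move=> [x y] [[/= [Ax Bx] [Ay By]]|[/= [Ax Bx] [Ay By]]]; rewrite mE//;
    [exact: hB|exact: hB'].
Qed.

Lemma linear_pair_fst G rho a t : linear_pair_law G rho a 0 -> 0 < a ->
  norm_tail rho (a * t) <= norm_tail G t.
Proof.
move=> [A [m [[mA GA] mm mE rhoE]]] a0.
have mAC : measurable (~` A : set (borel V)) by exact: measurableC.
have mt := measurable_norm_tail t.
rewrite -lee_fin -!norm_tailE rhoE; last exact: measurable_norm_tail.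
have GAC : G (~` A) = 0%E by rewrite probability_setC// GA subee.
have mAT : measurable (~` A `*` setT : set (borel V * borel V)) by exact: measurableX.
have mTA : measurable (setT `*` ~` A : set (borel V * borel V)) by exact: measurableX.
have mtT : measurable ([set x | t < `|x|] `*` setT : set (borel V * borel V)) by exact: measurableX.
have e1 : (G \x G)%E (~` A `*` setT) = 0%E.
  by apply: (etrans (product_measure1E G G mAC measurableT));
    apply: (etrans (congr2 mule GAC erefl)); rewrite mul0e.
have e2 : (G \x G)%E (setT `*` ~` A) = 0%E.
  by apply: (etrans (product_measure1E G G measurableT mAC));
    apply: (etrans (congr2 mule erefl GAC)); rewrite mule0.
have e3 : (G \x G)%E ([set x | t < `|x|] `*` setT) = G [set x | t < `|x|].
  apply: (etrans (product_measure1E G G mt measurableT)).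
  by apply: (etrans (congr2 mule erefl (probability_setT G))); rewrite mule1.
apply: (@le_trans _ _ ((G \x G)%E (([set x | t < `|x|] `*` setT) `|`
  (~` A `*` setT) `|` (setT `*` ~` A)))).
  apply: measure_le.
  - by rewrite -[X in measurable X]setTI; apply: (mm measurableT); exact: measurable_norm_tail.
  - by do 2 apply: measurableU => //.
  move=> [x y] /= h; have [Ax|nAx] := pselect (A x); last by left; right.
  have [Ay|nAy] := pselect (A y); last by right.
  left; left; split => //=; move: h; rewrite mE// scale0r addr0 normrZ gtr0_norm//.
  by rewrite ltr_pM2l.
apply: (le_trans (measureU2 _ _ _)) => //; first exact: measurableU.
rewrite [X in (_ + X)%E]e2 adde0; apply: (le_trans (measureU2 _ _ _)) => //.
by rewrite [X in (_ + X)%E]e1 adde0 [leLHS]e3.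
Qed.

Lemma sqrt2_lt : Num.sqrt 2 < 71 / 50 :> R.
Proof.
rewrite -(ltr_pXn2r (n := 2))// ?nnegrE//; try lra.
by rewrite sqr_sqrtr//; lra.
Qed.

(** [r1] is the law of Z, [r2] of Z + Z' and [r3] of sqrt 2 Z, where Z' is an independent copy of Z.
    The events |Z| > t' + a, |Z'| <= a and their mirror image each force |Z + Z'| > t', whose
    probability is compared with that of |sqrt 2 Z| > sqrt 2 t. *)
Lemma gaussian_norm_tail G : tight G -> gaussian G ->
  exists2 T, 0 < T & forall n, norm_tail G (T * (3 / 2) ^+ n) <= 2 * (4 / 7) ^+ n.
Proof.
move=> tG gG.
have [r1 tr1 lr1] := linear_pair_law_exists 1 (-1) tG.
have [r2 tr2 lr2] := linear_pair_law_exists 1 1 tr1.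
have [r3 tr3 lr3] := linear_pair_law_exists (Num.sqrt 2) 0 tr1.
have c1 l : continuous_functional l -> \int[r1]_x cos (l x) =
    (\int[G]_x cos (l x)) ^+ 2 + (\int[G]_x sin (l x)) ^+ 2 /\ \int[r1]_x sin (l x) = 0.
  move=> fl; have [-> ->] := linear_pair_law_cos lr1 fl.
  have e1 (f : R -> R) : \int[G]_x f (1 * l x) = \int[G]_x f (l x).
    by apply: eq_Rintegral => x _; rewrite mul1r.
  have e2 : \int[G]_x cos (-1 * l x) = \int[G]_x cos (l x).
    by apply: eq_Rintegral => x _; rewrite mulN1r cosN.
  have e3 : \int[G]_x sin (-1 * l x) = - \int[G]_x sin (l x).
    rewrite -RintegralN; first by apply: eq_Rintegral => x _; rewrite mulN1r sinN.
    apply: continuous_borel_integrable; split; last by exists 1 => x; exact: sin_max.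
    by move=> x; apply: continuous_comp; [exact: fl.1|exact: continuous_sin].
  by rewrite !e1 e2 e3; split; ring.
have same l : continuous_functional l -> \int[r3]_x cos (l x) = \int[r2]_x cos (l x).
  move=> fl; have [-> _] := linear_pair_law_cos lr2 fl.
  have [-> _] := linear_pair_law_cos lr3 fl.
  have e1 (f : R -> R) : \int[r1]_x f (1 * l x) = \int[r1]_x f (l x).
    by apply: eq_Rintegral => x _; rewrite mul1r.
  have e0 : \int[r1]_x cos (0 * l x) = 1.
    rewrite -[RHS](Rintegral_cst_prob r1); apply: eq_Rintegral => x _.
    by rewrite mul0r cos0.
  have e0' : \int[r1]_x sin (0 * l x) = 0.
    rewrite -[RHS](Rintegral_cst_prob r1); apply: eq_Rintegral => x _.
    by rewrite mul0r sin0.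
  rewrite !e1 e0 e0' mulr1 mulr0 subr0.
  have [-> ->] := c1 _ fl.
  have [-> _] := c1 _ (continuous_functionalZ (Num.sqrt 2) fl).
  by rewrite gaussian_functional_sqrt2//; ring.
have h8 : 0 < 8^-1 :> R by [].
have half0 : 0 < 2^-1 :> R by [].
have [a a0 pa] := norm_tail_small tr1 h8.
have [b b0 pb] := norm_tail_small tG half0.
have two t t' : 0 <= t -> Num.sqrt 2 * t < t' ->
    norm_tail r1 (t' + a) <= 4 / 7 * norm_tail r1 t.
  move=> t0 tt'; have q0 : 0 < Num.sqrt 2 :> R by rewrite sqrtr_gt0.
  have qt : 0 <= Num.sqrt 2 * t by rewrite mulr_ge0// ltW.
  have h1 : norm_tail r2 t' <= norm_tail r1 t.
    apply: (le_trans _ (linear_pair_fst t lr3 q0)).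
    rewrite -lee_fin -!norm_tailE; apply: norm_tail_le => //.
    by rewrite qt.
  have := linear_pair_rectangle2 lr2 (measurable_norm_tail (t' + a))
    (measurable_norm_le a) (measurable_norm_tail t').
  rewrite !norm_tailE norm_le_measure -!EFinM -EFinD lee_fin => h2.
  have {}h2 : norm_tail r1 (t' + a) * (1 - norm_tail r1 a) +
     (1 - norm_tail r1 a) * norm_tail r1 (t' + a) <= norm_tail r2 t'.
    apply: h2.
    - move=> x y /= xt ya; rewrite !scale1r.
      have := ler_normB (x + y) y; rewrite addrK; lra.
    - move=> x y /= xt ya; rewrite !scale1r.
      have := ler_normB (x + y) x; rewrite [X in `|X| <= _]addrAC subrr add0r; lra.
    - apply/seteqP; split => // x [/= h3 h4]; lra.
  have p0 := norm_tail_ge0 r1 (t' + a).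
  have : 7 / 8 * norm_tail r1 (t' + a) <= (1 - norm_tail r1 a) * norm_tail r1 (t' + a).
    by apply: ler_wpM2r => //; lra.
  lra.
(* For [t >= 25 * a] one has [(3/2 - 71/50) * t >= 2 * a], hence [sqrt 2 * t < 3/2 * t - a], and
   each step may multiply the radius by 3/2. *)
pose T0 := 25 * a.
have T00 : 0 < T0 by rewrite mulr_gt0.
have p32 n : 1 <= (3 / 2) ^+ n :> R by rewrite exprn_ege1//; lra.
have tail1 n : norm_tail r1 (T0 * (3 / 2) ^+ n) <= (4 / 7) ^+ n.
  elim: n => [|n IH].
    rewrite !expr0 -lee_fin -norm_tailE probability_le1//; exact: measurable_norm_tail.
  pose t := T0 * (3 / 2) ^+ n.
  have tT0 : T0 <= t by rewrite ler_peMr// ltW.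
  have := two t (3 / 2 * t - a); rewrite subrK.
  have -> : T0 * (3 / 2) ^+ n.+1 = 3 / 2 * t by rewrite /t exprS; ring.
  move=> h; rewrite exprS; apply: (@le_trans _ _ (4 / 7 * norm_tail r1 t)).
    apply: h; first by lra.
    have : Num.sqrt 2 * t <= 71 / 50 * t.
      by apply: ler_wpM2r; [lra|exact/ltW/sqrt2_lt].
    rewrite /T0 in tT0; lra.
  by rewrite ler_pM2l.
exists (T0 + b); first by rewrite addr_gt0.
move=> n.
(* Undoing the symmetrization: |X| > t + b and |Y| <= b force |X - Y| > t, and the second event has
   probability at least 1/2. *)
have hb : norm_tail G (T0 * (3 / 2) ^+ n + b) <= 2 * norm_tail r1 (T0 * (3 / 2) ^+ n).
  have := linear_pair_rectangle lr1 (measurable_norm_tail (T0 * (3 / 2) ^+ n + b))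
    (measurable_norm_le b) (measurable_norm_tail (T0 * (3 / 2) ^+ n)).
  rewrite !norm_tailE norm_le_measure -!EFinM lee_fin => h.
  have {}h : norm_tail G (T0 * (3 / 2) ^+ n + b) * (1 - norm_tail G b) <=
      norm_tail r1 (T0 * (3 / 2) ^+ n).
    apply: h => x y /= xt yb; rewrite scale1r scaleN1r.
    have := ler_normD (x - y) y; rewrite subrK; lra.
  have p0 := norm_tail_ge0 G (T0 * (3 / 2) ^+ n + b).
  have : norm_tail G (T0 * (3 / 2) ^+ n + b) * 2^-1 <=
      norm_tail G (T0 * (3 / 2) ^+ n + b) * (1 - norm_tail G b).
    by apply: ler_wpM2l => //; lra.
  lra.
apply: (@le_trans _ _ (norm_tail G (T0 * (3 / 2) ^+ n + b))).
  rewrite -lee_fin -!norm_tailE; apply: measure_le; [exact: measurable_norm_tail..|].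
  move=> x /=; apply: le_lt_trans.
  by rewrite [leRHS]mulrDl lerD2l ler_peMr//; exact: ltW.
by apply: (le_trans hb); rewrite ler_pM2l.
Qed.

(** If [t n] is the last radius below [|x|], then [|x| <= t n.+1], so [|x|] is at most [T] plus the
    sum of [t n.+1] over all [n] with [t n < |x|]. The expected terms are at most
    [3 * T * (6 / 7) ^+ n], with sum [21 * T]. *)
Lemma gaussian_integrable_norm G : tight G -> gaussian G ->
  (\int[G]_x `|x|%:E < +oo)%E.
Proof.
move=> tG gG; have [T T0 hT] := gaussian_norm_tail tG gG.
pose t n := T * (3 / 2) ^+ n.
pose f n (x : borel V) : \bar R := ((t n.+1)%:E * (\1_[set x : V | t n < `|x|] x)%:E)%E.
have t0 n : 0 <= t n by rewrite mulr_ge0 ?exprn_ge0// ltW.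
have mf n : measurable_fun [set: borel V] (f n).
  apply: measurable_funeM; apply/measurable_EFinP; apply: measurable_indic.
  exact: measurable_norm_tail.
have f0 n x : (0 <= f n x)%E by rewrite mule_ge0// lee_fin.
have mnorm : measurable_fun [set: borel V] (fun x : borel V => (`|x : V|)%:E).
  by apply/measurable_EFinP; apply: continuous_borel; exact: norm_continuous.
have msum : measurable_fun [set: borel V] (fun x => \sum_(n <oo) f n x)%E.
  exact: ge0_emeasurable_sum.
apply: (@le_lt_trans _ _ (\int[G]_x (T%:E + \sum_(n <oo) f n x))%E).
  apply: ge0_le_integral => //.
  - exact: emeasurable_funD.
  move=> x _.
  have [N hN] : exists n, `|x : V| <= t n.
    have q1 : `|(3 / 2)^-1 : R| < 1 by rewrite ger0_norm; lra.
    have x0 : 0 < T / (`|x : V| + 1) by rewrite divr_gt0// ltr_wpDl.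
    have [n _ /(_ n (leqnn n)) /= hn] : \forall n \near \oo,
        `|((3 / 2)^-1) ^+ n| < T / (`|x : V| + 1).
      by have /cvgr0Pnorm_lt := cvg_expr q1; apply.
    exists n; move: hn; have p0 : 0 < (3 / 2) ^+ n :> R by rewrite exprn_gt0.
    rewrite ger0_norm ?exprn_ge0// exprVn.
    rewrite ltr_pdivlMr ?ltr_wpDl// mulrC ltr_pdivrMr// => h.
    by apply: (@le_trans _ _ (`|x : V| + 1)); [rewrite lerDl|exact: ltW].
  have [[|n] {}hN minN] := ex_minnP (ex_intro (fun n => `|x : V| <= t n) N hN).
    apply: (@le_trans _ _ T%:E); first by move: hN; rewrite /t expr0 mulr1 lee_fin.
    by rewrite leeDl//; apply: nneseries_ge0.
  have tx : t n < `|x : V|.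
    by rewrite ltNge; apply/negP => /minN; rewrite ltnn.
  apply: (@le_trans _ _ (f n x)).
    by rewrite /f indicE mem_set//= mule1 lee_fin.
  apply: (@le_trans _ _ (\sum_(k <oo) f k x)%E).
    apply: le_trans (nneseries_lim_ge n.+1 _) => //.
    by rewrite big_nat_recr//= leeDr// sume_ge0.
  by rewrite leeDr// lee_fin ltW.
have sum0 x : (0 <= \sum_(n <oo) f n x)%E by exact: nneseries_ge0.
rewrite ge0_integralD//; try by move=> x _; rewrite lee_fin ltW.
rewrite integral_cst_prob integral_nneseries//.
apply: (@le_lt_trans _ _ (T%:E + (21 * T)%:E)%E); last by rewrite -EFinD ltry.
rewrite leeD2l//.
have bound n : (\int[G]_x f n x <= (3 * T * (6 / 7) ^+ n)%:E)%E.
  rewrite ge0_integralZl//; last 2 first.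
  - by apply/measurable_EFinP; apply: measurable_indic; exact: measurable_norm_tail.
  - by rewrite lee_fin.
  rewrite integral_indic//; last exact: measurable_norm_tail.
  rewrite setIT [X in (_ * X)%E](norm_tailE G (t n)) -EFinM lee_fin.
  apply: (@le_trans _ _ (t n.+1 * (2 * (4 / 7) ^+ n))).
    by apply: ler_wpM2l => //; exact: hT.
  rewrite /t exprS (_ : 6 / 7 = 3 / 2 * (4 / 7)); last by lra.
  rewrite (exprMn_comm n (mulrC (3 / 2 : R) (4 / 7))) le_eqVlt.
  by apply/orP; left; apply/eqP; field.
apply: (@le_trans _ _ (\sum_(n <oo) (3 * T * (6 / 7) ^+ n)%:E)%E).
  by apply: lee_nneseries => [n *|n *]; [apply: integral_ge0 => x _|exact: bound].
apply: lime_le.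
  apply: is_cvg_nneseries => n _ _; rewrite lee_fin mulr_ge0 ?exprn_ge0//; lra.
have geo n : \sum_(0 <= k < n) 3 * T * (6 / 7) ^+ k = 21 * T * (1 - (6 / 7) ^+ n).
  elim: n => [|n IH]; first by rewrite big_geq// expr0 subrr mulr0.
  by rewrite big_nat_recr//= IH exprS; field.
near=> n; rewrite sumEFin lee_fin geo.
have : 0 <= (6 / 7) ^+ n :> R by rewrite exprn_ge0.
have T00 := ltW T0.
move=> h; rewrite ler_piMr ?mulr_ge0//; lra.
Unshelve. all: by end_near. Qed.

End tails.

(** * The equality case of Jensen's inequality *)

Section equal_laws.
Context d (T : measurableType d) (R : realType).
Variable P : probability T R.
Variables a b : T -> R.
Hypotheses (ma : measurable_fun [set: T] a) (mb : measurable_fun [set: T] b).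
Hypothesis ab : forall u : R -> R, (forall s, `|u s| <= 1) ->
  (forall s t, `|u s - u t| <= `|s - t|) ->
  (\int[P]_x (u (a x))%:E = \int[P]_x (u (b x))%:E)%E.

Let measurable_comp_lipschitz (u : R -> R) (f : T -> R) :
  (forall s t, `|u s - u t| <= `|s - t|) -> measurable_fun [set: T] f ->
  measurable_fun [set: T] (fun x => (u (f x))%:E).
Proof.
move=> lu mf; apply/measurable_EFinP; apply: (measurableT_comp _ mf).
apply: continuous_measurable_fun; apply: (@lipschitz_continuous _ R^o _ 1) => s t.
by rewrite mul1r; exact: lu.
Qed.

(** Truncate [u] at [n.+1] and divide by [n.+1] to obtain an admissible test function, then let [n]
    grow by monotone convergence. Both integrals may be infinite, which lets
    [lipschitz_law_integrable] transfer integrability from [b] to [a]. *)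
Lemma ge0_lipschitz_integral_eq (u : R -> R) : (forall s, 0 <= u s) ->
  (forall s t, `|u s - u t| <= `|s - t|) ->
  (\int[P]_x (u (a x))%:E = \int[P]_x (u (b x))%:E)%E.
Proof.
move=> u0 lu.
pose un n s := Num.min (u s) n.+1%:R.
have un0 n s : 0 <= un n s by rewrite le_min u0 ler0n.
have lun n s t : `|un n s - un n t| <= `|s - t| by apply: (le_trans (min_lip _ _ _)).
have unE n : (\int[P]_x (un n (a x))%:E = \int[P]_x (un n (b x))%:E)%E.
  have n0 : 0 < n.+1%:R :> R by rewrite ltr0n.
  have nV0 : 0 <= n.+1%:R^-1 :> R by rewrite invr_ge0 ltW.
  have zl (f : T -> R) : measurable_fun [set: T] f ->
     (\int[P]_x (n.+1%:R^-1 * un n (f x))%:E = n.+1%:R^-1%:E * \int[P]_x (un n (f x))%:E)%E.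
    move=> mf; under eq_integral do rewrite EFinM.
    rewrite ge0_integralZl//; last by move=> x _; rewrite lee_fin.
    exact: measurable_comp_lipschitz.
  have := ab (u := fun s => n.+1%:R^-1 * un n s); rewrite zl// zl// => H.
  have {}H : (n.+1%:R^-1%:E * \int[P]_x (un n (a x))%:E =
      n.+1%:R^-1%:E * \int[P]_x (un n (b x))%:E)%E.
    apply: H => [s|s t].
      rewrite ger0_norm ?mulr_ge0// mulrC ler_pdivrMr// mul1r; by rewrite ge_min lexx orbT.
    rewrite -mulrBr normrM ger0_norm//; apply: le_trans (lun n s t).
    by rewrite ler_piMl// invf_le1// ler1n.
  have := congr1 (fun e => n.+1%:R%:E * e)%E H.
  by rewrite !muleA -EFinM divff ?gt_eqF// !mul1e.
have lim (f : T -> R) : measurable_fun [set: T] f ->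
    (\int[P]_x (un n (f x))%:E)%E @[n --> \oo] --> (\int[P]_x (u (f x))%:E)%E.
  move=> mf.
  have -> : (\int[P]_x (u (f x))%:E = \int[P]_x limn (fun n => (un n (f x))%:E))%E.
    apply: eq_integral => x _; apply/esym/cvg_lim => //; apply: cvg_EFin.
      exact: nearW.
    apply: cvg_near_cst; near=> n; rewrite /= /un; apply/min_idPl.
    apply: (@le_trans _ _ n%:R); last by rewrite ler_nat.
    by near: n; exact: nbhs_infty_ger.
  apply: cvg_monotone_convergence => //.
  - by move=> n; exact: measurable_comp_lipschitz.
  - by move=> n x _; rewrite lee_fin.
  - move=> x _ m n mn; rewrite lee_fin /un le_min !ge_min lexx /=.
    by rewrite ler_nat ltnS mn orbT.
apply: (cvg_unique _ (lim _ ma)) => //.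
rewrite (_ : (fun n => _) = (fun n => \int[P]_x (un n (b x))%:E)%E); first exact: lim.
by apply/funext.
Unshelve. all: by end_near. Qed.

Hypothesis ib : P.-integrable [set: T] (EFin \o b).

Lemma lipschitz_law_integrable : P.-integrable [set: T] (EFin \o a).
Proof.
apply/integrableP; split; first exact/measurable_EFinP.
have /integrableP[_] := ib.
have /(_ (fun s => `|s|)) := ge0_lipschitz_integral_eq.
by move=> -> // s t; exact: ler_dist_dist.
Qed.

Lemma lipschitz_law_expectation : (\int[P]_x (a x)%:E = \int[P]_x (b x)%:E)%E.
Proof.
have lmax (s t : R) : `|Num.max s 0 - Num.max t 0| <= `|s - t|.
  rewrite -[Num.max s 0]opprK -[Num.max t 0]opprK !oppr_max oppr0 -opprD normrN.
  apply: (le_trans (min_lip _ _ _)); by rewrite -opprD normrN.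
rewrite integralE [RHS]integralE; congr (_ - _)%E.
- have H := ge0_lipschitz_integral_eq (u := fun s => Num.max s 0) _ lmax.
  have E (f : T -> R) : (\int[P]_x (EFin \o f)^\+ x = \int[P]_x (Num.max (f x) 0)%:E)%E.
    by apply: eq_integral => x _; rewrite funeposE /= -EFin_max.
  by rewrite !E; apply: H => s; rewrite le_max lexx orbT.
- have H := ge0_lipschitz_integral_eq (u := fun s => Num.max (- s) 0).
  have E (f : T -> R) : (\int[P]_x (EFin \o f)^\- x = \int[P]_x (Num.max (- f x) 0)%:E)%E.
    by apply: eq_integral => x _; rewrite funenegE /= -EFin_max.
  rewrite !E; apply: H => [s|s t]; first by rewrite le_max lexx orbT.
  by apply: (le_trans (lmax _ _)); rewrite -opprD normrN.
Qed.

Lemma lipschitz_law_expectationB : (\int[P]_x (a x - b x)%:E = 0)%E.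
Proof.
under eq_integral do rewrite EFinB.
rewrite integralB//; last exact: lipschitz_law_integrable.
rewrite lipschitz_law_expectation subee//; exact: integrable_fin_num.
Qed.

End equal_laws.

Section full_measure.
Context d (T : measurableType d) (R : realType).
Variable P : probability T R.
Variable A : set T.
Hypotheses (mA : measurable A) (PA : P A = 1%E).

Lemma integral_full (f g : T -> R) : measurable_fun [set: T] f ->
  measurable_fun [set: T] g -> (forall x, A x -> f x = g x) ->
  (\int[P]_x (f x)%:E = \int[P]_x (g x)%:E)%E.
Proof.
move=> mf mg fg; apply: ae_eq_integral => //; try exact/measurable_EFinP.
exists (~` A); split; [exact: measurableC| |].
  apply: (etrans (probability_setC P mA)); by rewrite [X in (1 - X)%E]PA subee.
by move=> x /= h Ax; apply: h => _; rewrite fg.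
Qed.

Lemma integral_full0 (f g : T -> R) : measurable_fun [set: T] f ->
  measurable_fun [set: T] g -> (forall x, A x -> f x = g x) ->
  (\int[P]_x (f x)%:E = 0 -> \int[P]_x (g x)%:E = 0)%E.
Proof. by move=> mf mg fg <-; apply/esym/integral_full. Qed.

Lemma product_integrable_fst (f : T -> R) : P.-integrable [set: T] (EFin \o f) ->
  (P \x P)%E.-integrable [set: T * T] (EFin \o (fun p => f p.1)).
Proof.
move=> /integrableP[/measurable_EFinP mf fi].
apply/integrable12ltyP; first by apply/measurable_EFinP; exact: measurableT_comp.
apply: le_lt_trans fi; rewrite le_eqVlt; apply/orP; left; apply/eqP.
by apply: eq_integral => x _ /=; rewrite -abse_EFin integral_cst_prob.
Qed.

Lemma product_integrable_snd (f : T -> R) : P.-integrable [set: T] (EFin \o f) ->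
  (P \x P)%E.-integrable [set: T * T] (EFin \o (fun p => f p.2)).
Proof.
move=> /integrableP[/measurable_EFinP mf fi].
apply/integrable21ltyP; first by apply/measurable_EFinP; exact: measurableT_comp.
apply: le_lt_trans fi; rewrite le_eqVlt; apply/orP; left; apply/eqP.
by apply: eq_integral => x _ /=; rewrite -abse_EFin integral_cst_prob.
Qed.

End full_measure.

Section hypot.
Context {R : realType}.
Implicit Types s t : R.

(** Strictly convex, yet 1-Lipschitz: equality of laws against Lipschitz functions and a first
    moment suffice to integrate it. *)
Definition hypot1 s : R := Num.sqrt (1 + s ^+ 2).

Lemma hypot1_gt0 s : 0 < hypot1 s.
Proof. by rewrite sqrtr_gt0 ltr_wpDr ?sqr_ge0. Qed.

Lemma hypot1_sqr s : hypot1 s ^+ 2 = 1 + s ^+ 2.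
Proof. by rewrite sqr_sqrtr// addr_ge0 ?sqr_ge0. Qed.

Lemma hypot1_slope t : `|t / hypot1 t| <= 1.
Proof.
have h0 := hypot1_gt0 t.
rewrite normrM normfV (gtr0_norm h0) ler_pdivrMr// mul1r.
rewrite -(ler_pXn2r (n := 2))// ?nnegrE ?ltW// hypot1_sqr real_normK ?num_real//.
by rewrite ltrDr.
Qed.

(** Cauchy-Schwarz for the plane vectors (1, s) and (1, t). *)
Lemma one_mul_le_hypot1 s t : 1 + s * t <= hypot1 s * hypot1 t.
Proof.
have hs := hypot1_gt0 s; have ht := hypot1_gt0 t.
rewrite leNgt; apply/negP => h.
have : (hypot1 s * hypot1 t) ^+ 2 < (1 + s * t) ^+ 2.
  by rewrite ltr_pXn2r// nnegrE; [exact: ltW (mulr_gt0 _ _)|apply/ltW/(lt_trans _ h)/mulr_gt0].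
rewrite (exprMn_comm 2 (mulrC (hypot1 s) (hypot1 t))) !hypot1_sqr.
have := sqr_ge0 (s - t); nra.
Qed.

Lemma hypot1_tangentE s t :
  hypot1 s - (hypot1 t + t / hypot1 t * (s - t)) =
  (hypot1 s * hypot1 t - (1 + s * t)) / hypot1 t.
Proof.
have h0 := hypot1_gt0 t.
have h1 : hypot1 t != 0 by rewrite gt_eqF.
have h2 := hypot1_sqr t.
have -> : 1 + s * t = hypot1 t ^+ 2 + t * (s - t) by rewrite h2; ring.
by field.
Qed.

(* Strict convexity of [hypot1]: the graph lies above its tangent at [t], whose
   slope is [t / hypot1 t], and touches it only at [t]. *)
Lemma hypot1_tangent s t : hypot1 t + t / hypot1 t * (s - t) <= hypot1 s.
Proof.
rewrite -subr_ge0 hypot1_tangentE divr_ge0 ?subr_ge0//; last exact/ltW/hypot1_gt0.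
exact: one_mul_le_hypot1.
Qed.

Lemma hypot1_tangent_eq s t : hypot1 t + t / hypot1 t * (s - t) = hypot1 s -> s = t.
Proof.
move=> h; have := hypot1_tangentE s t; rewrite h subrr => /esym/eqP.
have ht := hypot1_gt0 t.
rewrite mulf_eq0 invr_eq0 (gt_eqF ht) orbF subr_eq0 => /eqP e.
apply/eqP; rewrite -subr_eq0 -sqrf_eq0; apply/eqP.
have := congr1 (fun z => z ^+ 2) e; rewrite /=.
rewrite (exprMn_comm 2 (mulrC (hypot1 s) (hypot1 t))) !hypot1_sqr => {}e.
have -> : (s - t) ^+ 2 = (1 + s ^+ 2) * (1 + t ^+ 2) - (1 + s * t) ^+ 2 by ring.
by rewrite e subrr.
Qed.

Lemma hypot1_lipschitz s t : `|hypot1 s - hypot1 t| <= `|s - t|.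
Proof.
wlog st : s t / hypot1 s <= hypot1 t.
  by move=> H; have [/H//|/ltW/H] := leP (hypot1 s) (hypot1 t); rewrite distrC (distrC t).
rewrite distrC ger0_norm ?subr_ge0//.
apply: (@le_trans _ _ (t / hypot1 t * (t - s))).
  by have := hypot1_tangent s t; rewrite -[s - t]opprB mulrN; lra.
apply: (le_trans (ler_norm _)); rewrite normrM -[leRHS]mul1r distrC.
by rewrite ler_wpM2r// hypot1_slope.
Qed.

End hypot.

Section jensen.
Context {R : realType} {V : normedModType R}.
Variable G : probability (borel V) R.
Hypothesis tG : tight G.
Hypothesis subS : vector_subspace (law_support G).
Hypothesis iG : (\int[G]_x `|x|%:E < +oo)%E.
Variables (psi : V -> R) (M : R).
Hypothesis cpsi : continuous psi.
Hypothesis M0 : 0 <= M.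
Hypothesis psiM : forall x, law_support G x -> `|psi x| <= M * `|x|.
Hypothesis hpsi : forall y, law_support G y -> forall u : R -> R,
  (forall s, `|u s| <= 1) -> (forall s t, `|u s - u t| <= `|s - t|) ->
  (\int[G]_x (u (psi (y + x) - psi y))%:E = \int[G]_x (u (psi x))%:E)%E.

Let S := law_support G.

Let mS : measurable (S : set (borel V)).
Proof. by apply: closed_borel; exact: law_support_closed. Qed.

Let GS : G S = 1%E.
Proof. by apply: law_support_full => //; exists 0; case: subS. Qed.

Let norm_integrable : G.-integrable [set: borel V] (fun x => `|x : V|%:E).
Proof.
apply/integrableP; split.
  by apply/measurable_EFinP; apply: continuous_borel; exact: norm_continuous.
by under eq_integral do rewrite /= normr_id.
Qed.

Let psi_integrable : G.-integrable [set: borel V] (EFin \o psi).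
Proof.
have mpsi : measurable_fun [set: borel V] (psi : borel V -> R) by exact: continuous_borel.
have mn : measurable_fun [set: borel V] ((fun x => `|x|) : borel V -> R).
  by apply: continuous_borel; exact: norm_continuous.
apply/integrableP; split; first exact/measurable_EFinP.
have mnpsi : measurable_fun [set: borel V] ((fun x => `|psi x|) : borel V -> R).
  exact: measurableT_comp.
have mmin : measurable_fun [set: borel V]
    ((fun x => Num.min `|psi x| (M * `|x|)) : borel V -> R).
  by apply: measurable_minr => //; exact: measurable_funM.
under eq_integral do rewrite /=.
(* The growth bound holds on [S] only; this minimum is measurable, equals [|psi x|] on [S] and is
   dominated by [M * |x|] everywhere. *)
rewrite (integral_full mS GS (g := fun x => Num.min `|psi x| (M * `|x|)))//; last first.
  by move=> x Sx; rewrite min_l// psiM.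
apply: (@le_lt_trans _ _ (\int[G]_x (M%:E * `|x : V|%:E))%E).
  apply: ge0_le_integral => //.
  - by move=> x _; rewrite lee_fin le_min normr_ge0 mulr_ge0.
  - exact/measurable_EFinP.
  - by apply: measurable_funeM; exact/measurable_EFinP.
  - by move=> x _; rewrite -EFinM lee_fin ge_min lexx orbT.
rewrite ge0_integralZl//; last exact/measurable_EFinP.
by rewrite lte_mul_pinfty.
Qed.

Let cshift y : continuous (fun x => psi (y + x) - psi y).
Proof.
move=> x; apply: cvgB; last exact: cvg_cst.
apply: continuous_comp; last exact: cpsi.
by apply: cvgD; [exact: cvg_cst|exact: cvg_id].
Qed.

Let hypot1_continuous : continuous (@hypot1 R).
Proof.
apply: (@lipschitz_continuous _ R^o _ 1) => s t; rewrite mul1r; exact: hypot1_lipschitz.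
Qed.

Let integral_increment y : S y -> (\int[G]_x (psi (y + x) - psi y - psi x)%:E = 0)%E.
Proof.
move=> Sy.
exact: (lipschitz_law_expectationB (continuous_borel (@cshift y))
  (continuous_borel cpsi) (hpsi Sy) psi_integrable).
Qed.

Let integral_hypot1 y : S y ->
  (\int[G]_x (hypot1 (psi (y + x) - psi y) - hypot1 (psi x))%:E = 0)%E.
Proof.
move=> Sy.
have ms : measurable_fun [set: borel V] ((fun x => psi (y + x) - psi y) : borel V -> R).
  by apply: continuous_borel; exact: cshift.
have mp : measurable_fun [set: borel V] (psi : borel V -> R) by exact: continuous_borel.
have ihyp (f : borel V -> R) : measurable_fun [set: borel V] f ->
    G.-integrable [set: borel V] (EFin \o f) ->
    G.-integrable [set: borel V] (EFin \o (fun x => hypot1 (f x))).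
  move=> mf fi.
  have fi' := integrableD measurableT (integrable_cst G 1) (integrable_abse fi).
  apply: (le_integrable measurableT _ _ fi').
    apply/measurable_EFinP; apply: (measurableT_comp _ mf).
    exact: continuous_measurable_fun.
  move=> x _ /=; rewrite lee_fin.
  rewrite (gtr0_norm (hypot1_gt0 _)) ger0_norm ?addr_ge0//.
  have := hypot1_lipschitz (f x) 0; rewrite subr0.
  rewrite /hypot1 expr0n/= addr0 sqrtr1 ler_norml => /andP[_]; lra.
under eq_integral do rewrite EFinB.
rewrite integralB//; last 2 first.
- apply: ihyp => //.
  exact: (lipschitz_law_integrable ms mp (hpsi Sy) psi_integrable).
- exact: ihyp.
have u0 s : 0 <= hypot1 s :> R by exact/ltW/hypot1_gt0.
rewrite (ge0_lipschitz_integral_eq ms mp (hpsi Sy) u0)//; last exact: hypot1_lipschitz.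
rewrite subee//; apply: (integrable_fin_num measurableT); exact: ihyp.
Qed.

Let defect (p : V * V) := psi (p.1 + p.2) - psi p.1 - psi p.2.

Let continuous_defect : continuous defect.
Proof.
have c1 : continuous (fun p : V * V => p.1) by move=> p; exact: cvg_fst.
have c2 : continuous (fun p : V * V => p.2) by move=> p; exact: cvg_snd.
move=> p; apply: cvgB; first apply: cvgB.
- apply: continuous_comp; last exact: cpsi.
  by apply: cvgD; [exact: c1|exact: c2].
- by apply: continuous_comp; [exact: c1|exact: cpsi].
- by apply: continuous_comp; [exact: c2|exact: cpsi].
Qed.

Let slope (t : R) := t / hypot1 t.

Let continuous_slope : continuous slope.
Proof.
move=> t; apply: cvgM; first exact: cvg_id.
by apply: cvgV; [rewrite gt_eqF// hypot1_gt0|exact: hypot1_continuous].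
Qed.

(** For a fixed second coordinate in [S] it has mean zero in the first, since [psi (x + y) - psi y]
    and [psi x] have the same law; [rise_integral] therefore integrates over the first coordinate
    first. *)
Let rise (p : V * V) := hypot1 (psi (p.1 + p.2) - psi p.2) - hypot1 (psi p.1).

Let continuous_rise : continuous rise.
Proof.
have c1 : continuous (fun p : V * V => p.1) by move=> p; exact: cvg_fst.
have c2 : continuous (fun p : V * V => p.2) by move=> p; exact: cvg_snd.
move=> p; apply: cvgB; last first.
  apply: continuous_comp; last exact: hypot1_continuous.
  by apply: continuous_comp; [exact: c1|exact: cpsi].
apply: continuous_comp; last exact: hypot1_continuous.
apply: cvgB; last by apply: continuous_comp; [exact: c2|exact: cpsi].
apply: continuous_comp; last exact: cpsi.
by apply: cvgD; [exact: c1|exact: c2].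
Qed.

(** The tangent-line part of [rise] at [psi p.1]. For a fixed first coordinate in [S] the slope is
    constant and [defect] has mean zero in the second, so [tilt_integral] uses the other order of
    integration. *)
Let tilt (p : V * V) := slope (psi p.1) * defect p.

Let continuous_tilt : continuous tilt.
Proof.
have c1 : continuous (fun p : V * V => p.1) by move=> p; exact: cvg_fst.
move=> p; apply: cvgM; last exact: continuous_defect.
apply: continuous_comp; last exact: continuous_slope.
by apply: continuous_comp; [exact: c1|exact: cpsi].
Qed.

Let defectE p : defect p = psi (p.1 + p.2) - psi p.2 - psi p.1.
Proof. by rewrite /defect; ring. Qed.

Let tilt_le_rise p : tilt p <= rise p.
Proof.
rewrite /tilt /rise defectE.
have := hypot1_tangent (psi (p.1 + p.2) - psi p.2) (psi p.1); rewrite /slope; lra.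
Qed.

Let tilt_lt_rise p : defect p != 0 -> tilt p < rise p.
Proof.
move=> d0; rewrite lt_neqAle tilt_le_rise andbT; apply: contra d0 => /eqP e.
rewrite defectE subr_eq0; apply/eqP; apply: hypot1_tangent_eq.
move: e; rewrite /tilt /rise defectE /slope; lra.
Qed.

Let defect_bound p : S p.1 -> S p.2 -> `|defect p| <= 2 * M * (`|p.1| + `|p.2|).
Proof.
move=> S1 S2; have S12 : S (p.1 + p.2).
  by rewrite -[p.1]scale1r; apply: subS.2.
apply: (le_trans (ler_normB _ _)); apply: (le_trans (lerD (ler_normB _ _) (lexx _))).
have := psiM S12; have := psiM S1; have := psiM S2.
have : M * `|p.1 + p.2| <= M * (`|p.1| + `|p.2|) by rewrite ler_wpM2l// ler_normD.
lra.
Qed.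

Let tilt_bound p : `|tilt p| <= `|defect p|.
Proof.
by rewrite normrM -[leRHS]mul1r ler_wpM2r// hypot1_slope.
Qed.

Let rise_bound p : `|rise p| <= `|defect p|.
Proof. by rewrite defectE; exact: hypot1_lipschitz. Qed.

Let separable_full_support : exists A : set V,
  [/\ measurable (A : set (borel V)), G A = 1%E, separable_set A & A `<=` S].
Proof.
have [A [mA GA [u hu]]] := tight_separable tG.
exists (A `&` S); split; first exact: measurableI.
- by rewrite probability_setI_full.
- by exists u => x e [Ax _]; exact: hu.
- by move=> x [].
Qed.

Section restriction.
Variable A : set V.
Hypotheses (mA : measurable (A : set (borel V))) (GA : G A = 1%E).
Hypotheses (sA : separable_set A) (AS : A `<=` S).

Let mAA : measurable (A `*` A : set (borel V * borel V)).
Proof. exact: measurableX. Qed.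

(** Extension by zero from the square of [A], where continuity implies product measurability. *)
Let cut (f : V * V -> R) : borel V * borel V -> R :=
  (f : borel V * borel V -> R) \_ (A `*` A).

Let measurable_cut f : continuous f -> measurable_fun [set: borel V * borel V] (cut f).
Proof.
move=> cf; apply/(measurable_restrictT _ mAA); exact: continuous_setX_measurable.
Qed.

Let cut_integrable f : continuous f -> (forall p, `|f p| <= `|defect p|) ->
  (G \x G)%E.-integrable [set: borel V * borel V] (EFin \o cut f).
Proof.
move=> cf fd.
have i1 := product_integrable_fst norm_integrable.
have i2 := product_integrable_snd norm_integrable.
have i12 := integrableZl measurableT (2 * M) (integrableD measurableT i1 i2).
apply: (le_integrable measurableT _ _ i12).
  by apply/measurable_EFinP; exact: measurable_cut.
move=> [x y] _; rewrite /= lee_fin /cut patchE.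
rewrite [leRHS]ger0_norm ?mulr_ge0 ?addr_ge0//.
case: ifPn => [/set_mem[/= Ax Ay]|_]; last by rewrite normr0 mulr_ge0 ?addr_ge0// mulr_ge0.
by apply: (le_trans (fd _)); apply: defect_bound; exact: AS.
Qed.

Let rise_integral : (\int[G \x G]_p (cut rise p)%:E = 0)%E.
Proof.
apply: (etrans (esym (integral21_prod_meas1 (cut_integrable continuous_rise rise_bound)))).
apply: integral0_eq => y _; rewrite /fubini_G /=.
have [Ay|nAy] := pselect (A y); last first.
  apply: integral0_eq => x _; rewrite /cut patchE; case: ifPn => // /set_mem[] /=.
  by [].
have := integral_hypot1 (AS Ay).
apply: (integral_full0 mA GA).
- apply: continuous_borel => x; apply: cvgB.
    by apply: continuous_comp; [exact: cshift|exact: hypot1_continuous].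
  by apply: continuous_comp; [exact: cpsi|exact: hypot1_continuous].
- by apply: measurableT_comp (pair2_measurable _); exact: measurable_cut.
- by move=> x Ax; rewrite /cut patchE mem_set// /rise /= (addrC x).
Qed.

Let tilt_integral : (\int[G \x G]_p (cut tilt p)%:E = 0)%E.
Proof.
apply: (etrans (esym (integral12_prod_meas1 (cut_integrable continuous_tilt tilt_bound)))).
apply: integral0_eq => x _; rewrite /fubini_F /=.
have [Ax|nAx] := pselect (A x); last first.
  apply: integral0_eq => y _; rewrite /cut patchE; case: ifPn => // /set_mem[] /=.
  by [].
have : (\int[G]_y (slope (psi x) * (psi (x + y) - psi x - psi y))%:E = 0)%E.
  have h0 := integral_increment (AS Ax).
  under eq_integral do rewrite EFinM.
  rewrite integralZl// ?h0 ?mule0//.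
  exact: (integrableB measurableT (lipschitz_law_integrable (continuous_borel (@cshift x))
    (continuous_borel cpsi) (hpsi (AS Ax)) psi_integrable) psi_integrable).
apply: (integral_full0 mA GA).
- apply: continuous_borel => y; apply: cvgM; first exact: cvg_cst.
  by apply: cvgB; [exact: cshift|exact: cpsi].
- by apply: measurableT_comp (pair1_measurable _); exact: measurable_cut.
- by move=> y Ay; rewrite /cut patchE mem_set.
Qed.

(** Were the defect nonzero, the nonnegative continuous [gap] would exceed some [c > 0] on a product
    of balls around [x] and [y]; both balls have positive mass, as their centres are in the support,
    and the mean of the gap would not be zero. *)
Lemma defect_eq0 x y : S x -> S y -> defect (x, y) = 0.
Proof.
move=> Sx Sy; apply/eqP/negPn/negP => /tilt_lt_rise lt.
pose gap p := rise p - tilt p.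
have cgap : continuous gap.
  by move=> p; apply: cvgB; [exact: continuous_rise|exact: continuous_tilt].
pose c := gap (x, y) / 2.
have g0 : 0 < gap (x, y) by rewrite subr_gt0.
have c0 : 0 < c by rewrite divr_gt0.
have : \forall p \near (x, y), c < gap p.
  have : gap (x, y) > c by rewrite /c; lra.
  by move=> h; apply: (cvgr_gt _ (cgap (x, y))).
case=> -[U W] /= [Ux Wy] UW.
have [dU dU0 {}Ux] := (nbhs_ballP _ _).1 Ux.
have [dW dW0 {}Wy] := (nbhs_ballP _ _).1 Wy.
have pos z (e : R) : S z -> 0 < e -> (0 < G (A `&` ball z e))%E.
  move=> Sz e0; rewrite probability_setI_full//; last first.
    by apply: open_borel; exact: ball_open.
  by apply: Sz; [exact: ball_open|exact: ballxx].
have mB z (e : R) : 0 < e -> measurable (A `&` ball z e : set (borel V)).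
  by move=> e0; apply: measurableI => //; apply: open_borel; exact: ball_open.
pose C := ((A `&` ball x dU) `*` (A `&` ball y dW) : set (borel V * borel V)).
have mC : measurable C by apply: measurableX; exact: mB.
have : (\int[G \x G]_p (cut gap p)%:E = 0)%E.
  rewrite (_ : (fun p => _) = (fun p => (cut rise p)%:E - (cut tilt p)%:E)%E).
    rewrite integralB//; try exact: cut_integrable.
    by rewrite rise_integral tilt_integral subee.
  apply/funext => p; rewrite -EFinB; congr EFin; rewrite /cut !patchE.
  by case: ifPn; rewrite ?subrr.
apply/eqP; rewrite gt_eqF//.
apply: (@lt_le_trans _ _ (c%:E * (G \x G)%E C)%E).
  rewrite mule_gt0//.
  rewrite [X in (0 < X)%E](product_measure1E G G (mB x _ dU0) (mB y _ dW0)).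
  by apply: mule_gt0; exact: pos.
have -> : (c%:E * (G \x G)%E C = \int[G \x G]_p (c%:E * (\1_C p)%:E))%E.
  rewrite ge0_integralZl//; last 2 first.
  - by apply/measurable_EFinP; exact: measurable_indic.
  - by rewrite lee_fin ltW.
  by rewrite integral_indic// setIT.
apply: ge0_le_integral => //.
- by move=> p _; rewrite mule_ge0// lee_fin ltW.
- by apply: measurable_funeM; apply/measurable_EFinP; exact: measurable_indic.
- by apply/measurable_EFinP; exact: measurable_cut.
move=> [a b] _; rewrite -EFinM lee_fin indicE /cut patchE.
case: ifPn => [_|nAA].
  case: (boolP ((a, b) \in C)) => [/set_mem[[_ Ba] [_ Bb]]|_]; last by rewrite mulr0 subr_ge0.
  by rewrite mulr1 ltW//; apply: (UW (a, b)); split; [exact: Ux|exact: Wy].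
case: (boolP ((a, b) \in C)) => [/set_mem[[Aa _] [Ab _]]|_]; last by rewrite mulr0.
by move/negP: nAA; case; apply: mem_set.
Qed.

End restriction.

Lemma additive_of_increment_law x y : S x -> S y -> psi (x + y) = psi x + psi y.
Proof.
move=> Sx Sy; have [A [mA GA sA AS]] := separable_full_support.
have := defect_eq0 mA GA sA AS Sx Sy.
rewrite /defect /=; lra.
Qed.

End jensen.

(** * Additivity of the derivative *)

Section homogeneous.
Context {R : realType} {D E : normedModType R}.
Variables (S : set D) (f : D -> E).
Hypothesis subS : vector_subspace S.
Hypothesis homf : forall x (c : R), S x -> 0 < c -> f (c *: x) = c *: f x.

Lemma subspaceZ (c : R) x : S x -> S (c *: x).
Proof. by move=> Sx; rewrite -[c *: x]addr0; apply: subS.2 => //; exact: subS.1. Qed.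

Lemma homogeneous0 : f 0 = 0.
Proof.
have := homf subS.1 (ltr0Sn R 1); rewrite scaler0 scaler_nat mulr2n => /eqP.
by rewrite -subr_eq0 opprD addrA subrr sub0r oppr_eq0 => /eqP.
Qed.

Lemma linear_on_of_additive : (forall x y, S x -> S y -> f (x + y) = f x + f y) ->
  linear_on S f.
Proof.
move=> addf.
have oppf x : S x -> f (- x) = - f x.
  move=> Sx; apply/eqP; rewrite -addr_eq0 -addf//; last first.
    by rewrite -scaleN1r; exact: subspaceZ.
  by rewrite addNr homogeneous0.
have scf c x : S x -> f (c *: x) = c *: f x.
  move=> Sx; case: (ltgtP c 0) => [c0|c0|->].
  - rewrite -[c in LHS]opprK scaleNr oppf; last exact: subspaceZ.
    by rewrite homf ?oppr_gt0// scaleNr opprK.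
  - exact: homf.
  - by rewrite !scale0r homogeneous0.
by move=> c x y Sx Sy _; rewrite addf ?scf//; exact: subspaceZ.
Qed.

(** Continuity at 0 bounds [f] by 1 on a small ball, and rescaling to radius [e / 2] spreads this to
    all of [S]. *)
Lemma homogeneous_linear_growth : continuous f ->
  exists2 M : R, 0 <= M & forall x, S x -> `|f x| <= M * `|x|.
Proof.
move=> cf; have : f x @[x --> (0 : D)] --> f 0 by exact: cf.
rewrite homogeneous0 => /cvgr0_norm_lt /(_ 1 ltr01).
move=> /nbhs_normP[e /= e0 he].
have e20 : 0 < e / 2 by rewrite divr_gt0.
exists (2 / e) => [|x Sx]; first by rewrite divr_ge0// ltW.
have [->|x0] := eqVneq x 0; first by rewrite homogeneous0 !normr0 mulr0.
have nx : 0 < `|x| by rewrite normr_gt0.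
pose c := e / 2 / `|x|.
have c0 : 0 < c by rewrite divr_gt0.
have /ltW : `|f (c *: x)| < 1.
  apply: he; rewrite /ball_/= sub0r normrN normrZ (gtr0_norm c0) /c divfK ?gt_eqF//; lra.
rewrite homf// normrZ (gtr0_norm c0) mulrC -ler_pdivlMr// => /le_trans; apply.
rewrite le_eqVlt; apply/orP; left; apply/eqP; rewrite /c; field.
by rewrite !gt_eqF.
Qed.

End homogeneous.

Lemma gaussian_increment_law_additive (R : realType) (D E : completeNormedModType R)
    (G : probability (borel D) R) (dphi : D -> E) :
  tight G -> gaussian G -> vector_subspace (law_support G) -> continuous dphi ->
  (forall x (c : R), law_support G x -> 0 < c -> dphi (c *: x) = c *: dphi x) ->
  (forall h f, law_support G h -> BL1 E f ->
    (\int[G]_z (f (dphi (h + z) - dphi h)%R)%:E = \int[G]_z (f (dphi z))%:E)%E) ->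
  forall x y, law_support G x -> law_support G y -> dphi (x + y) = dphi x + dphi y.
Proof.
move=> tG gG subS cdphi homd H x y Sx Sy.
have [M M0 hM] := homogeneous_linear_growth subS homd cdphi.
apply/eqP; rewrite -subr_eq0 -normr_eq0.
(* The functional is chosen to norm the very vector that should vanish; since [|l e| <= |e|],
   composing it with a scalar test function stays in [BL1 E]. *)
have [l [cl l1 <-]] := norming_functional (dphi (x + y) - (dphi x + dphi y)).
have := @additive_of_increment_law _ _ G tG subS (gaussian_integrable_norm tG gG)
  (fun z => l (dphi z)) M _ M0 _ _ x y Sx Sy.
rewrite linearB linearD subr_eq0 => -> //.
- by move=> z; apply: continuous_comp; [exact: cdphi|exact: cl].
- by move=> z Sz; apply: (le_trans (l1 _)); exact: hM.
- move=> h Sh u u1 lu.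
  have /(_ h (fun e => u (l e)) Sh) := H.
  under eq_integral do rewrite linearB.
  apply; split => [e|a b]; first exact: u1.
  apply: (le_trans (lu _ _)); rewrite -linearB; exact: l1.
Qed.

Theorem theorem3p1
  (R : realType) (D E : completeNormedModType R)
  (D0 Dphi : set D) (theta0 : D) (htheta0 : Dphi theta0)
  (phi : D -> E) (dphi : D -> E)
  (hphi : is_hadamard_directional_derivative phi Dphi theta0 D0 dphi)
  (hdphi : continuous dphi)
  (* PX n, PW n, PXW n: laws of the data, the weights, and both jointly *)
  (dX dW : measure_display) (X : measurableType dX) (W : measurableType dW)
  (PX : forall n : nat, probability (n.-tuple X) R)
  (PW : forall n : nat, probability (n.-tuple W) R)
  (PXW : forall n : nat, probability (n.-tuple X * n.-tuple W)%type R)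
  (theta_hat : forall n : nat, n.-tuple X -> D)
  (htheta_hat : forall n x, Dphi (theta_hat n x))
  (r : nat -> R) (r_nd : nondecreasing_seq r) (r_oo : r @ \oo --> +oo)
  (G0 : probability (borel D) R)
  (hcvg : cvg_in_law (T := fun n => n.-tuple X) PX
    (fun n x => r n *: (theta_hat n x - theta0)) G0)
  (hG0_tight : tight G0) (hG0_D0 : law_support G0 `<=` D0)
  (theta_star : forall n : nat, n.-tuple X -> n.-tuple W -> D)
  (htheta_star : forall n x w, Dphi (theta_star n x w))
  (hindep : forall n, independent_joint_law (PXW n) (PX n) (PW n))
  (hboot : cvg_to0_in_outer_probability (T := fun n => n.-tuple X) PX
    (fun n x => ereal_sup
      [set `| outer_expectation (PW n)
                (fun w => f (r n *: (theta_star n x w - theta_hat n x)))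
              - \int[G0]_z (f z)%:E |%E | f in BL1 D]))
  (hasym : asymptotically_measurable
    (T := fun n => (n.-tuple X * n.-tuple W)%type) PXW
    (fun n xw => r n *: (theta_star n xw.1 xw.2 - theta_hat n xw.1)))
  (hmeas : forall n (f : D -> R), bounded_continuous f ->
    {ae PX n, forall x, measurable_fun [set: n.-tuple W]
      (fun w => f (r n *: (theta_star n x w - theta_hat n x)))})
  (hG0_gauss : gaussian G0) (hG0_sub : vector_subspace (law_support G0)) :
  hadamard_differentiable phi Dphi theta0 (law_support G0) <->
  cvg_to0_in_outer_probability (T := fun n => n.-tuple X) PX
    (fun n x => ereal_sup
      [set `| outer_expectation (PW n)
                (fun w => f (r n *: (phi (theta_star n x w)
                                     - phi (theta_hat n x))))
              - \int[G0]_z (f (dphi z))%:E |%E | f in BL1 E]).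
Proof.
have cont h := @support_contingent _ _ _ _ _ _ (fun n => n.-tuple X) _ _ htheta_hat
  _ r_oo hcvg h.
split=> [[psi hpsi]|hcons].
  (* The assumed derivative [psi] is a priori a different map. Directions in the support are
     contingent, so it agrees there with [dphi], which inherits its linearity. *)
  have psiE h : law_support G0 h -> psi h = dphi h.
    by move=> Sh; apply: (hadamard_derivative_unique hphi Sh (hG0_D0 _ Sh) hpsi); exact: cont.
  apply: (@bootstrap_of_linear _ _ _ _ _ _ _ _ hphi hdphi _ hG0_tight hG0_D0 hG0_sub
    _ _ (fun n => n.-tuple X) (fun n => n.-tuple W)) => //.
  have [_ lin _] := hpsi.
  by move=> a x y Sx Sy Sxy; rewrite -!psiE//; exact: lin.
have homd x (c : R) : law_support G0 x -> 0 < c -> dphi (c *: x) = c *: dphi x.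
  move=> Sx c0; apply: (directional_derivative_homogeneous hphi c0); [exact: hG0_D0| |exact: cont].
  by apply: hG0_D0; exact: (subspaceZ hG0_sub).
apply: (linear_hadamard_differentiable hphi) => //.
apply: linear_on_of_additive => //.
apply: (gaussian_increment_law_additive hG0_tight hG0_gauss) => //.
exact: (@increment_law_of_bootstrap _ _ _ _ _ _ _ _ hphi hdphi _ hG0_tight hG0_D0 hG0_sub
    _ _ (fun n => n.-tuple X) (fun n => n.-tuple W) _ _ _ _ htheta_hat htheta_star _ r_oo
    hcvg hboot hcons).
Qed.
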